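(* Let $N\ge1$, $\alpha\in(0,1]$, and let $(r_n)_{n\ge0}$ satisfy $0\le r_n<1$ and $\lim_{n\to\infty}n^\gamma r_n=c>0$ for some $\gamma\in(\tfrac12,1]$. Let $Z_n(i)\in[0,1]$ ($i=1,\dots,N$, $n\ge0$) evolve by $Z_{n+1}(i)=(1-r_n)Z_n(i)+r_n I_{n+1}(i)$, where, with $\mathcal F_n=\sigma(Z_k(i):\,1\le i\le N,\ 0\le k\le n)$ and $Z_n=\frac1N\sum_{i=1}^N Z_n(i)$, the $I_{n+1}(1),\dots,I_{n+1}(N)\in\{0,1\}$ are conditionally independent given $\mathcal F_n$ with $P(I_{n+1}(i)=1\mid\mathcal F_n)=(1-\alpha)Z_n(i)+\alpha Z_n$. Assume the law of $(Z_0(1),\dots,Z_0(N))$ is permutation invariant, $E[Z_0(i)]=\tfrac12$ and $E[Z_0(1-Z_0)]>0$. Let $Z$ be the almost sure limit of $Z_n$ and fix $i\in\{1,\dots,N\}$. (i) If $\tfrac12<\gamma<1$, then \[\Big(n^{\gamma/2}e^{c\alpha t}\big(Z_{\lfloor n+n^\gamma t\rfloor}(i)-Z_{\lfloor n+n^\gamma t\rfloor}\big)\Big)_{t\ge0}\xrightarrow{d}(W_{V_t})_{t\ge0},\quad V_t=\Big(1-\frac1N\Big)\frac{cZ(1-Z)}{2\alpha}e^{2c\alpha t}.\] (ii) If $\gamma=1$ and $2c\alpha>1$, then \[\Big(n^{1/2}(1+t)^{c\alpha}\big(Z_{\lfloor n+nt\rfloor}(i)-Z_{\lfloor n+nt\rfloor}\big)\Big)_{t\ge0}\xrightarrow{d}(W_{V_t})_{t\ge0},\quad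 V_t=\Big(1-\frac1N\Big)\frac{c^2Z(1-Z)}{2c\alpha-1}(1+t)^{2c\alpha-1}.\] In both cases $W=(W_t)_{t\ge0}$ is a standard Brownian motion independent of $V=(V_t)_{t\ge0}$, and convergence in distribution is with respect to the Skorohod topology on $D[0,+\infty)$.
   Context: This is the interacting model with $\rho=1$; the almost sure limit $Z$ of $Z_n$ exists since $(Z_n)$ is then a bounded martingale. *)

(* Defs.v *)
From HB Require Import structures.
From mathcomp Require Import all_boot all_order all_algebra.
From mathcomp Require Import all_classical all_reals all_analysis.
Set Implicit Arguments. Unset Strict Implicit. Unset Printing Implicit Defensive.
Import Order.TTheory GRing.Theory Num.Theory.
Import numFieldNormedType.Exports.
Local Open Scope classical_set_scope.
Local Open Scope ring_scope.

Section defs.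
Context {R : realType}.

Definition cadlag (x : R -> R) : Prop :=
  forall t, 0 <= t -> x @ t^'+ --> x t /\ (0 < t -> cvg (x @ t^'-)).

Definition time_change (lam : R -> R) : Prop :=
  (forall s t, 0 <= s -> s < t -> lam s < lam t) /\
  {within [set t | 0 <= t], continuous lam} /\
  (forall t, 0 <= t -> 0 <= lam t) /\
  (forall u, 0 <= u -> exists2 t, 0 <= t & lam t = u).

(** Convergence in the Skorohod J1 topology of D[0,+oo)
    (Billingsley, Convergence of Probability Measures, Thm 16.2) *)
Definition skorohod_cvg (xs : nat -> R -> R) (x : R -> R) : Prop :=
  exists lam : nat -> R -> R,
    (forall n, time_change (lam n)) /\
    (forall e : R, 0 < e ->
       \forall n \near \oo, forall t, 0 <= t -> `|lam n t - t| <= e) /\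
    (forall m e : R, 0 < e ->
       \forall n \near \oo, forall t, 0 <= t <= m ->
         `|xs n (lam n t) - x t| <= e).

(** continuity of a functional on D[0,+oo) for the Skorohod topology
    (metrizable, hence sequential continuity) *)
Definition skorohod_continuous (F : (R -> R) -> R) : Prop :=
  forall (xs : nat -> R -> R) (x : R -> R),
    (forall n, cadlag (xs n)) -> cadlag x -> skorohod_cvg xs x ->
    F (xs n) @[n --> \oo] --> F x.

Definition cvg_dist_skorohod d (T : measurableType d) (P : probability T R)
  (X : nat -> T -> R -> R) d' (T' : measurableType d') (P' : probability T' R)
  (Y : T' -> R -> R) : Prop :=
  forall F : (R -> R) -> R,
    (exists M : R, forall x, `|F x| <= M) -> skorohod_continuous F ->
    (forall n, measurable_fun setT (F \o X n)) -> measurable_fun setT (F \o Y) ->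
    (fun n => \int[P]_w (F (X n w))%:E)%E @ \oo --> (\int[P']_w (F (Y w))%:E)%E.

Definition BM_indep_of d' (T' : measurableType d') (P' : probability T' R)
  (W : R -> T' -> R) (Z' : T' -> R) : Prop :=
  (forall t, measurable_fun setT (W t)) /\ measurable_fun setT Z' /\
  (forall w, W 0 w = 0) /\
  (forall w, {within [set t | 0 <= t], continuous (fun t => W t w)}) /\
  (forall (k : nat) (ts : 'I_k.+1 -> R) (B : 'I_k -> set R) (A : set R),
     ts ord0 = 0 ->
     (forall j : 'I_k, ts (widen_ord (leqnSn k) j) < ts (lift ord0 j)) ->
     measurable A -> (forall j, measurable (B j)) ->
     P' (Z' @^-1` A `&`
         [set w | forall j : 'I_k,
            B j (W (ts (lift ord0 j)) w - W (ts (widen_ord (leqnSn k) j)) w)])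
     = (P' (Z' @^-1` A) *
        \prod_(j < k) normal_prob 0
            (Num.sqrt (ts (lift ord0 j) - ts (widen_ord (leqnSn k) j))) (B j))%E).

Definition same_law d (T : measurableType d) (P : probability T R) (Z : T -> R)
  d' (T' : measurableType d') (P' : probability T' R) (Z' : T' -> R) : Prop :=
  forall B : set R, measurable B -> P' (Z' @^-1` B) = P (Z @^-1` B).

Definition avg (N : nat) (T : Type) (Zi : nat -> 'I_N -> T -> R) (n : nat) (w : T) : R :=
  (N%:R)^-1 * \sum_(i < N) Zi n i w.

Definition nat_filt d (T : measurableType d) (N : nat) (Zi : nat -> 'I_N -> T -> R)
  (n : nat) : set (set T) :=
  <<s [set A | exists k (i : 'I_N) (B : set R),
               (k <= n)%N /\ measurable B /\ A = Zi k i @^-1` B] >>.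

Definition interacting_model d (T : measurableType d) (P : probability T R)
  (N : nat) (alpha : R) (r : nat -> R)
  (Zi : nat -> 'I_N -> T -> R) (I : nat -> 'I_N -> T -> R) : Prop :=
  (forall n i, measurable_fun setT (Zi n i)) /\
  (forall n i, measurable_fun setT (I n i)) /\
  (forall n i w, 0 <= Zi n i w <= 1) /\
  (forall n i w, I n.+1 i w = 0 \/ I n.+1 i w = 1) /\
  (forall n i w, Zi n.+1 i w = (1 - r n) * Zi n i w + r n * I n.+1 i w) /\
  (* conditional independence given F_n of I_{n+1}(1..N), with
     P(I_{n+1}(i) = 1 | F_n) = (1-alpha) Z_n(i) + alpha Z_n :
     the conditional joint pmf is the product of the conditional marginals *)
  (forall n (A : set T) (b : 'I_N -> bool), nat_filt Zi n A ->
     P (A `&` [set w | forall i, I n.+1 i w = (b i)%:R]) =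
     (\int[P]_(w in A)
        (\prod_(i < N) (if b i then (1 - alpha) * Zi n i w + alpha * avg Zi n w
                        else 1 - ((1 - alpha) * Zi n i w + alpha * avg Zi n w)))%:E)%E).

End defs.

(* Main.v *)
(** The deviation [D n] of a component from the mean satisfies
    [D n.+1 = (1 - alpha r_n) D n + r_n xi n] with bounded martingale
    differences [xi n], whose conditional variance tends to
    [(1 - 1/N) Z (1 - Z)].  Dividing by [decay n = \prod_(l < n) (1 - alpha r_l)]
    turns [D] into a weighted sum of the [xi l], and the deterministic weights
    decide the limit: with [speed n = n^gamma], the sum of squared weights up to
    step [n + speed n * t], multiplied by [speed n * decay n ^ 2], converges to
    [kappa * clock t], where [kappa = c^2 / (2 c alpha - crit)] and [crit] is [1]
    if [gamma = 1] and [0] otherwise.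

    Finite-dimensional convergence, mixed over [Z], follows from a Lindeberg
    argument on [cos], after freezing the conditional variance at a late time,
    and from the density of trigonometric polynomials.  The fourth-moment
    maximal inequality controls the oscillations between grid points.  A bounded
    Skorohod-continuous functional is a limit from below of functionals that
    are Lipschitz for the uniform distance along continuous limit paths, so these
    two facts bound its expectation from below in the limit; applying this to the
    functional and to its opposite gives convergence in law. *)
Require Import Defs.
From HB Require Import structures.
From mathcomp Require Import all_boot all_order all_algebra all_fingroup.
From mathcomp Require Import all_classical all_reals all_analysis.
From mathcomp Require Import measurable_realfun.
From mathcomp Require Import ring lra.
Set Implicit Arguments.
Unset Strict Implicit.
Unset Printing Implicit Defensive.
Import Order.TTheory GRing.Theory Num.Theory.
Import numFieldNormedType.Exports.
Local Open Scope classical_set_scope.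
Local Open Scope ring_scope.

(** * Bounded measurable functions and expectations *)

(** Two obstacles shape the proof. The limit variance is random and involves [Z], which is known
    only in the limit, so the limit law is a mixture of Gaussian ones. Replacing [Z] by the mean at
    time [p] makes the variance adapted, and the noise before [p] disappears because the
    normalisation [sqrt (beta2 n)] tends to 0. Conditional moments are expressed throughout by
    testing against bounded adapted functions.

    The test functionals come with measurability of their compositions only, and the path space
    carries no sigma-algebra. The infimal regularisation avoids both compactness of families of laws
    and measurability of the functional: it reads a path through the uniform distance on a bounded
    interval, where a continuous path is close to a step path built from finitely many of its
    values.

    The two regimes are treated at once in logarithmic form: between [n] and the time index, the sum
    of the inverse speeds tends to [t] when gamma < 1 and to ln (1 + t) when gamma = 1, and the
    decay is the exponential of a multiple of this sum. *)

Lemma cvg0_le (R : realType) (u v : nat -> R) :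
  (\forall n \near \oo, `|u n| <= v n) -> v @ \oo --> (0 : R) -> u @ \oo --> (0 : R).
Proof.
move=> uv v0; apply: (@squeeze_cvgr _ _ _ _ (fun n => - v n) v) => //.
- by apply: filterS uv => n; rewrite ler_norml.
- by rewrite -oppr0; exact: cvgN.
Qed.

Lemma cvg_bigsum (R : realType) (J : Type) (s : seq J) (f : J -> nat -> R) (l : J -> R) :
  (forall j, f j @ \oo --> l j) ->
  (fun n => \sum_(j <- s) f j n) @ \oo --> \sum_(j <- s) l j.
Proof.
move=> fl; elim: s => [|j s ih].
  by rewrite big_nil; under eq_fun do rewrite big_nil; exact: cvg_cst.
by rewrite big_cons; under eq_fun do rewrite big_cons; exact: cvgD.
Qed.

Section bounded_measurable.
Context {R : realType} d (T : measurableType d).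
Implicit Types f g : T -> R.

Definition bmf f := measurable_fun setT f /\ exists M : R, forall w, `|f w| <= M.

Lemma bmf_meas f : bmf f -> measurable_fun setT f. Proof. by case. Qed.

Lemma bmf_le M f : measurable_fun setT f -> (forall w, `|f w| <= M) -> bmf f.
Proof. by move=> mf fM; split => //; exists M. Qed.

Lemma bmf_cst (a : R) : bmf (fun=> a).
Proof. by apply: (@bmf_le `|a|) => //; exact: measurable_cst. Qed.

Lemma bmfD f g : bmf f -> bmf g -> bmf (fun w => f w + g w).
Proof.
move=> [mf [M fM]] [mg [M' gM]]; split; first exact: measurable_funD.
by exists (M + M') => w; rewrite (le_trans (ler_normD _ _))// lerD.
Qed.

Lemma bmfM f g : bmf f -> bmf g -> bmf (fun w => f w * g w).
Proof.
move=> [mf [M fM]] [mg [M' gM]]; split; first exact: measurable_funM.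
by exists (M * M') => w; rewrite normrM ler_pM.
Qed.

Lemma bmfN f : bmf f -> bmf (fun w => - f w).
Proof.
move=> [mf [M fM]]; split; first exact: measurableT_comp.
by exists M => w; rewrite normrN.
Qed.

Lemma bmfB f g : bmf f -> bmf g -> bmf (fun w => f w - g w).
Proof. by move=> bf bg; apply: bmfD => //; exact: bmfN. Qed.

Lemma bmfX f n : bmf f -> bmf (fun w => f w ^+ n).
Proof.
move=> bf; elim: n => [|n ih]; first by apply: bmf_cst.
by under eq_fun do rewrite exprS; exact: bmfM.
Qed.

Lemma bmf_norm f : bmf f -> bmf (fun w => `|f w|).
Proof.
move=> [mf [M fM]]; split; first exact: measurableT_comp.
by exists M => w; rewrite normr_id.
Qed.

Lemma bmf_sum (I : Type) (s : seq I) (Q : pred I) (F : I -> T -> R) :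
  (forall i, bmf (F i)) -> bmf (fun w => \sum_(i <- s | Q i) F i w).
Proof.
move=> bF; elim: s => [|i s ih].
  by under eq_fun do rewrite big_nil; exact: bmf_cst.
under eq_fun do rewrite big_cons; case: (Q i) => //.
exact: bmfD.
Qed.

Lemma bmf_prod (I : Type) (s : seq I) (Q : pred I) (F : I -> T -> R) :
  (forall i, bmf (F i)) -> bmf (fun w => \prod_(i <- s | Q i) F i w).
Proof.
move=> bF; elim: s => [|i s ih].
  by under eq_fun do rewrite big_nil; exact: bmf_cst.
under eq_fun do rewrite big_cons; case: (Q i) => //.
exact: bmfM.
Qed.

Lemma bmf_cos f : measurable_fun setT f -> bmf (fun w => cos (f w)).
Proof.
move=> mf; apply: (@bmf_le 1); last by move=> w; rewrite ler_norml cos_geN1 cos_le1.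
by apply: measurableT_comp => //; apply: continuous_measurable_fun; exact: continuous_cos.
Qed.

Lemma bmf_sin f : measurable_fun setT f -> bmf (fun w => sin (f w)).
Proof.
move=> mf; apply: (@bmf_le 1); last by move=> w; rewrite ler_norml sin_geN1 sin_le1.
by apply: measurableT_comp => //; apply: continuous_measurable_fun; exact: continuous_sin.
Qed.

Lemma bmf_expRN f : measurable_fun setT f -> (forall w, f w <= 0) ->
  bmf (fun w => expR (f w)).
Proof.
move=> mf f0; apply: (@bmf_le 1); last first.
  by move=> w; rewrite ger0_norm ?expR_ge0// -[leRHS]expR0 ler_expR.
by apply: measurableT_comp => //; exact: measurable_expR.
Qed.

Lemma bmf_indic (A : set T) : measurable A -> bmf (\1_A : T -> R).
Proof.
move=> mA; apply: (@bmf_le 1) => //.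
by move=> w; rewrite indicE; case: (_ \in _); rewrite ?normr1 ?normr0.
Qed.

(** Slicing of the range into intervals of length [e]. The slices are sets of reals, so the same
    coefficients serve after composition with any random variable: identities between expectations
    reduce to identities between probabilities. *)
Lemma bmf_approx f (e : R) : bmf f -> 0 < e ->
  exists (n : nat) (a : nat -> R) (A : nat -> set R),
    (forall k, measurable (A k)) /\
    forall w, `|f w - \sum_(k < n) a k * \1_(f @^-1` (A k)) w| <= e.
Proof.
move=> [mf [M fM]] e0.
pose g w := Num.truncn ((f w + M) / e).
have g0 w : 0 <= (f w + M) / e.
  rewrite divr_ge0 ?(ltW e0)//; have := fM w; rewrite ler_norml; lra.
pose n := (Num.truncn ((M + M) / e)).+1.
have gn w : (g w < n)%N.
  rewrite /g /n ltnS; apply: le_truncn.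
  rewrite ler_pM2r ?invr_gt0// lerD2r; have := fM w; rewrite ler_norml; lra.
exists n, (fun k => k%:R * e - M), (fun k => [set x | k%:R * e - M <= x < k.+1%:R * e - M]).
split.
  move=> k; rewrite [X in measurable X](_ : _ = `[k%:R * e - M, k.+1%:R * e - M[%classic).
    exact: measurable_itv.
  by apply/seteqP; split => x /=; rewrite in_itv.
move=> w.
have gk k : (f @^-1` [set x | k%:R * e - M <= x < k.+1%:R * e - M]) w <-> g w = k.
  rewrite /preimage/= /g; split.
    move=> /andP[h1 h2]; apply: truncn_def; apply/andP; split.
      by rewrite ler_pdivlMr// -lerBlDr.
    by rewrite ltr_pdivrMr// -ltrBrDr.
  move=> <-; have /andP[h1 h2] := truncn_itv (g0 w).
  by rewrite lerBlDr -ler_pdivlMr// h1/= ltrBrDr -ltr_pdivrMr.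
rewrite (bigD1 (Ordinal (gn w)))//= big1; last first.
  move=> k kg; rewrite indicE memNset ?mulr0// => /gk kE.
  by move/eqP: kg; apply; apply: val_inj => /=.
have hk : (f @^-1` [set x | (g w)%:R * e - M <= x < (g w).+1%:R * e - M]) w by apply/gk.
rewrite indicE mem_set//= mulr1 addr0.
move: hk; rewrite /preimage/= -natr1 => /andP[h1 h2].
rewrite ler_norml; apply/andP; split; lra.
Qed.

End bounded_measurable.

Section expectation.
Context {R : realType} d (T : measurableType d) (P : probability T R).
Implicit Types f g : T -> R.

Definition Ex f : R := Rintegral P setT f.

Lemma bmf_integrable f : bmf f -> P.-integrable setT (EFin \o f).
Proof.
move=> [mf [M fM]].
apply: (@le_integrable _ _ _ P _ measurableT _ (EFin \o cst M)).
- exact/measurable_EFinP.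
- by move=> w _; rewrite /= lee_fin (le_trans (fM w))// ler_norm.
- exact: finite_measure_integrable_cst.
Qed.
Hint Resolve bmf_integrable : core.

Lemma ExE f : bmf f -> (\int[P]_w (f w)%:E = (Ex f)%:E)%E.
Proof.
move=> bf; rewrite /Ex /Rintegral fineK//.
by apply: integrable_fin_num => //; exact: bmf_integrable.
Qed.

Lemma ExD f g : bmf f -> bmf g -> Ex (fun w => f w + g w) = Ex f + Ex g.
Proof. by move=> bf bg; rewrite /Ex RintegralD//; exact: bmf_integrable. Qed.

Lemma ExB f g : bmf f -> bmf g -> Ex (fun w => f w - g w) = Ex f - Ex g.
Proof. by move=> bf bg; rewrite /Ex RintegralB//; exact: bmf_integrable. Qed.

Lemma ExZ a f : bmf f -> Ex (fun w => a * f w) = a * Ex f.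
Proof. by move=> bf; rewrite /Ex RintegralZl//; exact: bmf_integrable. Qed.

Lemma ExN f : bmf f -> Ex (fun w => - f w) = - Ex f.
Proof.
move=> bf; rewrite -mulN1r -ExZ//; congr Ex.
by apply/funext => w; rewrite mulN1r.
Qed.

Lemma Ex_cst a : Ex (fun=> a) = a.
Proof. by rewrite /Ex Rintegral_cst//= [X in fine X](probability_setT P) mulr1. Qed.

Lemma Ex_le f g : bmf f -> bmf g -> (forall w, f w <= g w) -> Ex f <= Ex g.
Proof. by move=> bf bg fg; apply: le_Rintegral => //; exact: bmf_integrable. Qed.

Lemma Ex_ge0 f : (forall w, 0 <= f w) -> 0 <= Ex f.
Proof. by move=> f0; apply: Rintegral_ge0. Qed.

Lemma Ex_norm f : bmf f -> `|Ex f| <= Ex (fun w => `|f w|).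
Proof. by move=> bf; apply: le_normr_Rintegral => //; exact: bmf_integrable. Qed.

Lemma Ex_le_cst f a : bmf f -> (forall w, f w <= a) -> Ex f <= a.
Proof. by move=> bf fa; rewrite -[leRHS]Ex_cst; apply: Ex_le => //; exact: bmf_cst. Qed.

Lemma Ex_norm_le f a : bmf f -> (forall w, `|f w| <= a) -> `|Ex f| <= a.
Proof.
by move=> bf fa; rewrite (le_trans (Ex_norm bf))// Ex_le_cst//; exact: bmf_norm.
Qed.

Lemma Ex_dist_le f g a : bmf f -> bmf g -> (forall w, `|f w - g w| <= a) ->
  `|Ex f - Ex g| <= a.
Proof. by move=> bf bg fg; rewrite -ExB//; apply: Ex_norm_le => //; exact: bmfB. Qed.

Lemma Ex_sum (I : Type) (s : seq I) (Q : pred I) (F : I -> T -> R) :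
  (forall i, bmf (F i)) ->
  Ex (fun w => \sum_(i <- s | Q i) F i w) = \sum_(i <- s | Q i) Ex (F i).
Proof.
move=> bF; elim: s => [|i s ih].
  by under eq_fun do rewrite big_nil; rewrite Ex_cst big_nil.
under eq_fun do rewrite big_cons; rewrite big_cons; case: (Q i) => //.
by rewrite ExD// ?ih//; exact: bmf_sum.
Qed.

Lemma Ex_indic (A : set T) : measurable A -> Ex (\1_A) = fine (P A).
Proof. by move=> mA; rewrite /Ex /Rintegral integral_indic// setIT. Qed.

Lemma Ex_dct (fs : nat -> T -> R) f (M : R) :
  (forall n, measurable_fun setT (fs n)) -> bmf f ->
  (forall n w, `|fs n w| <= M) ->
  {ae P, forall w, fs n w @[n --> \oo] --> f w} ->
  Ex (fs n) @[n --> \oo] --> Ex f.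
Proof.
move=> mfs bf fM cf.
have [|||||_ _ h] := @dominated_convergence _ _ _ P setT measurableT
  (fun n => EFin \o fs n) (EFin \o f) (EFin \o cst M).
- by move=> n; exact/measurable_EFinP.
- by apply/measurable_EFinP; case: bf.
- apply: filterS cf => w cw _; apply: cvg_EFin; last exact: cw.
  by near=> n.
- exact: finite_measure_integrable_cst.
- by apply: aeW => w n _; rewrite /= lee_fin.
by apply: fine_cvg; rewrite -ExE.
Unshelve. all: by end_near. Qed.

End expectation.

(** * Taylor bounds with explicit remainders *)

Section taylor.
Context {R : realType}.
Implicit Types x y : R.

(** Bootstraps the trigonometric bounds below: the derivative of each gap between function and
    polynomial is the previous gap. *)
Lemma nneg_of_derive (f df : R -> R) : (forall x, is_derive x 1 f (df x)) ->
  (forall x, 0 <= x -> 0 <= df x) -> f 0 = 0 -> forall x, 0 <= x -> 0 <= f x.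
Proof.
move=> fdf df0 f0 x x0.
have cf : {within `[0, x], continuous f}.
  by apply: derivable_within_continuous => y _; apply: ex_derive; exact: fdf.
have [c] := @MVT_segment _ f df 0 x x0 (fun y _ => fdf y) cf.
rewrite in_itv/= => /andP[c0 _]; rewrite f0 !subr0 => ->.
by rewrite mulr_ge0// df0.
Qed.

Lemma sin_le_id x : 0 <= x -> sin x <= x.
Proof.
move=> x0; rewrite -subr_ge0.
have D (y : R) : is_derive y 1 (fun x : R => x - sin x) (1 - cos y) by apply: is_derive_eq.
apply: (nneg_of_derive D) x0; last by rewrite sin0 subr0.
by move=> y _; rewrite subr_ge0 cos_le1.
Qed.

Lemma cos_ge_quad x : 0 <= x -> 1 - x ^+ 2 / 2 <= cos x.
Proof.
move=> x0; rewrite -subr_ge0.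
have D (y : R) : is_derive y 1 (fun x : R => cos x - (1 - x ^+ 2 / 2)) (- sin y + y).
  by apply: is_derive_eq; rewrite /GRing.scale/=; lra.
apply: (nneg_of_derive D) x0; last by rewrite cos0 expr0n/= mul0r subr0 subrr.
by move=> y y0; have := sin_le_id y0; lra.
Qed.

Lemma sin_ge_cub x : 0 <= x -> x - x ^+ 3 / 6 <= sin x.
Proof.
move=> x0; rewrite -subr_ge0.
have D (y : R) : is_derive y 1 (fun x : R => sin x - (x - x ^+ 3 / 6))
    (cos y - (1 - y ^+ 2 / 2)).
  by apply: is_derive_eq; rewrite /GRing.scale/=; lra.
apply: (nneg_of_derive D) x0; last by rewrite sin0 expr0n/= mul0r subr0 subrr.
by move=> y y0; have := cos_ge_quad y0; lra.
Qed.

Lemma cos_le_quart x : 0 <= x -> cos x <= 1 - x ^+ 2 / 2 + x ^+ 4 / 24.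
Proof.
move=> x0; rewrite -subr_ge0.
have D (y : R) : is_derive y 1 (fun x : R => 1 - x ^+ 2 / 2 + x ^+ 4 / 24 - cos x)
    (sin y - (y - y ^+ 3 / 6)).
  by apply: is_derive_eq; rewrite /GRing.scale/=; lra.
apply: (nneg_of_derive D) x0; last first.
  by rewrite cos0 !expr0n/= !mul0r subr0 addr0 subrr.
by move=> y y0; have := sin_ge_cub y0; lra.
Qed.

Lemma sin_taylor x : `|sin x - x| <= `|x| ^+ 3 / 6.
Proof.
wlog x0 : x / 0 <= x.
  move=> h; have [/h//|/ltW x0] := leP 0 x.
  have := h (- x); rewrite oppr_ge0 sinN normrN => /(_ x0).
  by rewrite -opprD normrN.
rewrite (ger0_norm x0) ler_norml; have := sin_le_id x0; have := sin_ge_cub x0.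
have : 0 <= x ^+ 3 by rewrite exprn_ge0.
by move=> h0 h1 h2; apply/andP; split; lra.
Qed.

Lemma cos_taylor x : `|cos x - 1 + x ^+ 2 / 2| <= x ^+ 4 / 24.
Proof.
wlog x0 : x / 0 <= x.
  move=> h; have [/h//|/ltW x0] := leP 0 x.
  have := h (- x); rewrite oppr_ge0 cosN => /(_ x0).
  by rewrite sqrrN (_ : (- x) ^+ 4 = x ^+ 4); [|ring].
rewrite ler_norml; have := cos_ge_quad x0; have := cos_le_quart x0.
have : 0 <= x ^+ 4 by rewrite exprn_ge0.
by move=> h0 h1 h2; apply/andP; split; lra.
Qed.

(** By the addition formula the remainder combines those of [cos] and [sin] at [y] with coefficients
    at most 1, hence the uniformity in [x]. *)
Lemma cosD_taylor x y :
  `|cos (x + y) - (cos x - y * sin x - y ^+ 2 / 2 * cos x)|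
    <= `|y| ^+ 3 / 6 + y ^+ 4 / 24.
Proof.
rewrite cosD.
have -> : cos x * cos y - sin x * sin y -
    (cos x - y * sin x - y ^+ 2 / 2 * cos x) =
    cos x * (cos y - 1 + y ^+ 2 / 2) - sin x * (sin y - y) by ring.
rewrite (le_trans (ler_normB _ _))// !normrM addrC lerD//.
  by rewrite -[leRHS]mul1r ler_pM// ?sin_max// sin_taylor.
by rewrite -[leRHS]mul1r ler_pM// ?cos_max// cos_taylor.
Qed.

Lemma expRN_taylor y : 0 <= y -> `|expR (- y) - 1 + y| <= y ^+ 2 / 2.
Proof.
move=> y0.
rewrite ger0_norm; last by have := expR_ge1Dx (- y); lra.
rewrite -subr_ge0.
have D (x : R) : is_derive x 1 (fun y : R => y ^+ 2 / 2 - (expR (- y) - 1 + y))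
    (x - 1 + expR (- x)).
  by apply: is_derive_eq; rewrite /GRing.scale/=; lra.
apply: (nneg_of_derive D) y0; last first.
  by rewrite oppr0 expR0 expr0n/= mul0r subrr addr0 subrr.
by move=> x _; have := expR_ge1Dx (- x); lra.
Qed.

End taylor.

(** * Martingale differences *)

Section martingale_differences.
Context {R : realType} d (T : measurableType d) (P : probability T R).
Variable G : nat -> set (set T).
Hypothesis G_meas : forall n A, G n A -> measurable A.
Hypothesis G_mono : forall n, G n `<=` G n.+1.

(** Adapted and bounded. Retyping the domain with the sigma-algebra generated by [G n] lets the
    closure lemmas of [bmf] serve for adaptedness as well. *)
Definition adp n (f : T -> R) := @bmf R _ (g_sigma_algebraType (G n)) f.

Lemma adp_le n m f : (n <= m)%N -> adp n f -> adp m f.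
Proof.
move=> nm [mf bf]; split => //.
have nmG : G n `<=` G m.
  elim: m nm => [|m ih]; first by rewrite leqn0 => /eqP ->.
  by rewrite leq_eqVlt ltnS => /predU1P[->//|/ih h]; exact: subset_trans h (@G_mono _).
move=> _ B mB; apply: (sub_sigma_algebra2 nmG).
exact: (mf measurableT B mB).
Qed.

Lemma adp_bmf n f : adp n f -> bmf f.
Proof.
move=> [mf bf]; split => // _ B mB.
have : <<s G n >> ([set: T] `&` f @^-1` B) by exact: (mf measurableT B mB).
move: (_ `&` _); apply: smallest_sub; last by move=> A; exact: G_meas.
exact: sigma_algebra_measurable.
Qed.

Variables (K : R) (xi sg : nat -> T -> R).
Hypothesis K_ge0 : 0 <= K.
Hypothesis xi_adp : forall n, adp n.+1 (xi n).
Hypothesis xi_le : forall n w, `|xi n w| <= K.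
Hypothesis xi_centered : forall n g, adp n g -> Ex P (fun w => g w * xi n w) = 0.

(** Martingale transform. The predictable factor [h] is kept apart from the deterministic weights
    [a], which alone enter the moment bounds; it will carry the stopping. *)
Definition mtr (a : nat -> R) (h : nat -> T -> R) n w :=
  \sum_(l < n) a l * h l w * xi l w.

Lemma mtrS a h n w : mtr a h n.+1 w = mtr a h n w + a n * h n w * xi n w.
Proof. by rewrite /mtr big_ord_recr. Qed.

Lemma mtr_adp a h n : (forall l, adp l (h l)) -> adp n (mtr a h n).
Proof.
move=> ah; elim: n => [|n ih].
  by rewrite /adp /mtr; under eq_fun do rewrite big_ord0; exact: bmf_cst.
rewrite (_ : mtr a h n.+1 = fun w => mtr a h n w + a n * h n w * xi n w); last first.
  by apply/funext => w; rewrite mtrS.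
apply: bmfD; first exact: adp_le ih.
apply: bmfM; last exact: xi_adp.
by apply: bmfM; [exact: bmf_cst|exact: (adp_le (leqnSn n) (ah n))].
Qed.

Section moments.
Variables (a : nat -> R) (h : nat -> T -> R).
Hypothesis h_adp : forall l, adp l (h l).
Hypothesis h_le : forall l w, `|h l w| <= 1.

Let S := mtr a h.
Let A n := \sum_(l < n) (K * a l) ^+ 2.

Let bS n : bmf (S n). Proof. exact: adp_bmf (mtr_adp _ _ h_adp). Qed.

Let incr_le l w : (a l * h l w * xi l w) ^+ 2 <= (K * a l) ^+ 2.
Proof.
rewrite -[leLHS]real_normK ?num_real// -[leRHS]real_normK ?num_real//.
rewrite lerXn2r ?nnegrE// (_ : a l * h l w * xi l w = xi l w * a l * h l w); last by ring.
rewrite !normrM -[leRHS]mulr1 ler_pM// ler_wpM2r//.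
by rewrite (le_trans (xi_le _ _))// ler_norm.
Qed.

Lemma mtr_moment2 n : Ex P (fun w => S n w ^+ 2) <= A n.
Proof.
elim: n => [|n ih].
  rewrite /A big_ord0 /S /mtr; under eq_fun do rewrite big_ord0 expr2 mulr0.
  by rewrite Ex_cst.
have -> : (fun w => S n.+1 w ^+ 2) =
  (fun w => (S n w ^+ 2 + (S n w * (2 * a n * h n w)) * xi n w) +
            (a n * h n w * xi n w) ^+ 2).
  by apply/funext => w; rewrite /S mtrS; ring.
have b0 : adp n (fun w => S n w * (2 * a n * h n w)).
  apply: bmfM; first exact: (mtr_adp _ _ h_adp).
  by apply: bmfM; [exact: bmf_cst|exact: h_adp].
have b1 : bmf (fun w => S n w * (2 * a n * h n w) * xi n w).
  by apply: bmfM; [exact: adp_bmf b0|exact: adp_bmf (xi_adp n)].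
have b2 : bmf (fun w => (a n * h n w * xi n w) ^+ 2).
  apply: bmfX; apply: bmfM; last exact: adp_bmf (xi_adp n).
  by apply: bmfM; [exact: bmf_cst|exact: adp_bmf (h_adp n)].
have b3 : bmf (fun w => S n w ^+ 2) by exact: bmfX.
rewrite ExD//; last exact: bmfD.
rewrite ExD// xi_centered// addr0 /A big_ord_recr/= lerD//.
by apply: Ex_le_cst => // w; exact: incr_le.
Qed.

(** The term in S^3 is centered, and 4 x y^3 <= 2 x^2 y^2 + 2 y^4 bounds the rest of the expansion
    by 8 c2 x^2 + 3 c2^2. With the second moment bound the increase is at most 8 c2 A + 3 c2^2,
    which 4 (A + c2)^2 - 4 A^2 covers. *)
Lemma mtr_moment4 n : Ex P (fun w => S n w ^+ 4) <= 4 * A n ^+ 2.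
Proof.
elim: n => [|n ih].
  rewrite /A big_ord0 /S /mtr; under eq_fun do rewrite big_ord0 exprS mul0r.
  by rewrite Ex_cst expr2 !mulr0.
pose c2 := (K * a n) ^+ 2.
pose y w := a n * h n w * xi n w.
have b0 : adp n (fun w => S n w ^+ 3 * (4 * a n * h n w)).
  apply: bmfM; first by apply: bmfX; exact: (mtr_adp _ _ h_adp).
  by apply: bmfM; [exact: bmf_cst|exact: h_adp].
have b1 : bmf (fun w => S n w ^+ 3 * (4 * a n * h n w) * xi n w).
  by apply: bmfM; [exact: adp_bmf b0|exact: adp_bmf (xi_adp n)].
have b3 : bmf (fun w => S n w ^+ 4) by exact: bmfX.
have b4 : bmf (fun w => (8 * c2) * S n w ^+ 2 + 3 * c2 ^+ 2).
  apply: bmfD; last exact: bmf_cst.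
  by apply: bmfM; [exact: bmf_cst|exact: bmfX].
have b5 : bmf (fun w => 8 * c2 * S n w ^+ 2).
  by apply: bmfM; [exact: bmf_cst|exact: bmfX].
have : Ex P (fun w => S n.+1 w ^+ 4) <=
  Ex P (fun w => (S n w ^+ 4 + S n w ^+ 3 * (4 * a n * h n w) * xi n w) +
     ((8 * c2) * S n w ^+ 2 + 3 * c2 ^+ 2)).
  apply: Ex_le; first exact: bmfX.
    by apply: bmfD => //; exact: bmfD.
  move=> w; rewrite /S mtrS -/(S) -/(y w).
  set x := S n w.
  have yc : y w ^+ 2 <= c2 by exact: incr_le.
  rewrite (_ : x ^+ 3 * (4 * a n * h n w) * xi n w = 4 * x ^+ 3 * y w); last first.
    by rewrite /y; ring.
  have y0 : 0 <= y w ^+ 2 by exact: sqr_ge0.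
  have x0 : 0 <= x ^+ 2 by exact: sqr_ge0.
  have h1 : x ^+ 2 * y w ^+ 2 <= x ^+ 2 * c2 by rewrite ler_wpM2l.
  have h2 : (y w ^+ 2) ^+ 2 <= c2 ^+ 2 by rewrite lerXn2r// nnegrE// (le_trans y0).
  have h3 : 0 <= y w ^+ 2 * (x - y w) ^+ 2 by rewrite mulr_ge0// sqr_ge0.
  have -> : (x + y w) ^+ 4 = x ^+ 4 + 4 * x ^+ 3 * y w + 8 * (x ^+ 2 * y w ^+ 2)
     + 3 * (y w ^+ 2) ^+ 2 - 2 * (y w ^+ 2 * (x - y w) ^+ 2) by ring.
  by lra.
move/le_trans; apply.
rewrite ExD//; last exact: bmfD.
rewrite ExD// xi_centered// addr0 ExD//; last exact: bmf_cst.
rewrite ExZ; last exact: bmfX.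
rewrite Ex_cst /A big_ord_recr/= -/(A n) -/c2.
have c0 : 0 <= c2 by exact: sqr_ge0.
have := mtr_moment2 n => m2.
have : 8 * c2 * Ex P (fun w => S n w ^+ 2) <= 8 * c2 * A n.
  by rewrite ler_wpM2l// mulr_ge0.
have := sqr_ge0 c2.
rewrite (_ : 4 * (A n + c2) ^+ 2 = 4 * A n ^+ 2 + 8 * c2 * A n + 4 * c2 ^+ 2); last by ring.
by lra.
Qed.

End moments.

(** * Maximal inequality with fourth moments *)

Section maximal.
Variables (a : nat -> R) (e : R).
Hypothesis e_gt0 : 0 < e.

Let S := mtr a (fun _ _ => 1).

Let one_adp l : adp l (fun=> 1). Proof. exact: bmf_cst. Qed.

Let good k : set T := [set w | `|S k w| < e].

Let goodm k : measurable (good k : set (g_sigma_algebraType (G k))).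
Proof.
have [mS _] : adp k (fun w => `|S k w|) by apply: bmf_norm; exact: (mtr_adp _ _ one_adp).
have := mS measurableT `]-oo, e[%classic (measurable_itv _).
by rewrite setTI (_ : _ @^-1` _ = good k).
Qed.

(** Indicator that the sum has not left the ball up to time [l]; being known at time [l], it may
    multiply [xi l]. *)
Let h l w : R := \prod_(k < l.+1) \1_(good k) w.

Let h_adp l : adp l (h l).
Proof.
apply: bmf_prod => k; apply: (@adp_le k l); first by rewrite -ltnS ltn_ord.
exact: (@bmf_indic R _ (g_sigma_algebraType (G k)) (good k) (@goodm k)).
Qed.

Let h1 l w : (forall k, (k <= l)%N -> good k w) -> h l w = 1.
Proof.
move=> gw; rewrite /h big1// => k _; rewrite indicE mem_set//.
by apply: gw; rewrite -ltnS ltn_ord.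
Qed.

Let h0 l w k : (k <= l)%N -> ~ good k w -> h l w = 0.
Proof.
move=> kl gw; have kl' : (k < l.+1)%N by [].
by rewrite /h (bigD1 (Ordinal kl'))//= indicE memNset// mul0r.
Qed.

Let h_le l w : `|h l w| <= 1.
Proof.
have [gw|/existsNP[k /not_implyP[kl gk]]] := pselect (forall k, (k <= l)%N -> good k w).
  by rewrite h1// normr1.
by rewrite (h0 kl gk) normr0.
Qed.

Let stop_eq n w : (forall k, (k < n)%N -> good k w) -> mtr a h n w = S n w.
Proof.
elim: n => [|n ih] gw; first by rewrite /S /mtr !big_ord0.
rewrite /S !mtrS ih; last by move=> k kn; apply: gw; exact: ltnW.
by rewrite h1// => k kn; exact: gw.
Qed.

(** The increment leading out of the ball is still counted, since [h l] looks no further than time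
    [l]; afterwards the sum stays frozen outside. *)
Let stop_ge n w : (exists2 k, (k <= n)%N & ~ good k w) -> e <= `|mtr a h n w|.
Proof.
elim: n => [|n ih].
  move=> [k]; rewrite leqn0 => /eqP -> /negP; rewrite -leNgt.
  by rewrite stop_eq.
move=> [k kn gk].
have [[j jn gj]|ng] := pselect (exists2 k, (k <= n)%N & ~ good k w).
  by rewrite mtrS (h0 jn gj) mulr0 mul0r addr0; apply: ih; exists j.
have gw j : (j < n.+1)%N -> good j w.
  by move=> jn; apply: contrapT => gj; apply: ng; exists j.
rewrite stop_eq//; move: gk kn; rewrite leq_eqVlt => gk /predU1P[<-|kn].
  by rewrite leNgt; apply/negP.
by exfalso; apply: gk; exact: gw.
Qed.

Definition exceed n : set T := [set w | exists2 k, (k <= n)%N & e <= `|S k w|].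

Lemma measurable_exceed n : measurable (exceed n).
Proof.
rewrite (_ : exceed n = \big[setU/set0]_(k < n.+1) ~` good k); last first.
  rewrite -(bigcup_mkord n.+1 (fun k => ~` good k)); apply/seteqP; split => w.
    move=> [k kn ek]; exists k => //=.
    by rewrite /good/=; apply/negP; rewrite -leNgt.
  move=> [k /= kn /negP]; rewrite -leNgt => ?; by exists k.
apply: bigsetU_measurable => k _; apply: measurableC.
have [mS _] : bmf (fun w => `|S k w|) by apply: bmf_norm; apply: adp_bmf; exact: mtr_adp.
have := mS measurableT `]-oo, e[%classic (measurable_itv _).
by rewrite setTI (_ : _ @^-1` _ = good k).
Qed.

(* Freezing the sum once it has left the ball keeps it a martingale transform,
   so that the maximal inequality reduces to the fourth moment bound. *)
Lemma exceed_le n :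
  Ex P (\1_(exceed n)) <= 4 * (\sum_(l < n) (K * a l) ^+ 2) ^+ 2 / e ^+ 4.
Proof.
have e4 : 0 < e ^+ 4 by rewrite exprn_gt0.
rewrite ler_pdivlMr//.
have bh : bmf (mtr a h n) by exact: adp_bmf (mtr_adp _ _ h_adp).
have bE : bmf (\1_(exceed n) : T -> R) by apply: bmf_indic; exact: measurable_exceed.
rewrite mulrC -ExZ//.
apply: le_trans (mtr_moment4 a h_adp h_le n).
apply: Ex_le.
- by apply: bmfM => //; exact: bmf_cst.
- exact: bmfX.
move=> w; rewrite indicE; have [|] := boolP (w \in exceed n).
  rewrite inE => -[k kn ek]; rewrite mulr1.
  have -> : mtr a h n w ^+ 4 = `|mtr a h n w| ^+ 4.
    by rewrite -normrX ger0_norm// exprn_even_ge0.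
  rewrite lerXn2r ?nnegrE ?(ltW e_gt0) ?normr_ge0// stop_ge//; exists k => //.
  by rewrite /good/=; apply/negP; rewrite -leNgt.
by move=> _; rewrite mulr0 exprn_even_ge0.
Qed.

End maximal.

(** * Lindeberg exchange with a frozen random variance *)

Section lindeberg.
Hypothesis sg_adp : forall n, adp n (sg n).
Hypothesis xi_sqr : forall n g, adp n g ->
  Ex P (fun w => g w * xi n w ^+ 2) = Ex P (fun w => g w * sg n w).
Variables (b : nat -> R) (p : nat) (s : T -> R) (th : R).
Hypothesis b_le : forall l, `|b l| <= 1.
Hypothesis s_adp : adp p s.
Hypothesis s_01 : forall w, 0 <= s w <= 1.

Let V m n := \sum_(m <= l < n) b l ^+ 2.
Let S n w := \sum_(p <= l < n) b l * xi l w.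

Let S_adp n : (p <= n)%N -> adp n (S n).
Proof.
move=> pn; rewrite (_ : S n = mtr (fun l => if (l < p)%N then 0 else b l) (fun=> fun=> 1) n).
  by apply: mtr_adp => l; exact: bmf_cst.
apply/funext => w; rewrite /S /mtr -(big_mkord predT
   (fun l => (if (l < p)%N then 0 else b l) * 1 * xi l w)) [RHS](@big_cat_nat _ _ _ p)//=.
rewrite [X in _ = X + _](_ : _ = 0) ?add0r; last first.
  rewrite big_nat big1// => l /andP[_ lp].
  by rewrite lp !mul0r.
by apply: eq_big_nat => l /andP[pl _]; rewrite ltnNge pl/= mulr1.
Qed.

(** The increment b_n xi_n is traded for the factor exp(- s b_n^2 / 2) of a Gaussian variable of
    variance [s]. As [s] is known at time p <= n, all prefactors are adapted: the first-order term
    has mean zero and the second-order one sees [sg n] in place of the square of [xi n]. *)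
Lemma lindeberg_step n m : (p <= n < m)%N ->
  `| Ex P (fun w => cos (S n.+1 w + th) * expR (- (s w * V n.+1 m / 2))) -
     Ex P (fun w => cos (S n w + th) * expR (- (s w * V n m / 2))) |
  <= b n ^+ 2 / 2 * Ex P (fun w => `|sg n w - s w|) + (K ^+ 3 + K ^+ 4 + 1) * `|b n| ^+ 3.
Proof.
move=> /andP[pn nm].
have V0 k : 0 <= V k m by apply: sumr_ge0 => l _; exact: sqr_ge0.
have s0 w : 0 <= s w by case/andP: (s_01 w).
pose q w := expR (- (s w * V n.+1 m / 2)).
have sVn k : adp p (fun w => expR (- (s w * V k m / 2))).
  apply: bmf_expRN; last first.
    by move=> w; rewrite oppr_le0 divr_ge0// mulr_ge0.
  apply: bmf_meas; apply: bmfN; apply: bmfM; last exact: bmf_cst.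
  by apply: bmfM; [exact: s_adp|exact: bmf_cst].
have q_adp : adp n q by exact: (adp_le pn (sVn n.+1)).
have q01 w : 0 <= q w <= 1.
  rewrite expR_ge0/= -[leRHS]expR0 ler_expR oppr_le0 divr_ge0// mulr_ge0//.
pose x w := S n w + th.
pose y w := b n * xi n w.
have mx : @measurable_fun _ _ (g_sigma_algebraType (G n)) R setT x.
  by apply: bmf_meas; apply: bmfD; [exact: S_adp|exact: bmf_cst].
have cx_adp : adp n (fun w => cos (x w)) by exact: bmf_cos.
have sx_adp : adp n (fun w => sin (x w)) by exact: bmf_sin.
have xS w : S n.+1 w + th = x w + y w.
  by rewrite /x /y /S big_nat_recr//=; ring.
have VS : V n m = b n ^+ 2 + V n.+1 m by rewrite /V big_ltn.
have qE w : expR (- (s w * V n m / 2)) = q w * expR (- (s w * b n ^+ 2 / 2)).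
  by rewrite /q -expRD VS; congr expR; ring.
(* [g1] and [g2] are the coefficients of [xi n] and of its square in the expansion of the cosine. *)
pose g1 w := - b n * (q w * sin (x w)).
pose g2 w := - (b n ^+ 2 / 2) * (q w * cos (x w)).
have g1_adp : adp n g1 by apply: bmfM; [exact: bmf_cst|exact: bmfM].
have g2_adp : adp n g2 by apply: bmfM; [exact: bmf_cst|exact: bmfM].
have bxi : bmf (xi n) by exact: adp_bmf (xi_adp n).
have bg1 : bmf (fun w => g1 w * xi n w) by apply: bmfM => //; exact: adp_bmf g1_adp.
have bg2 : bmf (fun w => g2 w * xi n w ^+ 2).
  by apply: bmfM; [exact: adp_bmf g2_adp|exact: bmfX].
have bsg : bmf (sg n) by exact: adp_bmf (sg_adp n).
have bg2s : bmf (fun w => g2 w * sg n w) by apply: bmfM => //; exact: adp_bmf g2_adp.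
have bs : bmf s by exact: adp_bmf s_adp.
have bL : bmf (fun w => cos (S n.+1 w + th) * expR (- (s w * V n.+1 m / 2))).
  apply: bmfM; last exact: adp_bmf (sVn n.+1).
  apply: bmf_cos; apply: bmf_meas; apply: bmfD; last exact: bmf_cst.
  by apply: (@adp_bmf n.+1); apply: S_adp; exact: leqW.
have bR : bmf (fun w => cos (S n w + th) * expR (- (s w * V n m / 2))).
  apply: bmfM; last exact: adp_bmf (sVn n).
  exact: adp_bmf cx_adp.
rewrite -ExB//.
(* The two subtracted terms have mean zero, so they may be inserted before taking absolute
   values. *)
have -> : Ex P (fun w => cos (S n.+1 w + th) * expR (- (s w * V n.+1 m / 2)) -
     cos (S n w + th) * expR (- (s w * V n m / 2))) =
   Ex P (fun w => (cos (S n.+1 w + th) * expR (- (s w * V n.+1 m / 2)) -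
     cos (S n w + th) * expR (- (s w * V n m / 2))) - g1 w * xi n w
      - (g2 w * xi n w ^+ 2 - g2 w * sg n w)).
  rewrite [RHS]ExB; [|by apply: bmfB => //; exact: bmfB|exact: bmfB].
  rewrite [X in _ = X - _]ExB//; last exact: bmfB.
  by rewrite [X in _ - X - _]xi_centered// [X in _ - X]ExB// xi_sqr// subrr !subr0.
have bD : bmf (fun w => b n ^+ 2 / 2 * `|sg n w - s w|).
  by apply: bmfM; [exact: bmf_cst|apply: bmf_norm; exact: bmfB].
rewrite -[X in _ <= _ + X](Ex_cst P) -ExZ; last by apply: bmf_norm; exact: bmfB.
rewrite -ExD//; last exact: bmf_cst.
apply: (le_trans (Ex_norm _ _)).
  by apply: bmfB; apply: bmfB => //; exact: bmfB.
apply: Ex_le.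
- by apply: bmf_norm; apply: bmfB; apply: bmfB => //; exact: bmfB.
- by apply: bmfD => //; exact: bmf_cst.
move=> w; rewrite xS qE -/(q w) -/(x w) /g1 /g2.
have /andP[q0 q1] := q01 w.
pose z := s w * b n ^+ 2 / 2.
have z0 : 0 <= z by rewrite divr_ge0// mulr_ge0// sqr_ge0.
set X := x w; set Y := y w.
(* Three errors: the remainder of the cosine, the remainder of the exponential, and the replacement
   of [sg n] by [s]. *)
have -> : cos (X + Y) * q w - cos X * (q w * expR (- (s w * b n ^+ 2 / 2))) -
    - b n * (q w * sin X) * xi n w -
    (- (b n ^+ 2 / 2) * (q w * cos X) * xi n w ^+ 2 -
     - (b n ^+ 2 / 2) * (q w * cos X) * sg n w) =
   q w * (cos (X + Y) - (cos X - Y * sin X - Y ^+ 2 / 2 * cos X))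
   - q w * (cos X * (expR (- z) - 1 + z))
   - (b n ^+ 2 / 2) * ((q w * cos X) * (sg n w - s w)).
  by rewrite /Y /y /z; ring.
have B0 : 0 <= `|b n| by [].
have B1 := b_le n.
have YK : `|Y| <= K * `|b n| by rewrite /Y /y normrM mulrC ler_wpM2r.
have h1 : `|q w * (cos (X + Y) - (cos X - Y * sin X - Y ^+ 2 / 2 * cos X))|
    <= (K ^+ 3 + K ^+ 4) * `|b n| ^+ 3.
  rewrite normrM (ger0_norm q0).
  apply: (@le_trans _ _ (1 * (`|Y| ^+ 3 / 6 + Y ^+ 4 / 24))).
    by apply: ler_pM => //; exact: cosD_taylor.
  rewrite mul1r mulrDl lerD//.
    rewrite ler_pdivrMr// -exprMn.
    have : `|Y| ^+ 3 <= (K * `|b n|) ^+ 3 by rewrite lerXn2r// nnegrE mulr_ge0.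
    have : 0 <= (K * `|b n|) ^+ 3 by rewrite exprn_ge0// mulr_ge0.
    by lra.
  have h4 : Y ^+ 4 <= (K * `|b n|) ^+ 4.
    have -> : Y ^+ 4 = `|Y| ^+ 4 by rewrite -normrX ger0_norm// exprn_even_ge0.
    by rewrite lerXn2r// nnegrE mulr_ge0.
  have : (K * `|b n|) ^+ 4 <= K ^+ 4 * `|b n| ^+ 3.
    have b34 : `|b n| ^+ 4 <= `|b n| ^+ 3.
      by rewrite [leLHS]exprS -[leRHS]mul1r ler_wpM2r ?exprn_ge0.
    by rewrite exprMn ler_wpM2l ?exprn_ge0.
  have : 0 <= K ^+ 4 * `|b n| ^+ 3 by rewrite mulr_ge0// exprn_ge0.
  by move=> ? ?; lra.
have h2 : `|q w * (cos X * (expR (- z) - 1 + z))| <= `|b n| ^+ 3.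
  rewrite !normrM (ger0_norm q0).
  apply: (@le_trans _ _ (1 * (1 * (z ^+ 2 / 2)))).
    apply: ler_pM => //.
    by apply: ler_pM => //; [exact: cos_max|exact: expRN_taylor].
  rewrite !mul1r.
  have zb : z <= `|b n| ^+ 2.
    rewrite /z real_normK ?num_real// ler_pdivrMr//.
    have /andP[_ s1] := s_01 w.
    have : s w * b n ^+ 2 <= 1 * b n ^+ 2 by rewrite ler_wpM2r// sqr_ge0.
    have := sqr_ge0 (b n); lra.
  have z2 : z ^+ 2 <= (`|b n| ^+ 2) ^+ 2 by rewrite lerXn2r// nnegrE.
  have : (`|b n| ^+ 2) ^+ 2 <= `|b n| ^+ 3.
    by rewrite -exprM [leLHS]exprS -[leRHS]mul1r ler_wpM2r ?exprn_ge0.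
  have : 0 <= z ^+ 2 by exact: sqr_ge0.
  by lra.
have h3 : `|b n ^+ 2 / 2 * (q w * cos X * (sg n w - s w))| <=
    b n ^+ 2 / 2 * `|sg n w - s w|.
  have b20 : 0 <= b n ^+ 2 / 2 by rewrite divr_ge0// sqr_ge0.
  rewrite normrM (ger0_norm b20) ler_wpM2l// !normrM -[leRHS]mul1r ler_wpM2r//.
  by rewrite -[leRHS]mul1r ler_pM// ?cos_max// ger0_norm.
rewrite (le_trans (ler_normB _ _))//.
have := ler_normB (q w * (cos (X + Y) - (cos X - Y * sin X - Y ^+ 2 / 2 * cos X)))
  (q w * (cos X * (expR (- z) - 1 + z))).
by lra.
Qed.

(** Telescoping between rank [m], where no Gaussian factor is present, and rank [p], where no noise
    is left. *)
Lemma lindeberg m : (p <= m)%N ->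
  `| Ex P (fun w => cos (S m w + th)) -
     Ex P (fun w => cos th * expR (- (s w * V p m / 2))) |
  <= \sum_(p <= l < m) (b l ^+ 2 / 2 * Ex P (fun w => `|sg l w - s w|)
       + (K ^+ 3 + K ^+ 4 + 1) * `|b l| ^+ 3).
Proof.
move=> pm.
pose F n := Ex P (fun w => cos (S n w + th) * expR (- (s w * V n m / 2))).
have Fm : Ex P (fun w => cos (S m w + th)) = F m.
  congr Ex; apply/funext => w; rewrite /V big_geq//.
  by rewrite mulr0 mul0r oppr0 expR0 mulr1.
have Fp : Ex P (fun w => cos th * expR (- (s w * V p m / 2))) = F p.
  congr Ex; apply/funext => w; rewrite /S big_geq//.
  by rewrite add0r.
rewrite Fm Fp -telescope_sumr//.
apply: le_trans (ler_norm_sum _ _ _) _.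
rewrite big_nat [leRHS]big_nat; apply: ler_sum => l plm.
exact: lindeberg_step.
Qed.

End lindeberg.

End martingale_differences.

(** * Gaussian increments and Brownian motion *)

Section gaussian_characteristic_function.
Context {R : realType}.
Variable s : R.
Hypothesis s_gt0 : 0 < s.
Notation mu := (@lebesgue_measure R).
Let p := normal_pdf 0 s.

Let s_neq0 : s != 0. Proof. by rewrite gt_eqF. Qed.

Let pE x : p x = normal_peak s * expR (- (x ^+ 2 / (2 * s ^+ 2))).
Proof.
rewrite /p normal_pdfE// /normal_fun subr0 mulNr.
by rewrite -[X in _ / X]mulr_natl.
Qed.

Let p_ge0 x : 0 <= p x. Proof. exact: normal_pdf_ge0. Qed.

Let dp (x : R) : is_derive x 1 p (- (x / s ^+ 2) * p x).
Proof.
have -> : p = (fun x => normal_peak s * expR (- (x ^+ 2 / (2 * s ^+ 2)))).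
  by apply/funext => y; exact: pE.
apply: is_derive_eq; rewrite /GRing.scale/=.
by field.
Qed.

(** Half of the exponent of the density absorbs the factor |x|; the other half is a Gaussian of
    standard deviation [s2]. This gives the integrable bound [G] for |x| p(x). *)
Let s2 := Num.sqrt 2 * s.
Let s2_gt0 : 0 < s2. Proof. by rewrite mulr_gt0// sqrtr_gt0. Qed.
Let C := normal_peak s * s / normal_peak s2.
Let G x := C * normal_pdf 0 s2 x.

Let xp_le x : `|x| * p x <= G x.
Proof.
have pk : 0 < normal_peak s2 by rewrite normal_peak_gt0// gt_eqF.
rewrite /G normal_pdfE ?gt_eqF// /C mulrA divfK ?gt_eqF// pE.
rewrite -mulrA mulrCA ler_wpM2l ?normal_peak_ge0//.
rewrite /normal_fun subr0 mulNr (_ : x ^+ 2 / (2 * s ^+ 2) =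
  (x / (2 * s)) ^+ 2 + x ^+ 2 / (s2 ^+ 2 *+ 2)); last first.
  by rewrite (_ : s2 ^+ 2 = 2 * s ^+ 2) ?exprMn ?sqr_sqrtr// -[_ *+ 2]mulr_natl; field.
rewrite opprD expRD mulrA ler_wpM2r ?expR_ge0//.
set u := x / (2 * s).
have -> : `|x| = 2 * s * `|u|.
  by rewrite /u normrM normfV (ger0_norm (_ : 0 <= 2 * s)) ?mulr_ge0 ?ltW//; field.
have h : 2 * `|u| * expR (- u ^+ 2) <= 1.
  rewrite expRN ler_pdivrMr ?expR_gt0// mul1r.
  apply: le_trans (expR_ge1Dx _).
  have := sqr_ge0 (`|u| - 1); rewrite sqrrB real_normK ?num_real//; lra.
by have := ler_wpM2l (ltW s_gt0) h; lra.
Qed.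

Let intG : mu.-integrable setT (EFin \o G).
Proof.
rewrite (_ : _ \o _ = fun x => (C%:E * (normal_pdf 0 s2 x)%:E)%E)//.
by apply: integrableZl => //; exact: integrable_normal_pdf.
Qed.

Lemma bmf_normal_integrable (f : R -> R) : bmf f ->
  mu.-integrable setT (EFin \o (fun x => f x * p x)).
Proof.
move=> [mf [M fM]].
apply: (@le_integrable _ _ _ mu _ measurableT _ (fun x => M%:E * (p x)%:E)%E).
- apply/measurable_EFinP; apply: measurable_funM => //.
  exact: measurable_normal_pdf.
- move=> x _; rewrite -EFinM /= lee_fin !normrM ler_wpM2r//.
  by rewrite (le_trans (fM x))// ler_norm.
- by apply: integrableZl => //; exact: integrable_normal_pdf.
Qed.

Let xp_integrable (f : R -> R) : bmf f ->
  mu.-integrable setT (EFin \o (fun x => f x * (x * p x))).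
Proof.
move=> [mf [M fM]].
apply: (@le_integrable _ _ _ mu _ measurableT _ (fun x => M%:E * (G x)%:E)%E).
- apply/measurable_EFinP; apply: measurable_funM => //.
  by apply: measurable_funM => //; exact: measurable_normal_pdf.
- move=> x _; rewrite -EFinM /= lee_fin [leLHS]normrM [leRHS]normrM.
  apply: ler_pM => //.
    by rewrite (le_trans (fM x))// ler_norm.
  by rewrite [leLHS]normrM (ger0_norm (p_ge0 _)) (le_trans (xp_le x))// ler_norm.
- exact: integrableZl.
Qed.

Definition normal_mean (f : R -> R) : R := \int[mu]_x (f x * p x).

Let mlin (l t : R) : measurable_fun setT (fun x : R => l * x + t).
Proof. by apply: measurable_funD => //; exact: measurable_funM. Qed.

(** Stein's identity: sin(l x + t) p(x) vanishes at infinity, so its derivative integrates to zero.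
    This is read on the intervals [-n-1, n+1] and passed to the limit. *)
Lemma normal_by_parts l t :
  \int[mu]_x (sin (l * x + t) * (x * p x)) =
  s ^+ 2 * l * normal_mean (fun x => cos (l * x + t)).
Proof.
pose F (x : R) := sin (l * x + t) * p x.
pose f (x : R) := l * (cos (l * x + t) * p x)
  - (s ^- 2) * (sin (l * x + t) * (x * p x)).
have dF (x : R) : is_derive x 1 F (f x).
  rewrite /F; have := dp x => dpx.
  by apply: is_derive_eq; rewrite /f /GRing.scale/=; field.
have bc : bmf (fun x : R => cos (l * x + t)) by exact: bmf_cos.
have bs : bmf (fun x : R => sin (l * x + t)) by exact: bmf_sin.
have ic := bmf_normal_integrable bc.
have is_ := xp_integrable bs.
have if1 : mu.-integrable setT (EFin \o (fun x => l * (cos (l * x + t) * p x))).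
  rewrite (_ : _ \o _ = fun x => (l%:E * (cos (l * x + t) * p x)%:E)%E)//.
  exact: integrableZl.
have if2 : mu.-integrable setT (EFin \o (fun x => s ^- 2 * (sin (l * x + t) * (x * p x)))).
  rewrite (_ : _ \o _ = fun x => ((s ^- 2)%:E * (sin (l * x + t) * (x * p x))%:E)%E)//.
  exact: integrableZl.
have iF : mu.-integrable setT (EFin \o f).
  rewrite (_ : _ \o _ = fun x => ((l * (cos (l * x + t) * p x))%:E
     - (s ^- 2 * (sin (l * x + t) * (x * p x)))%:E)%E)//.
  exact: integrableB.
suff f0 : \int[mu]_x f x = 0.
  have : \int[mu]_x f x = l * normal_mean (fun x => cos (l * x + t)) -
     s ^- 2 * \int[mu]_x (sin (l * x + t) * (x * p x)).
    by rewrite RintegralB// RintegralZl// RintegralZl.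
  rewrite f0 => /esym/eqP; rewrite subr_eq0 => /eqP h.
  by rewrite -mulrA h mulrA divff ?mul1r// sqrf_eq0.
have cf : continuous f.
  move=> x; rewrite /f.
  have cp : {for x, continuous p} by exact: continuous_normal_pdf.
  have clx : {for x, continuous (fun x : R => l * x + t)}.
    by apply: cvgD; [apply: cvgM; [exact: cvg_cst|exact: cvg_id]|exact: cvg_cst].
  apply: cvgB; (apply: cvgM; first exact: cvg_cst).
    apply: cvgM => //.
    by apply: continuous_comp clx _; exact: continuous_cos.
  apply: cvgM.
    by apply: continuous_comp clx _; exact: continuous_sin.
  by apply: cvgM => //; exact: cvg_id.
have cF : continuous F.
  by move=> x; apply: differentiable_continuous; apply/derivable1_diffP; apply: ex_derive; exact: dF.
have FTC n : \int[mu]_(x in `[- n.+1%:R, n.+1%:R]) f x = F n.+1%:R - F (- n.+1%:R).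
  have nn : (- n.+1%:R : R) < n.+1%:R by rewrite gt0_cp.
  rewrite /Rintegral (continuous_FTC2 nn (F := F)) ?fineB//.
  - exact: continuous_subspaceT.
  - split.
    + by move=> x _; apply: ex_derive; exact: dF.
    + by apply: cvg_at_right_filter; exact: cF.
    + by apply: cvg_at_left_filter; exact: cF.
  - by move=> x _; rewrite derive1E; apply: derive_val; exact: dF.
have lim1 : \int[mu]_(x in `[- n.+1%:R, n.+1%:R]) f x @[n --> \oo] --> \int[mu]_x f x.
  have mA n : measurable (`[- n.+1%:R, n.+1%:R]%classic : set R) by exact: measurable_itv.
  have mf : measurable_fun setT (EFin \o f) by exact: measurable_int iF.
  have [|||||_ _ h] := @dominated_convergence _ _ _ mu setT measurableT
    (fun n => (EFin \o f) \_ `[- n.+1%:R, n.+1%:R]) (EFin \o f) (fun x => `|(EFin \o f) x|%E).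
  - by move=> n; apply/(measurable_restrictT _ (mA n)); exact: measurable_funTS.
  - exact: mf.
  - apply: aeW => x _; apply: cvg_near_cst.
    exists (Num.truncn `|x|) => // n /= xn; rewrite patchE mem_set//=.
    rewrite in_itv/= -ler_norml.
    have := ltW (truncnS_gt `|x|) => /le_trans; apply.
    by rewrite ler_nat.
  - exact: integrable_abse.
  - by apply: aeW => x n _; rewrite patchE; case: ifP => // _; rewrite abse0.
  apply: fine_cvg; rewrite fineK; last exact: integrable_fin_num.
  by under eq_fun do rewrite integral_mkcond.
(* Since |x| p(x) is bounded, the boundary terms are O(1/n). *)
have lim2 : F n.+1%:R - F (- n.+1%:R) @[n --> \oo] --> (0 : R).
  pose B := C * normal_peak s2.
  have Fb (x : R) : 0 < `|x| -> `|F x| <= B / `|x|.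
    move=> x0; rewrite ler_pdivlMr// mulrC /F normrM (ger0_norm (p_ge0 _)) mulrCA.
    rewrite -[leRHS]mul1r ler_pM ?mulr_ge0// ?sin_max// (le_trans (xp_le x))//.
    rewrite /G /B ler_wpM2l ?normal_pdf_ub ?gt_eqF//.
    by rewrite /C divr_ge0 ?normal_peak_ge0// mulr_ge0 ?normal_peak_ge0// ltW.
  have hB : (2 * B) * harmonic n @[n --> \oo] --> (0 : R).
    by rewrite -(mulr0 (2 * B)); apply: cvgMr; exact: cvg_harmonic.
  apply: cvg0_le hB; apply: nearW => n.
  rewrite (le_trans (ler_normB _ _))//.
  have n0 : 0 < `|n.+1%:R| :> R by rewrite normr_gt0 pnatr_eq0.
  have nE : `|n.+1%:R| = n.+1%:R :> R by rewrite ger0_norm.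
  have h1 := Fb n.+1%:R n0; have h2 := Fb (- n.+1%:R); rewrite normrN in h2.
  rewrite (_ : 2 * B * harmonic n = B / n.+1%:R + B / n.+1%:R); last first.
    by rewrite /harmonic/= -mulrA mulr_natl mulr2n.
  by move: h1 (h2 n0); rewrite nE => h1' h2'; exact: lerD.
have lim3 : \int[mu]_(x in `[- n.+1%:R, n.+1%:R]) f x @[n --> \oo] --> (0 : R).
  by under eq_fun do rewrite FTC.
exact: (cvg_unique _ lim1 lim3).
Unshelve. all: by end_near. Qed.

(** As a function of [l] the integral solves J' = - s^2 l J with J(0) = cos t, by differentiation
    under the integral and Stein's identity; [H] below is J times the integrating factor. *)
Lemma normal_mean_cos l t :
  normal_mean (fun x => cos (l * x + t)) = cos t * expR (- (s ^+ 2 * l ^+ 2 / 2)).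
Proof.
pose f (l : R) (x : R) := cos (l * x + t) * p x.
have df (l' x : R) : is_derive l' 1 (f^~ x) (- sin (l' * x + t) * (x * p x)).
  by rewrite /f; apply: is_derive_eq; rewrite /GRing.scale/=; ring.
have int (l' : R) : mu.-integrable setT (EFin \o f l').
  by apply: bmf_normal_integrable; exact: bmf_cos.
have d1 (l' x : R) : partial1of2 f l' x = - sin (l' * x + t) * (x * p x).
  by rewrite partial1of2E; apply: derive_val; exact: df.
have G0 x : 0 <= G x by apply: le_trans (xp_le x); rewrite mulr_ge0.
have Gub (l' x : R) : `|partial1of2 f l' x| <= G x.
  rewrite d1 !normrM normrN -[leRHS]mul1r ler_pM ?mulr_ge0 ?sin_max//.
  by rewrite (ger0_norm (p_ge0 _)) xp_le.
pose J (l' : R) := \int[mu]_x f l' x.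
have dJ (l' : R) : is_derive l' 1 J (- (s ^+ 2 * l' * J l')).
  have Il : `]l' - 1, l' + 1[%classic l' by rewrite /= in_itv/=; apply/andP; split; lra.
  have H1 (x : R) : `]l' - 1, l' + 1[%classic x -> mu.-integrable setT (EFin \o f x) by [].
  have H2 (x y : R) : `]l' - 1, l' + 1[%classic x -> [set: R] y -> derivable (f^~ y) x 1.
    by move=> _ _; apply: ex_derive; exact: df.
  have H3 (x y : R) : `]l' - 1, l' + 1[%classic x -> [set: R] y -> `|partial1of2 f x y| <= G y by [].
  apply: DeriveDef; first exact: (derivable_under_integral measurableT Il H1 H2 G0 intG H3).
  rewrite -derive1E (differentiation_under_integral measurableT Il H1 H2 G0 intG H3).
  under eq_Rintegral do rewrite d1 mulNr.
  have -> : \int[mu]_x (- (sin (l' * x + t) * (x * p x))) =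
     -1 * \int[mu]_x (sin (l' * x + t) * (x * p x)).
    rewrite -RintegralZl//; last by apply: xp_integrable; exact: bmf_sin.
    by under eq_Rintegral do rewrite -mulN1r.
  by rewrite normal_by_parts mulN1r.
pose H (l' : R) := J l' * expR (s ^+ 2 * l' ^+ 2 / 2).
have dH (l' : R) : is_derive l' 1 H 0.
  rewrite /H; have := dJ l' => dJl.
  by apply: is_derive_eq; rewrite /GRing.scale/=; field.
have J0 : J 0 = cos t.
  rewrite /J /f; under eq_Rintegral do rewrite mul0r add0r.
  rewrite RintegralZl//; last exact: integrable_normal_pdf.
  by rewrite /Rintegral integral_normal_pdf mulr1.
have := is_derive_0_is_cst l 0 dH.
rewrite /H J0 expr0n/= mulr0 mul0r expR0 mulr1 => <-.
by rewrite -[RHS]mulrA -expRD subrr expR0 mulr1.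
Qed.

(* The weight [H] carries the randomness independent of [X]. *)
Lemma normal_mean_ext d' (T' : measurableType d') (P' : probability T' R)
  (H X : T' -> R) (c : R) (f : R -> R) :
  bmf H -> measurable_fun setT X -> bmf f ->
  (forall B, measurable B ->
     Ex P' (fun w => H w * \1_(X @^-1` B) w) = c * fine (normal_prob 0 s B)) ->
  Ex P' (fun w => H w * f (X w)) = c * normal_mean f.
Proof.
move=> bH mX bf HX.
have [MH HM] := bH.2.
have MH0 : 0 <= MH by apply: le_trans (HM point).
have bfX (g : R -> R) : bmf g -> bmf (fun w => g (X w)).
  by move=> [mg [M gM]]; split; [exact: measurableT_comp|exists M].
apply/eqP; rewrite -subr_eq0 -normr_eq0 eq_le normr_ge0 andbT.
apply/ler_addgt0Pr => e e0; rewrite add0r.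
pose e' := e / (MH + `|c| + 1).
have D0 : 0 < MH + `|c| + 1 by rewrite ltr_wpDl// addr_ge0.
have e'0 : 0 < e' by rewrite divr_gt0.
have [n [a [A [mA fA]]]] := bmf_approx bf e'0.
pose g x := \sum_(k < n) a k * \1_(f @^-1` (A k)) x : R.
have mfA k : measurable (f @^-1` A k) by rewrite -[X in measurable X]setTI; exact: bf.1.
have bi k : bmf (\1_(f @^-1` (A k)) : R -> R) by exact: bmf_indic.
have bg : bmf g by apply: bmf_sum => k; apply: bmfM; [exact: bmf_cst|exact: bi].
have Eg : Ex P' (fun w => H w * g (X w)) = c * normal_mean g.
  have -> : (fun w => H w * g (X w)) =
      (fun w => \sum_(k < n) a k * (H w * \1_(X @^-1` (f @^-1` A k)) w)).
    by apply/funext => w; rewrite /g mulr_sumr; apply: eq_bigr => k _; rewrite mulrCA.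
  have bk k : bmf (fun w => H w * \1_(X @^-1` (f @^-1` A k)) w).
    apply: bmfM => //; apply: bmf_indic.
    by rewrite -[X in measurable X]setTI; exact: mX.
  rewrite Ex_sum; last by move=> k; apply: bmfM; [exact: bmf_cst|exact: bk].
  have -> : normal_mean g = \sum_(k < n) a k * fine (normal_prob 0 s (f @^-1` A k)).
    have ik (k : nat) : normal_mean (\1_(f @^-1` A k)) = fine (normal_prob 0 s (f @^-1` A k)).
      rewrite /normal_prob integral_mkcond /normal_mean /Rintegral; congr fine.
      apply: eq_integral => x _; rewrite patchE indicE.
      by case: (x \in _); rewrite ?mul1r ?mul0r.
    rewrite /normal_mean /g.
    clear fA bg; clear g; elim: n => [|m IHm].
      under eq_Rintegral do rewrite big_ord0 mul0r.
      by rewrite big_ord0 /Rintegral integral0.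
    under eq_Rintegral do rewrite big_ord_recr/= mulrDl -mulrA.
    rewrite RintegralD//.
    - rewrite IHm big_ord_recr/= RintegralZl//; first by rewrite -ik.
      exact: bmf_normal_integrable.
    - apply: bmf_normal_integrable; apply: bmf_sum => k.
      by apply: bmfM; [exact: bmf_cst|exact: bi].
    - under eq_fun do rewrite mulrA.
      by apply: bmf_normal_integrable; apply: bmfM; [exact: bmf_cst|exact: bi].
  rewrite mulr_sumr; apply: eq_bigr => k _.
  by rewrite ExZ// HX// mulrCA.
have -> : Ex P' (fun w => H w * f (X w)) - c * normal_mean f =
   (Ex P' (fun w => H w * f (X w)) - Ex P' (fun w => H w * g (X w))) -
   c * (normal_mean f - normal_mean g) by rewrite Eg; ring.
have h1 : `|Ex P' (fun w => H w * f (X w)) - Ex P' (fun w => H w * g (X w))| <= MH * e'.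
  apply: Ex_dist_le; [by apply: bmfM => //; exact: bfX|by apply: bmfM => //; exact: bfX|].
  by move=> w; rewrite -mulrBr normrM ler_pM.
have h2 : `|c * (normal_mean f - normal_mean g)| <= `|c| * e'.
  rewrite normrM ler_wpM2l//.
  rewrite /normal_mean -RintegralB//; try exact: bmf_normal_integrable.
  under eq_Rintegral do rewrite -mulrBl.
  have bfg : bmf (fun x => f x - g x) by exact: bmfB.
  apply: (le_trans (le_normr_Rintegral _ _)) => //; first exact: bmf_normal_integrable.
  have -> : e' = \int[mu]_x (e' * p x).
    rewrite RintegralZl//; last exact: integrable_normal_pdf.
    by rewrite /Rintegral integral_normal_pdf mulr1.
  apply: le_Rintegral => //.
  - rewrite (_ : _ \o _ = fun x => `|((f x - g x) * p x)%:E|%E)//.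
    exact/integrable_abse/bmf_normal_integrable.
  - by apply: bmf_normal_integrable; exact: bmf_cst.
  - by move=> x _; rewrite normrM (ger0_norm (p_ge0 x)) ler_wpM2r.
rewrite (le_trans (ler_normB _ _))// (le_trans (lerD h1 h2))//.
rewrite -mulrDl mulrC /e' mulrAC ler_pdivrMr// ler_wpM2l ?(ltW e0)//; lra.
Qed.

End gaussian_characteristic_function.

(** * Brownian increments at fixed and at random times *)

Section brownian.
Context {R : realType} d' (T' : measurableType d') (P' : probability T' R).
Variables (W : R -> T' -> R) (Z' : T' -> R).
Hypothesis BM : BM_indep_of P' W Z'.

Let mW t : measurable_fun setT (W t). Proof. by case: BM. Qed.
Let mZ : measurable_fun setT Z'. Proof. by case: BM => _ []. Qed.
Let W0 w : W 0 w = 0. Proof. by case: BM => _ [_ []]. Qed.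
Let cW w : {within [set t | 0 <= t], continuous (fun t => W t w)}.
Proof. by case: BM => _ [_ [_ []]]. Qed.

Section increments.
Variables (k : nat) (t lam : nat -> R).
Hypothesis t0 : t 0%N = 0.
Hypothesis t_lt : forall j, (j < k)%N -> t j < t j.+1.

Let X j w := W (t j.+1) w - W (t j) w.
Let mX j : measurable_fun setT (X j). Proof. exact: measurable_funB. Qed.
Let sd j := Num.sqrt (t j.+1 - t j).

Let sd_gt0 j : (j < k)%N -> 0 < sd j.
Proof. by move=> jk; rewrite sqrtr_gt0 subr_gt0 t_lt. Qed.

Let BM_prod (B : nat -> set R) A : measurable A -> (forall j, measurable (B j)) ->
  Ex P' (fun w => \1_(Z' @^-1` A) w * \prod_(0 <= j < k) \1_(X j @^-1` B j) w) =
  fine (P' (Z' @^-1` A)) * \prod_(0 <= j < k) fine (normal_prob 0 (sd j) (B j)).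
Proof.
move=> mA mB.
have [_ [_ [_ [_ /(_ k (fun j => t j) (fun j => B j) A t0)]]]] := BM.
move=> /(_ (fun j => t_lt (ltn_ord j)) mA (fun j => mB j)) h.
have mZA : measurable (Z' @^-1` A) by rewrite -[X in measurable X]setTI; exact: mZ.
have mXB j : measurable (X j @^-1` B j).
  by rewrite -[X in measurable X]setTI; exact: mX.
set E := _ `&` _ in h.
have EE : E = Z' @^-1` A `&` \big[setI/setT]_(j < k) (X j @^-1` B j).
  rewrite /E -(bigcap_mkord k (fun j => X j @^-1` B j)); congr (_ `&` _).
  apply/seteqP; split => w /=.
    by move=> hw j /= jk; exact: (hw (Ordinal jk)).
  by move=> hw j; apply: hw => /=.
have mE : measurable E.
  by rewrite EE; apply: measurableI => //; apply: bigsetI_measurable.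
have -> : (fun w => \1_(Z' @^-1` A) w * \prod_(0 <= j < k) \1_(X j @^-1` B j) w) =
    (\1_E : T' -> R).
  have indI (C D : set T') w : \1_(C `&` D) w = \1_C w * \1_D w :> R.
    by rewrite !indicE in_setI; do 2 case: (_ \in _); rewrite ?mul1r ?mul0r.
  apply/funext => w; rewrite big_mkord EE indI; congr (_ * _).
  elim/big_rec2 : _ => [|j a b _ h'].
    by rewrite indicE mem_set.
  by rewrite indI h'.
have fN (a : R) (C : set R) : measurable C -> (normal_prob 0 a C \is a fin_num)%E.
  by move=> mC; exact: (@fin_num_measure _ _ _ (normal_prob 0 a)).
have pE : (\prod_(j < k) normal_prob 0
    (Num.sqrt (t (lift ord0 j) - t (widen_ord (leqnSn k) j))) (B j) =
    (\prod_(j < k) fine (normal_prob 0 (sd j) (B j)))%:E)%E.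
  elim/big_rec2 : _ => // j a b _ ->.
  by rewrite EFinM fineK//; exact: fN.
rewrite Ex_indic// h pE big_mkord fineM//.
exact: fin_num_measure.
Qed.

(** The first [m] increments are tested by a cosine and the others by indicators. Induction on [m]
    turns one indicator after another into a cosine, everything else forming the weight of
    [normal_mean_ext]. *)
Let BM_cos_rec m A (B : nat -> set R) th : (m <= k)%N ->
  measurable A -> (forall j, measurable (B j)) ->
  Ex P' (fun w => \1_(Z' @^-1` A) w * cos (\sum_(0 <= j < m) lam j * X j w + th) *
           \prod_(m <= j < k) \1_(X j @^-1` B j) w) =
  fine (P' (Z' @^-1` A)) *
    (cos th * expR (- (\sum_(0 <= j < m) lam j ^+ 2 * (t j.+1 - t j)) / 2)) *
  \prod_(m <= j < k) fine (normal_prob 0 (sd j) (B j)).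
Proof.
move=> mk mA; elim: m mk th B => [|m ih] mk th B mB.
  under eq_fun do rewrite [X in cos (X + _)]big_geq// add0r.
  rewrite [X in expR (- X / _)]big_geq// oppr0 mul0r expR0 mulr1.
  have bp : @bmf R _ _ (fun w => \1_(Z' @^-1` A) w * \prod_(0 <= j < k) \1_(X j @^-1` B j) w).
    apply: bmfM.
      by apply: bmf_indic; rewrite -[X in measurable X]setTI; exact: mZ.
    apply: bmf_prod => j; apply: bmf_indic; rewrite -[X in measurable X]setTI.
    exact: mX.
  have -> : (fun w => \1_(Z' @^-1` A) w * cos th * \prod_(0 <= j < k) \1_(X j @^-1` B j) w)
    = (fun w => cos th * (\1_(Z' @^-1` A) w * \prod_(0 <= j < k) \1_(X j @^-1` B j) w)).
    by apply/funext => w; rewrite mulrCA mulrA.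
  by rewrite ExZ// BM_prod// mulrCA mulrA.
have sm := sd_gt0 mk.
pose rest w := \prod_(m.+1 <= j < k) \1_(X j @^-1` B j) w : R.
pose S w := \sum_(0 <= j < m) lam j * X j w.
have mS : measurable_fun setT S.
  by apply: measurable_sum => j; apply: measurable_funM.
have bZA : bmf (\1_(Z' @^-1` A) : T' -> R).
  by apply: bmf_indic; rewrite -[X in measurable X]setTI; exact: mZ.
have brest : bmf rest.
  apply: bmf_prod => j; apply: bmf_indic; rewrite -[X in measurable X]setTI.
  exact: mX.
pose Hh th w := \1_(Z' @^-1` A) w * cos (S w + th) * rest w.
have bH th' : bmf (Hh th').
  apply: bmfM => //; apply: bmfM => //; apply: bmf_cos.
  exact: measurable_funD.
pose cc th' := fine (P' (Z' @^-1` A)) *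
    (cos th' * expR (- (\sum_(0 <= j < m) lam j ^+ 2 * (t j.+1 - t j)) / 2)) *
  \prod_(m.+1 <= j < k) fine (normal_prob 0 (sd j) (B j)).
(* The induction hypothesis leaves the set at rank [m] free, which gives the law of [X m] under the
   weight. *)
have Hc th' (B0 : set R) : measurable B0 ->
   Ex P' (fun w => Hh th' w * \1_(X m @^-1` B0) w) = cc th' * fine (normal_prob 0 (sd m) B0).
  move=> mB0.
  have := ih (ltnW mk) th' (fun j => if j == m then B0 else B j).
  have E1 w : \prod_(m <= j < k) \1_(X j @^-1` (if j == m then B0 else B j)) w =
     \1_(X m @^-1` B0) w * rest w.
    rewrite big_ltn// eqxx; congr (_ * _); apply: eq_big_nat => j /andP[mj _].
    by rewrite gtn_eqF.
  have E2 : \prod_(m <= j < k) fine (normal_prob 0 (sd j) (if j == m then B0 else B j)) =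
     fine (normal_prob 0 (sd m) B0) * \prod_(m.+1 <= j < k) fine (normal_prob 0 (sd j) (B j)).
    rewrite big_ltn// eqxx; congr (_ * _); apply: eq_big_nat => j /andP[mj _].
    by rewrite gtn_eqF.
  under eq_fun do rewrite E1.
  rewrite E2 => h.
  have -> : (fun w => Hh th' w * \1_(X m @^-1` B0) w) =
     (fun w => \1_(Z' @^-1` A) w * cos (S w + th') * (\1_(X m @^-1` B0) w * rest w)).
    by apply/funext => w; rewrite /Hh mulrAC mulrA.
  rewrite h; last by move=> j; case: ifP.
  by rewrite /cc [RHS]mulrAC mulrA.
have bcos (l a : R) : bmf (fun x : R => cos (l * x + a)).
  by apply: bmf_cos; apply: measurable_funD => //; exact: measurable_funM.
(* A phase shift by pi / 2 writes the sines of the addition formula as cosines, so the induction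
   hypothesis covers both terms; the second one then vanishes because cos (pi / 2) = 0. *)
have E3 : (fun w => \1_(Z' @^-1` A) w * cos (\sum_(0 <= j < m.+1) lam j * X j w + th) * rest w)
  = (fun w => Hh th w * cos (lam m * X m w + 0) - Hh (th - pi / 2) w * cos (lam m * X m w - pi / 2)).
  apply/funext => w; rewrite big_nat_recr//= -/(S w) /Hh.
  rewrite addr0 addrA [X in _ * X - _]/= !cosBpihalf.
  rewrite (_ : S w + lam m * X m w + th = (S w + th) + lam m * X m w); last by ring.
  by rewrite cosD; ring.
rewrite -/(rest) E3 ExB; last 2 first.
- by apply: bmfM => //; apply: bmf_cos; apply: measurable_funD => //; apply: measurable_funM.
- by apply: bmfM => //; apply: bmf_cos; apply: measurable_funD => //; apply: measurable_funM.
rewrite (normal_mean_ext (bH _) (@mX m) (bcos (lam m) 0) (Hc th)).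
rewrite (normal_mean_ext (bH _) (@mX m) (bcos (lam m) (- (pi / 2))) (Hc (th - pi / 2))).
rewrite !normal_mean_cos// cos0 cosN cos_pihalf mul0r mulr0 subr0 mul1r /cc.
rewrite mulrAC; congr (_ * _); rewrite -!mulrA; congr (_ * (_ * _)).
rewrite -expRD big_nat_recr//=; congr expR.
have : sd m * sd m = t m.+1 - t m.
  by rewrite -expr2 /sd sqr_sqrtr// subr_ge0 ltW// t_lt.
by move=> <-; field.
Qed.

Lemma BM_cos A th : measurable A ->
  Ex P' (fun w => \1_(Z' @^-1` A) w *
     cos (\sum_(0 <= j < k) lam j * (W (t j.+1) w - W (t j) w) + th)) =
  fine (P' (Z' @^-1` A)) *
    (cos th * expR (- (\sum_(0 <= j < k) lam j ^+ 2 * (t j.+1 - t j)) / 2)).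
Proof.
move=> mA; have := @BM_cos_rec k A (fun=> setT) th (leqnn k) mA (fun=> measurableT).
rewrite big_geq// mulr1 => <-; congr Ex; apply/funext => w.
by rewrite big_geq// mulr1.
Qed.

End increments.

(* The Brownian motion is run at the random times [v Z' * q j]; as [v Z'] is
   independent of it, one may first replace [v Z'] by a discretisation. *)
Section random_time.
Variables (k : nat) (q lam : nat -> R) (v : R -> R) (M th : R).
Hypothesis q0 : q 0%N = 0.
Hypothesis q_lt : forall j, (j < k)%N -> q j < q j.+1.
Hypothesis mv : measurable_fun setT v.
Hypothesis v_ge0 : forall z, 0 <= v z.
Hypothesis v_le : forall z, v z <= M.

Let q_ge0 j : (j <= k)%N -> 0 <= q j.
Proof.
elim: j => [|j ih] jk; first by rewrite q0.
by rewrite (le_trans (ih (ltnW jk)))// ltW// q_lt.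
Qed.

Let V w := v (Z' w).
Let mV : measurable_fun setT V. Proof. exact: measurableT_comp. Qed.
Let idx n w := Num.truncn (n.+1%:R * V w).
Let Vn n w : R := (idx n w)%:R / n.+1%:R.
Let Nn n := (Num.truncn (n.+1%:R * M)).+1.
Let slice n i : set R := v @^-1` `[i%:R / n.+1%:R, i.+1%:R / n.+1%:R[.

Let mslice n i : measurable (slice n i).
Proof. by rewrite -[X in measurable X]setTI; apply: mv => //; exact: measurable_itv. Qed.

Let idxP n w i : (Z' @^-1` slice n i) w <-> idx n w = i.
Proof.
have n0 : 0 < n.+1%:R :> R by [].
rewrite /slice /preimage/= in_itv/= /idx; split.
  move=> /andP[h1 h2]; apply: truncn_def; apply/andP; split.
    by rewrite mulrC -ler_pdivrMr.
  by rewrite mulrC -ltr_pdivlMr.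
move=> <-; have /andP[h1 h2] := @truncn_itv _ (n.+1%:R * V w) (mulr_ge0 (ltW n0) (v_ge0 _)).
by rewrite ler_pdivrMr// [X in _ <= X]mulrC h1/= ltr_pdivlMr// [X in X < _]mulrC.
Qed.

Let idx_lt n w : (idx n w < Nn n)%N.
Proof. by rewrite /idx /Nn ltnS; apply: le_truncn; rewrite ler_pM2l// v_le. Qed.

Let split_idx n (F : nat -> T' -> R) w :
  F (idx n w) w = \sum_(i < Nn n) \1_(Z' @^-1` slice n i) w * F i w.
Proof.
rewrite (bigD1 (Ordinal (idx_lt n w)))//= big1; last first.
  move=> i ii; rewrite indicE memNset ?mul0r// => /idxP iE.
  by move/eqP: ii; apply; exact: val_inj.
by rewrite indicE mem_set ?mul1r ?addr0//; apply/idxP.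
Qed.

Let Vn_cvg w : Vn n w @[n --> \oo] --> V w.
Proof.
apply/subr_cvg0; apply: (@cvg0_le _ _ harmonic); last exact: cvg_harmonic.
apply: nearW => n.
have n0 : 0 < n.+1%:R :> R by [].
have /andP[h1 h2] := @truncn_itv _ (n.+1%:R * V w) (mulr_ge0 (ltW n0) (v_ge0 _)).
rewrite /Vn /harmonic/= -(ler_pM2r n0) mulVf ?gt_eqF//.
rewrite -[X in _ * X](ger0_norm (ltW n0)) -normrM mulrBl divfK ?gt_eqF// mulrC.
rewrite ler0_norm; last by rewrite subr_le0.
by move: h1 h2; rewrite -/(idx n w) -[(idx n w).+1%:R]natr1; lra.
Qed.

Let Y (U : T' -> R) j w := W (U w * q j.+1) w - W (U w * q j) w.
Let Q := \sum_(0 <= j < k) lam j ^+ 2 * (q j.+1 - q j).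

Let Q_ge0 : 0 <= Q.
Proof.
rewrite /Q big_nat sumr_ge0// => j /= jk; rewrite mulr_ge0 ?sqr_ge0// subr_ge0.
by rewrite ltW// q_lt.
Qed.

Let mYn n j : measurable_fun setT (Y (Vn n) j).
Proof.
have -> : Y (Vn n) j = fun w => \sum_(i < Nn n) \1_(Z' @^-1` slice n i) w *
   (W (i%:R / n.+1%:R * q j.+1) w - W (i%:R / n.+1%:R * q j) w).
  by apply/funext => w; rewrite -(split_idx n
    (fun i w => W (i%:R / n.+1%:R * q j.+1) w - W (i%:R / n.+1%:R * q j) w)).
apply: measurable_sum => i; apply: measurable_funM; last exact: measurable_funB.
by apply: measurable_indic; rewrite -[X in measurable X]setTI; exact: mZ.
Qed.

Let W_cvg (x : nat -> R) y w : (forall n, 0 <= x n) -> x @ \oo --> y ->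
  W (x n) w @[n --> \oo] --> W y w.
Proof.
move=> x0 xy.
have y0 : 0 <= y.
  rewrite -(cvg_lim _ xy)//; apply: limr_ge; first exact: cvgP xy.
  exact: nearW.
have /subspace_continuousP/(_ y y0) h := @cW w.
apply: (cvg_comp x (fun t => W t w)) h.
move=> A; rewrite /within/= => /xy; rewrite /nbhs/=.
by apply: filterS => n; exact.
Qed.

Let Yn_cvg j w : (j < k)%N -> Y (Vn n) j w @[n --> \oo] --> Y V j w.
Proof.
move=> jk; apply: cvgB; apply: W_cvg.
- by move=> n; rewrite mulr_ge0 ?divr_ge0// q_ge0.
- by apply: cvgMl; exact: Vn_cvg.
- by move=> n; rewrite mulr_ge0 ?divr_ge0// q_ge0// ltnW.
- by apply: cvgMl; exact: Vn_cvg.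
Qed.

Lemma measurable_time_change j : (j < k)%N -> measurable_fun setT (Y V j).
Proof.
move=> jk; apply: (measurable_fun_cvg (h := fun n => Y (Vn n) j)) => //.
by move=> w _; exact: Yn_cvg.
Qed.

Lemma BM_cos_random :
  Ex P' (fun w => cos (\sum_(0 <= j < k) lam j * Y V j w + th)) =
  Ex P' (fun w => cos th * expR (- (V w * Q) / 2)).
Proof.
(* On each slice the time is a fixed multiple i / (n + 1), and [BM_cos] applies with the slice as
   the event on [Z']. *)
have En n : Ex P' (fun w => cos (\sum_(0 <= j < k) lam j * Y (Vn n) j w + th)) =
   Ex P' (fun w => cos th * expR (- (Vn n w * Q) / 2)).
  pose F (i : nat) w := cos (\sum_(0 <= j < k) lam j *
    (W (i%:R / n.+1%:R * q j.+1) w - W (i%:R / n.+1%:R * q j) w) + th).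
  pose H (i : nat) (w : T') := cos th * expR (- (i%:R / n.+1%:R * Q) / 2).
  have b1 i : bmf (\1_(Z' @^-1` slice n i) : T' -> R).
    by apply: bmf_indic; rewrite -[X in measurable X]setTI; exact: mZ.
  have bF i : bmf (F i).
    apply: bmf_cos; apply: measurable_funD => //; apply: measurable_sum => j.
    by apply: measurable_funM => //; exact: measurable_funB.
  transitivity (Ex P' (fun w => \sum_(i < Nn n) \1_(Z' @^-1` slice n i) w * F i w)).
    by congr Ex; apply/funext => w; rewrite -(split_idx n F).
  transitivity (Ex P' (fun w => \sum_(i < Nn n) \1_(Z' @^-1` slice n i) w * H i w)); last first.
    by congr Ex; apply/funext => w; rewrite -(split_idx n H).
  rewrite !Ex_sum; last 2 first.
  - by move=> i; apply: bmfM => //; exact: bmf_cst.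
  - by move=> i; apply: bmfM.
  apply: eq_bigr => i _.
  have -> : Ex P' (fun w => \1_(Z' @^-1` slice n i) w * H i w) =
     fine (P' (Z' @^-1` slice n i)) * (cos th * expR (- (i%:R / n.+1%:R * Q) / 2)).
    under eq_fun do rewrite mulrC.
    rewrite ExZ// mulrC Ex_indic//.
    by rewrite -[X in measurable X]setTI; exact: mZ.
  (* In the slice of index 0 the times all collapse to 0, where [BM_cos], which needs increasing
     times, does not apply; there the increments vanish. *)
  case: i => -[|i] ii /=.
    rewrite /F; under eq_fun do under eq_bigr do rewrite !mul0r subrr mulr0.
    under eq_fun do rewrite big1_eq add0r mulrC.
    rewrite ExZ// Ex_indic; last by rewrite -[X in measurable X]setTI; exact: mZ.
    by rewrite !mul0r oppr0 mul0r expR0 mulr1 mulrC.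
  have i0 : 0 < i.+1%:R / n.+1%:R :> R by rewrite divr_gt0.
  rewrite /F BM_cos//.
  - congr (_ * (_ * expR (- _ / 2))); rewrite /Q mulr_sumr; apply: eq_bigr => j _.
    by rewrite -mulrBr mulrCA.
  - by rewrite q0 mulr0.
  - by move=> j jk; rewrite ltr_pM2l// q_lt.
have bexp (U : T' -> R) : measurable_fun setT U -> (forall w, 0 <= U w) ->
    bmf (fun w => cos th * expR (- (U w * Q) / 2)).
  move=> mU U0; apply: bmfM; first exact: bmf_cst.
  apply: bmf_expRN; last by move=> w; rewrite mulNr oppr_le0 divr_ge0// mulr_ge0.
  by do 2 (apply: measurable_funM || apply: measurableT_comp) => //; apply: measurable_funM.
have mVn n : measurable_fun setT (Vn n).
  have -> : Vn n = fun w => \sum_(i < Nn n) \1_(Z' @^-1` slice n i) w * (i%:R / n.+1%:R).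
    by apply/funext => w; rewrite -(split_idx n (fun i w => i%:R / n.+1%:R)).
  apply: measurable_sum => i; apply: measurable_funM => //.
  by apply: measurable_indic; rewrite -[X in measurable X]setTI; exact: mZ.
have Vn0 n w : 0 <= Vn n w by rewrite divr_ge0.
have l1 : Ex P' (fun w => cos (\sum_(0 <= j < k) lam j * Y (Vn n) j w + th)) @[n --> \oo] -->
   Ex P' (fun w => cos (\sum_(0 <= j < k) lam j * Y V j w + th)).
  apply: (@Ex_dct _ _ _ _ _ _ 1).
  - move=> n; apply: bmf_meas; apply: bmf_cos; apply: measurable_funD => //.
    by apply: measurable_sum => j; exact: measurable_funM.
  - apply: bmf_cos; apply: measurable_funD => //.
    have -> : (fun w => \sum_(0 <= j < k) lam j * Y V j w) =
       (fun w => \sum_(j < k) lam j * Y V j w) by apply/funext => w; rewrite big_mkord.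
    by apply: measurable_sum => j; apply: measurable_funM => //; exact: measurable_time_change.
  - by move=> n w; exact: cos_max.
  - apply: aeW => w; apply: (@continuous_cvg _ _ _ _ _ _ cos); first exact: continuous_cos.
    apply: cvgD; last exact: cvg_cst.
    under eq_fun do rewrite big_mkord. rewrite big_mkord.
    by apply: cvg_bigsum => j; apply: cvgMr; exact: Yn_cvg.
have l2 : Ex P' (fun w => cos th * expR (- (Vn n w * Q) / 2)) @[n --> \oo] -->
   Ex P' (fun w => cos th * expR (- (V w * Q) / 2)).
  apply: (@Ex_dct _ _ _ _ _ _ 1).
  - by move=> n; apply: bmf_meas; exact: bexp.
  - by apply: bexp => // w; exact: v_ge0.
  - move=> n w; rewrite normrM -[leRHS]mulr1 ler_pM// ?cos_max// ger0_norm ?expR_ge0//.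
    by rewrite -[leRHS]expR0 ler_expR mulNr oppr_le0 divr_ge0// mulr_ge0.
  - apply: aeW => w; apply: cvgMr.
    apply: (@continuous_cvg _ _ _ _ _ _ expR); first exact: continuous_expR.
    by apply: cvgMl; apply: cvgN; apply: cvgMl; exact: Vn_cvg.
suff l3 : Ex P' (fun w => cos (\sum_(0 <= j < k) lam j * Y (Vn n) j w + th)) @[n --> \oo] -->
   Ex P' (fun w => cos th * expR (- (V w * Q) / 2)) by exact: (cvg_unique _ l1 l3).
by under eq_fun do rewrite En.
Qed.

End random_time.

End brownian.

(** * Trigonometric polynomials and Lipschitz functions of finitely many variables *)

Section product_bernoulli.
Context {R : realFieldType} {S : finType}.
Variable p : S -> R.

(** Probability of the outcome [b]. It is used twice: as the weight in Bernstein's operator and as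
    the conditional law of the I_{n+1}(j). *)
Definition bern (b : S -> bool) : R := \prod_s (if b s then p s else 1 - p s).

(** Independence, as distributivity of the product over sums. The moments below take [phi] equal to
    1 off one or two coordinates. *)
Let bern_prod (phi : S -> bool -> R) :
  \sum_(b : {ffun S -> bool}) bern b * \prod_s phi s (b s) =
  \prod_s (p s * phi s true + (1 - p s) * phi s false).
Proof.
transitivity (\prod_s \sum_(c : bool) (if c then p s else 1 - p s) * phi s c).
  by rewrite bigA_distr_bigA; apply: eq_bigr => b _; rewrite -big_split.
by apply: eq_bigr => s _; rewrite big_bool.
Qed.

Lemma bern_sum1 : \sum_(b : {ffun S -> bool}) bern b = 1.
Proof.
transitivity (\sum_(b : {ffun S -> bool}) bern b * \prod_(s : S) 1).
  by apply: eq_bigr => b _; rewrite big1_eq mulr1.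
rewrite (bern_prod (fun _ _ => 1)) big1// => s _.
by rewrite !mulr1 addrC subrK.
Qed.

Let prod_at s (F : S -> R) : \prod_u (if u == s then F u else 1) = F s.
Proof. by rewrite -big_mkcond big_pred1_eq. Qed.

Lemma bern_mean s : \sum_(b : {ffun S -> bool}) bern b * ((b s)%:R - p s) = 0.
Proof.
transitivity (\sum_(b : {ffun S -> bool}) bern b *
    \prod_u (if u == s then (b u)%:R - p u else 1)).
  by apply: eq_bigr => b _; rewrite (prod_at s (fun u => (b u)%:R - p u)).
rewrite (bern_prod (fun u c => if u == s then c%:R - p u else 1)) (bigD1 s)//= eqxx.
by rewrite (_ : p s * _ + _ = 0) ?mul0r//; ring.
Qed.

Lemma bern_cov s t : \sum_(b : {ffun S -> bool}) bern b *
    (((b s)%:R - p s) * ((b t)%:R - p t)) = if s == t then p s * (1 - p s) else 0.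
Proof.
transitivity (\sum_(b : {ffun S -> bool}) bern b *
    \prod_u ((if u == s then (b u)%:R - p u else 1) * (if u == t then (b u)%:R - p u else 1))).
  apply: eq_bigr => b _; rewrite big_split/=.
  by rewrite (prod_at s (fun u => (b u)%:R - p u)) (prod_at t (fun u => (b u)%:R - p u)).
rewrite (bern_prod (fun u c => (if u == s then c%:R - p u else 1) *
                               (if u == t then c%:R - p u else 1))).
have [<-|st] := eqVneq s t.
  rewrite (bigD1 s)//= eqxx big1; first by ring.
  by move=> u us; rewrite (negbTE us); ring.
rewrite (bigD1 s)//= eqxx (negbTE st).
by rewrite (_ : p s * _ + _ = 0) ?mul0r//; ring.
Qed.

Hypothesis p01 : forall s, 0 <= p s <= 1.

Lemma bern_ge0 b : 0 <= bern b.
Proof.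
by apply: prodr_ge0 => s _; have := p01 s; case: (b s) => /andP[]; rewrite ?subr_ge0.
Qed.

End product_bernoulli.

(** * Continuity theorem for Lipschitz test functions *)

Section levy.
Context {R : realType} {K : nat}.
Local Notation vec := ('I_K -> R).

(** Span of the cosines with a phase, the real form of characters; by linearity its expectations are
    controlled as soon as those of the cosines are. *)
Inductive trig : (vec -> R) -> Prop :=
| trig_cos a (lam : vec) th : trig (fun x => a * cos (\sum_j lam j * x j + th))
| trigD f g : trig f -> trig g -> trig (fun x => f x + g x).

Lemma trig_cst a : trig (fun=> a).
Proof.
have -> : (fun=> a) = (fun x : vec => a * cos (\sum_j (fun=> 0 : R) j * x j + 0)).
  apply/funext => x; rewrite big1 ?addr0 ?cos0 ?mulr1// => j _.
  by rewrite mul0r.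
exact: trig_cos.
Qed.

Lemma trigM f g : trig f -> trig g -> trig (fun x => f x * g x).
Proof.
elim=> [a lam th|f1 f2 t1 ih1 t2 ih2] tg; last first.
  by under eq_fun do rewrite mulrDl; exact: trigD (ih1 tg) (ih2 tg).
elim: tg => [b mu ph|g1 g2 t1 ih1 t2 ih2]; last first.
  by under eq_fun do rewrite mulrDr; exact: trigD.
have -> : (fun x : vec => a * cos (\sum_j lam j * x j + th) * (b * cos (\sum_j mu j * x j + ph)))
  = (fun x => a * b / 2 * cos (\sum_j (lam j + mu j) * x j + (th + ph)) +
              a * b / 2 * cos (\sum_j (lam j - mu j) * x j + (th - ph))).
  apply/funext => x.
  have -> : \sum_j (lam j + mu j) * x j + (th + ph) =
    (\sum_j lam j * x j + th) + (\sum_j mu j * x j + ph).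
    by under eq_bigr do rewrite mulrDl; rewrite big_split/=; ring.
  have -> : \sum_j (lam j - mu j) * x j + (th - ph) =
    (\sum_j lam j * x j + th) - (\sum_j mu j * x j + ph).
    by under eq_bigr do rewrite mulrBl; rewrite sumrB; ring.
  move: (\sum_j lam j * x j + th) (\sum_j mu j * x j + ph) => A B.
  by rewrite cosB cosD; field.
by apply: trigD; exact: trig_cos.
Qed.

Lemma trig_sum (I : Type) (s : seq I) (F : I -> vec -> R) :
  (forall i, trig (F i)) -> trig (fun x => \sum_(i <- s) F i x).
Proof.
move=> tF; elim: s => [|i s ih].
  by under eq_fun do rewrite big_nil; exact: trig_cst.
by under eq_fun do rewrite big_cons; exact: trigD.
Qed.

Lemma trig_prod (I : Type) (s : seq I) (F : I -> vec -> R) :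
  (forall i, trig (F i)) -> trig (fun x => \prod_(i <- s) F i x).
Proof.
move=> tF; elim: s => [|i s ih].
  by under eq_fun do rewrite big_nil; exact: trig_cst.
by under eq_fun do rewrite big_cons; exact: trigM.
Qed.

Lemma trig_sin (d : R) j : trig (fun x => sin (d * x j)).
Proof.
have := trig_cos 1 (fun i => if i == j then d else 0) (- (pi / 2)).
rewrite (_ : (fun x => _) = (fun x => sin (d * x j)))//.
apply/funext => x; rewrite mul1r cosBpihalf; congr sin.
by rewrite (bigD1 j)//= eqxx big1 ?addr0// => i ij; rewrite (negbTE ij) mul0r.
Qed.

Section lipschitz.
Variables (g : vec -> R) (L M : R).
Hypothesis gM : forall x, `|g x| <= M.
Hypothesis gL : forall x y, `|g x - g y| <= L * \sum_j `|x j - y j|.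
Hypothesis L_ge0 : 0 <= L.

(** A bounded substitute for the identity, close to it for small [d]. Its coordinates are
    trigonometric and range in a compact interval, where polynomial approximation is available. *)
Definition sinc (d : R) (x : vec) : vec := fun j => sin (d * x j) / d.

(* Bernstein's operator, applied to the coordinates [(1 + sin (d * x j)) / 2]. *)
Lemma sinc_approx (d e : R) : 0 < d -> 0 < e ->
  exists2 f, trig f & forall x, `|f x - g (sinc d x)| <= e.
Proof.
move=> d0 e0.
pose p (x : vec) j := (1 + sin (d * x j)) / 2.
have p01 x j : 0 <= p x j <= 1.
  rewrite /p; have := sin_geN1 (d * x j); have := sin_le1 (d * x j) => h1 h2.
  by apply/andP; split; lra.
pose D := 2 * L / d * K%:R + 1.
have D0 : 0 < D by rewrite ltr_wpDl// mulr_ge0// divr_ge0 ?(ltW d0)// mulr_ge0.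
pose eta := e / (2 * D).
have eta0 : 0 < eta by rewrite divr_gt0// mulr_gt0.
(* Chosen so that the variance of a mean of [n] Bernoulli variables is at most eta^2. *)
pose n := (Num.truncn (eta ^- 2)).+1.
have n0 : 0 < n%:R :> R by [].
have neta : n%:R^-1 <= eta ^+ 2.
  rewrite -[leRHS]invrK lef_pV2 ?posrE ?invr_gt0 ?exprn_gt0//.
  exact/ltW/truncnS_gt.
pose S := ('I_K * 'I_n)%type.
pose pS x (s : S) := p x s.1.
(* The map q |-> (2 q - 1) / d inverts the passage from [sinc d x] to the parameters [p x], applied
   here to empirical frequencies. *)
pose node (b : {ffun S -> bool}) : vec :=
  fun j => (2 * (n%:R^-1 * \sum_(k < n) (b (j, k))%:R) - 1) / d.
pose f x := \sum_(b : {ffun S -> bool}) bern (pS x) b * g (node b).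
exists f.
  apply: trig_sum => b; apply: trigM; last exact: trig_cst.
  apply: trig_prod => s.
  have tp : trig (fun x => pS x s).
    apply: trigM; last exact: trig_cst.
    by apply: trigD; [exact: trig_cst|exact: trig_sin].
  case: (b s) => //.
  have -> : (fun x => 1 - pS x s) = (fun x => 1 + (-1) * pS x s).
    by apply/funext => x; rewrite mulN1r.
  by apply: trigD; [exact: trig_cst|apply: trigM => //; exact: trig_cst].
move=> x.
have bx0 b : 0 <= bern (pS x) b by apply: bern_ge0 => s; exact: p01.
have -> : g (sinc d x) = \sum_(b : {ffun S -> bool}) bern (pS x) b * g (sinc d x).
  by rewrite -mulr_suml bern_sum1 mul1r.
rewrite /f -sumrB; apply: le_trans (ler_norm_sum _ _ _) _.
pose u (b : {ffun S -> bool}) j := n%:R^-1 * \sum_(k < n) ((b (j, k))%:R - p x j).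
have nodeE b j : node b j - sinc d x j = 2 / d * u b j.
  rewrite /node /sinc /u sumrB sumr_const card_ord -[_ *+ n]mulr_natl /p; field.
  by rewrite !gt_eqF.
(* Trades the first absolute moment for the variance, in place of the Cauchy-Schwarz inequality. *)
have sq b j : `|u b j| <= eta + u b j ^+ 2 / eta.
  have := sqr_ge0 (`|u b j| - eta); rewrite sqrrB real_normK ?num_real// => h.
  rewrite -(ler_pM2r eta0) mulrDl divfK ?gt_eqF//.
  have := sqr_ge0 eta; have := sqr_ge0 (u b j).
  have := mulr_ge0 (normr_ge0 (u b j)) (ltW eta0); lra.
have mom j : \sum_(b : {ffun S -> bool}) bern (pS x) b * u b j ^+ 2 <= n%:R^-1.
  have -> : \sum_(b : {ffun S -> bool}) bern (pS x) b * u b j ^+ 2 =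
     n%:R^-1 ^+ 2 * \sum_(k < n) \sum_(l < n) \sum_(b : {ffun S -> bool}) bern (pS x) b *
       (((b (j, k))%:R - pS x (j, k)) * ((b (j, l))%:R - pS x (j, l))).
    rewrite mulr_sumr.
    under [RHS]eq_bigr do rewrite mulr_sumr.
    under [RHS]eq_bigr do under eq_bigr do rewrite mulr_sumr.
    under [RHS]eq_bigr do rewrite exchange_big.
    rewrite exchange_big; apply: eq_bigr => b _ /=.
    rewrite /u exprMn mulrCA; under [RHS]eq_bigr do rewrite -mulr_sumr -mulr_sumr.
    rewrite -mulr_sumr; congr (_ * _); rewrite -mulr_sumr; congr (_ * _).
    rewrite expr2 mulr_suml; apply: eq_bigr => k _.
    by rewrite mulr_sumr.
  have -> : \sum_(k < n) \sum_(l < n) \sum_(b : {ffun S -> bool}) bern (pS x) b *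
       (((b (j, k))%:R - pS x (j, k)) * ((b (j, l))%:R - pS x (j, l))) =
     n%:R * (p x j * (1 - p x j)).
    transitivity (\sum_(k < n) p x j * (1 - p x j)).
      apply: eq_bigr => k _.
      under eq_bigr do rewrite bern_cov xpair_eqE eqxx/= eq_sym.
      by rewrite -big_mkcond big_pred1_eq.
    by rewrite sumr_const card_ord mulr_natl.
  have -> : n%:R^-1 ^+ 2 * (n%:R * (p x j * (1 - p x j))) = n%:R^-1 * (p x j * (1 - p x j)).
    by field; rewrite gt_eqF.
  rewrite -[leRHS]mulr1 ler_wpM2l ?invr_ge0//.
  have /andP[h1 h2] := p01 x j.
  rewrite -[leRHS]mulr1; apply: ler_pM => //; lra.
apply: (@le_trans _ _ (\sum_(b : {ffun S -> bool}) bern (pS x) b *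
   (L * \sum_j (2 / d * (eta + u b j ^+ 2 / eta))))).
  apply: ler_sum => b _; rewrite -mulrBr normrM (ger0_norm (bx0 b)) ler_wpM2l//.
  apply: le_trans (gL _ _) _; rewrite ler_wpM2l//; apply: ler_sum => j _.
  rewrite nodeE normrM ger0_norm ?divr_ge0 ?(ltW d0)// ler_wpM2l ?divr_ge0 ?(ltW d0)//.
have -> : \sum_(b : {ffun S -> bool}) bern (pS x) b *
   (L * \sum_j (2 / d * (eta + u b j ^+ 2 / eta))) =
   2 * L / d * \sum_(j < K) (eta + (\sum_(b : {ffun S -> bool}) bern (pS x) b * u b j ^+ 2) / eta).
  under eq_bigr do rewrite -mulr_sumr [L * _]mulrA mulrCA mulr_sumr.
  rewrite -mulr_sumr exchange_big/= (_ : L * (2 / d) = 2 * L / d); last by ring.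
  congr (_ * _); apply: eq_bigr => j _.
  under eq_bigr do rewrite mulrDr.
  rewrite big_split/=; congr (_ + _); first by rewrite -mulr_suml bern_sum1 mul1r.
  by rewrite mulr_suml; apply: eq_bigr => b _; rewrite mulrA.
have le1 : \sum_(j < K) (eta + (\sum_(b : {ffun S -> bool}) bern (pS x) b * u b j ^+ 2) / eta)
   <= K%:R * (2 * eta).
  rewrite mulr_natl -[X in _ *+ X]card_ord -sumr_const; apply: ler_sum => j _.
  rewrite mulr_natl mulr2n lerD2l ler_pdivrMr// -expr2.
  exact: le_trans (mom j) neta.
apply: (@le_trans _ _ (2 * L / d * (K%:R * (2 * eta)))).
  by rewrite ler_wpM2l// divr_ge0 ?(ltW d0)// mulr_ge0.
have -> : e = 2 * eta * D by rewrite /eta; field; rewrite gt_eqF.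
rewrite (_ : 2 * L / d * (K%:R * (2 * eta)) = 2 * eta * (2 * L / d * K%:R)); last by ring.
have DL : 2 * L / d * K%:R <= D by rewrite lerDl.
by apply: ler_wpM2l => //; rewrite mulr_ge0// ltW.
Qed.

(** Rescaled form of |y - sin y| <= y^2: Taylor when |y| <= 6, the trivial bound 1 + |y| beyond. A
    quadratic error is what second moments control. *)
Lemma sinc_dist (d : R) x : 0 < d -> `|g x - g (sinc d x)| <= L * d * \sum_j x j ^+ 2.
Proof.
move=> d0; apply: le_trans (gL _ _) _; rewrite -mulrA ler_wpM2l// mulr_sumr.
apply: ler_sum => j _; rewrite /sinc.
set y := d * x j.
have -> : x j = y / d by rewrite /y mulrC mulKf// gt_eqF.
rewrite -mulrBl normrM normfV (ger0_norm (ltW d0)).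
have -> : d * (y / d) ^+ 2 = y ^+ 2 / d by field; rewrite gt_eqF.
rewrite ler_wpM2r ?invr_ge0 ?(ltW d0)// distrC.
have [y6|y6] := leP `|y| 6.
  apply: le_trans (sin_taylor _) _; rewrite ler_pdivrMr// exprS mulrC.
  by rewrite real_normK ?num_real// ler_wpM2l// sqr_ge0.
rewrite (le_trans (ler_normB _ _))//; have := sin_max y.
rewrite -(real_normK (num_real y)) expr2; nra.
Qed.

Lemma trig_bmf d (T : measurableType d) (X : T -> vec) f :
  (forall j, measurable_fun setT (X^~ j)) -> trig f -> bmf (fun w => f (X w)).
Proof.
move=> mX; elim=> [a lam th|f1 f2 _ b1 _ b2]; last exact: bmfD.
apply: bmfM; first exact: bmf_cst.
apply: bmf_cos; apply: measurable_funD => //; apply: measurable_sum => j.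
exact: measurable_funM.
Qed.

Let sinc_bmf d (T : measurableType d) (X : T -> vec) (e : R) : 0 < e ->
  (forall j, measurable_fun setT (X^~ j)) -> bmf (fun w => g (sinc e (X w))).
Proof.
move=> e0 mX; apply: (@bmf_le _ _ _ M); last by move=> w.
have ap n : {f | trig f & forall x, `|f x - g (sinc e x)| <= harmonic n}.
  by apply: cid2; apply: sinc_approx => //; exact: harmonic_gt0.
apply: (measurable_fun_cvg (h := fun n w => s2val (ap n) (X w))).
  by move=> n; apply: bmf_meas; apply: trig_bmf => //; exact: (s2valP (ap n)).
move=> w _; apply/subr_cvg0; apply: (@cvg0_le _ _ harmonic); last exact: cvg_harmonic.
by apply: nearW => n; exact: (s2valP' (ap n)).
Qed.

Let sinc_cvg (x : vec) : g (sinc (harmonic n) x) @[n --> \oo] --> g x.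
Proof.
apply/subr_cvg0.
apply: (@cvg0_le _ _ (fun n => (L * \sum_j x j ^+ 2) * harmonic n)).
  apply: nearW => n; rewrite distrC (le_trans (sinc_dist _ (harmonic_gt0 _)))//.
  by rewrite mulrAC.
move: (L * _) => A; rewrite -[X in _ --> X](mulr0 A).
by apply: cvgMr; exact: cvg_harmonic.
Qed.

Lemma lipschitz_bmf d (T : measurableType d) (X : T -> vec) :
  (forall j, measurable_fun setT (X^~ j)) -> bmf (fun w => g (X w)).
Proof.
move=> mX; apply: (@bmf_le _ _ _ M); last by move=> w.
apply: (measurable_fun_cvg (h := fun n w => g (sinc (harmonic n) (X w)))).
  by move=> n; apply: bmf_meas; apply: sinc_bmf => //; exact: harmonic_gt0.
by move=> w _; exact: sinc_cvg.
Qed.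

(** Bounded second moments play the role of tightness: they make [g] close in mean to its
    composition with [sinc], which trigonometric polynomials approximate uniformly. On the side of
    [Y], where no moment is assumed, dominated convergence does this. *)
Lemma levy d (T : measurableType d) (P : probability T R) (X : nat -> T -> vec)
  d' (T' : measurableType d') (P' : probability T' R) (Y : T' -> vec) (C : R) :
  (forall n j, bmf ((X n)^~ j)) -> (forall j, measurable_fun setT (Y^~ j)) ->
  (\forall n \near \oo, forall j, Ex P (fun w => X n w j ^+ 2) <= C) ->
  (forall lam th, Ex P (fun w => cos (\sum_j lam j * X n w j + th)) @[n --> \oo] -->
     Ex P' (fun w => cos (\sum_j lam j * Y w j + th))) ->
  Ex P (fun w => g (X n w)) @[n --> \oo] --> Ex P' (fun w => g (Y w)).
Proof.
move=> bX mY XC Hcos.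
have mX n j : measurable_fun setT ((X n)^~ j) by case: (bX n j).
have Htrig f : trig f -> Ex P (fun w => f (X n w)) @[n --> \oo] --> Ex P' (fun w => f (Y w)).
  elim=> [a lam th|f1 f2 t1 h1 t2 h2].
    have b1 n : bmf (fun w => cos (\sum_j lam j * X n w j + th)).
      apply: bmf_cos; apply: measurable_funD => //; apply: measurable_sum => j.
      by apply: measurable_funM.
    have b2 : bmf (fun w => cos (\sum_j lam j * Y w j + th)).
      apply: bmf_cos; apply: measurable_funD => //; apply: measurable_sum => j.
      exact: measurable_funM.
    rewrite ExZ//; under eq_fun do rewrite ExZ//.
    by apply: cvgMr; exact: Hcos.
  have bf1 n : bmf (fun w => f1 (X n w)) by exact: (trig_bmf (mX n) t1).
  have bf2 n : bmf (fun w => f2 (X n w)) by exact: (trig_bmf (mX n) t2).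
  rewrite (ExD _ (trig_bmf mY t1) (trig_bmf mY t2)).
  under eq_fun do rewrite (ExD _ (bf1 _) (bf2 _)).
  exact: cvgD.
apply/cvgrPdist_le => /= e e0.
pose D := L * (K%:R * `|C|) + 1.
have D0 : 0 < D by rewrite ltr_wpDl// !mulr_ge0.
have cY : Ex P' (fun w => g (sinc (harmonic n) (Y w))) @[n --> \oo] --> Ex P' (fun w => g (Y w)).
  apply: (@Ex_dct _ _ _ _ _ _ M).
  - by move=> n; apply: bmf_meas; apply: sinc_bmf => //; exact: harmonic_gt0.
  - exact: lipschitz_bmf.
  - by move=> n w.
  - by apply: aeW => w; exact: sinc_cvg.
have e5 : 0 < e / 5 by rewrite divr_gt0.
have [m [m1 m2]] : exists m : nat, `|Ex P' (fun w => g (Y w)) -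
    Ex P' (fun w => g (sinc (harmonic m) (Y w)))| <= e / 5 /\ D * harmonic m <= e / 5.
  have /cvgrPdist_le/(_ _ e5) h1 := cY.
  have h2 : \forall m \near \oo, D * harmonic m <= e / 5.
    have : D * harmonic m @[m --> \oo] --> D * 0 by apply: cvgMr; exact: cvg_harmonic.
    rewrite mulr0 => /cvgr0_norm_le /(_ _ e5); apply: filterS => m.
    by apply: le_trans; exact: ler_norm.
  have [m _ /(_ m (leqnn m)) hm] : \forall m \near \oo, _ /\ _ := filterI h1 h2.
  by exists m.
set dl := harmonic m in m1 m2.
have dl0 : 0 < dl by exact: harmonic_gt0.
have [f tf fg] := sinc_approx dl0 e5.
have /cvgrPdist_le/(_ _ e5) hf := Htrig f tf.
near=> n.
have XCn : forall j, Ex P (fun w => X n w j ^+ 2) <= C by near: n.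
have hfn : `|Ex P' (fun w => f (Y w)) - Ex P (fun w => f (X n w))| <= e / 5 by near: n.
have bgX : bmf (fun w => g (X n w)) by exact: lipschitz_bmf.
have bsX : bmf (fun w => g (sinc dl (X n w))) by exact: sinc_bmf.
have bfX : bmf (fun w => f (X n w)) by exact: trig_bmf.
have bsY : bmf (fun w => g (sinc dl (Y w))) by exact: sinc_bmf.
have bfY : bmf (fun w => f (Y w)) by exact: trig_bmf.
have b2 : bmf (fun w => \sum_j X n w j ^+ 2) by apply: bmf_sum => j; exact: bmfX.
have k1 : `|Ex P (fun w => g (X n w)) - Ex P (fun w => g (sinc dl (X n w)))| <= e / 5.
  rewrite -ExB// (le_trans (Ex_norm _ (bmfB bgX bsX)))//.
  apply: (@le_trans _ _ (Ex P (fun w => (L * dl) * \sum_j X n w j ^+ 2))).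
    apply: Ex_le; [by apply: bmf_norm; exact: bmfB| |by move=> w; exact: sinc_dist].
    by apply: bmfM => //; exact: bmf_cst.
  rewrite ExZ// Ex_sum; last by move=> j; exact: bmfX.
  apply: le_trans m2; rewrite mulrAC ler_wpM2r ?(ltW dl0)//.
  rewrite /D (le_trans _ (_ : L * (K%:R * `|C|) <= _))// ?lerDl// ler_wpM2l//.
  rewrite mulr_natl -[X in _ *+ X]card_ord -sumr_const; apply: ler_sum => j _.
  by rewrite (le_trans (XCn j))// ler_norm.
have k2 : `|Ex P (fun w => f (X n w)) - Ex P (fun w => g (sinc dl (X n w)))| <= e / 5.
  by apply: Ex_dist_le.
have k3 : `|Ex P' (fun w => f (Y w)) - Ex P' (fun w => g (sinc dl (Y w)))| <= e / 5.
  by apply: Ex_dist_le.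
move: m1 hfn k1 k2 k3; rewrite !ler_norml.
do 5 move=> /andP[? ?]; apply/andP; split; lra.
Unshelve. all: by end_near. Qed.

End lipschitz.
End levy.

(** * Asymptotics of the normalising sequences *)

Section sequences_asymptotics.
Context {R : realType}.

Lemma cvg_near_eq (u v : nat -> R) (l : R) :
  (\forall n \near \oo, u n = v n) -> v @ \oo --> l -> u @ \oo --> l.
Proof.
move=> uv; apply: cvg_trans; apply: near_eq_cvg.
by apply: filterS uv => n ->.
Qed.

Lemma near_oo_gt0 : \forall n \near \oo, (0 < n)%N.
Proof. by exists 1%N. Qed.

Lemma series_harmonic_pinfty (C : R) (N : nat) :
  \forall n \near \oo, C <= \sum_(N <= l < n) (harmonic l : R).
Proof.
have nd : {homo (series (@harmonic R)) : n m / (n <= m)%N >-> n <= m}.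
  by apply/nondecreasing_seqP => n; rewrite /series/= big_nat_recr//= lerDl harmonic_ge0.
have h := nondecreasing_dvgn_lt nd (@dvg_harmonic R).
have /cvgryPge/(_ (C + series harmonic N)) := h.
move=> H; near=> n.
have nN : (N <= n)%N by near: n; exists N.
have : C + series harmonic N <= series (@harmonic R) n by near: n.
have -> : series (@harmonic R) n = series harmonic N + \sum_(N <= l < n) harmonic l.
  by rewrite /series/= [LHS](@big_cat_nat _ _ _ N).
by rewrite addrC lerD2l.
Unshelve. all: by end_near. Qed.

Variable G : nat -> R.
Hypothesis G_gt0 : forall n, (0 < n)%N -> 0 < G n.
Hypothesis G_le : forall n, (0 < n)%N -> G n <= n%:R.

(* [y] relaxes to [k] at rate [lam / G], and [1 / G] is not summable. *)
Lemma relaxation (y u b : nat -> R) (lam k : R) : 0 < lam ->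
  (\forall n \near \oo, y n.+1 = (1 - u n) * y n + b n) ->
  (fun n => (G n)^-1) @ \oo --> (0 : R) ->
  (fun n => G n * u n) @ \oo --> lam ->
  (fun n => G n * b n) @ \oo --> lam * k ->
  y @ \oo --> k.
Proof.
move=> lam0 yE G0 Gu Gb.
have u0 : u @ \oo --> (0 : R).
  apply: (@cvg_near_eq _ (fun n => (G n * u n) * (G n)^-1)).
    apply: filterS near_oo_gt0 => n n0.
    by rewrite mulrC mulKf// gt_eqF// G_gt0.
  by rewrite -(mulr0 lam); exact: cvgM.
have Gd : (fun n => G n * (b n - k * u n)) @ \oo --> (0 : R).
  rewrite (_ : (fun n => _) = (fun n => G n * b n - k * (G n * u n))); last first.
    by apply/funext => n; ring.
  rewrite -(subrr (lam * k)) {2}[lam * k]mulrC.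
  by apply: cvgB => //; apply: cvgMr.
apply/subr_cvg0; apply/cvgr0Pnorm_le => e e0.
have e2 : 0 < e / 2 by rewrite divr_gt0.
have el : 0 < e / 2 * (lam / 2) by rewrite mulr_gt0// divr_gt0.
have n1 : \forall n \near \oo, u n <= 1.
  have /cvgr0_norm_le/(_ _ ltr01) := u0.
  by apply: filterS => n; apply: le_trans; exact: ler_norm.
have n2 : \forall n \near \oo, lam / 2 <= G n * u n.
  have /cvgrPdist_le/(_ (lam / 2)) := Gu.
  rewrite divr_gt0// => /(_ isT); apply: filterS => n; rewrite ler_norml; lra.
have n3 := @cvgr0_norm_le _ _ _ _ _ _ Gd _ el.
have [N _ HN] : \forall n \near \oo, [/\ (0 < n)%N, y n.+1 = (1 - u n) * y n + b n,
   u n <= 1, lam / 2 <= G n * u n & `|G n * (b n - k * u n)| <= e / 2 * (lam / 2)].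
  near=> n; split; near: n; [exact: near_oo_gt0|exact: yE|exact: n1|exact: n2|exact: n3].
pose z n := `|y n - k|.
pose C := z N.
pose s n := \sum_(N <= l < n) u l.
(* The bound [G l <= l] makes [u] dominate the harmonic series, so that [s] diverges. *)
have uh l : (N <= l)%N -> lam / 2 * harmonic l <= u l.
  move=> /HN[l0 _ _ h _].
  rewrite /harmonic/= ler_pdivrMr//.
  have u_ge0 : 0 <= u l.
    by rewrite -(pmulr_rge0 _ (G_gt0 l0)) (le_trans _ h)// divr_ge0// ltW.
  apply: le_trans h _; rewrite mulrC.
  by rewrite ler_wpM2l// (le_trans (G_le l0))// ler_nat.
have uge0 l : (N <= l)%N -> 0 <= u l.
  move=> /uh; apply: le_trans; apply: mulr_ge0; last exact: harmonic_ge0.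
  by rewrite divr_ge0// ltW.
have s0 n : 0 <= s n.
  by rewrite /s big_nat sumr_ge0// => l /andP[Nl _]; exact: uge0.
have C0 : 0 <= C by exact: normr_ge0.
(* Since (1 - u) / (1 + s) <= 1 / (1 + s + u), the excess over e / 2 decays at least like 1 / (1 +
   s), which is enough. *)
have main j : z (N + j)%N - e / 2 <= C / (1 + s (N + j)%N).
  elim: j => [|j ih].
    rewrite addn0 /s big_geq// addr0 divr1 /C; lra.
  rewrite addnS; set n := (N + j)%N in ih *.
  have Nn : (N <= n)%N by rewrite leq_addr.
  have [n0 yn un gun gbn] := HN n Nn.
  have sE : s n.+1 = s n + u n by rewrite /s big_nat_recr.
  have un0 := uge0 n Nn.
  have bku : `|b n - k * u n| <= e / 2 * u n.
    rewrite -(ler_pM2l (G_gt0 n0)) -{1}(ger0_norm (ltW (G_gt0 n0))) -normrM.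
    by apply: le_trans gbn _; rewrite [leRHS]mulrCA ler_wpM2l// ltW.
  have zS : z n.+1 - e / 2 <= (1 - u n) * (z n - e / 2).
    have : z n.+1 <= (1 - u n) * z n + `|b n - k * u n|.
      rewrite /z yn (_ : _ - k = (1 - u n) * (y n - k) + (b n - k * u n)); last by ring.
      apply: le_trans (ler_normD _ _) _; rewrite normrM lerD2r.
      by rewrite (@ger0_norm _ (1 - u n)) ?subr_ge0.
    by lra.
  apply: le_trans zS _.
  apply: (@le_trans _ _ ((1 - u n) * (C / (1 + s n)))).
    by rewrite ler_wpM2l// subr_ge0.
  have sn := s0 n.
  rewrite mulrCA ler_wpM2l// sE.
  rewrite ler_pdivrMr; last by rewrite ltr_pwDl.
  rewrite mulrC ler_pdivlMr; last by rewrite ltr_pwDl// addr_ge0.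
  have := mulr_ge0 un0 sn; have := sqr_ge0 (u n); rewrite expr2; lra.
have hs := series_harmonic_pinfty (C / (e / 2) / (lam / 2)) N.
near=> n.
have Nn : (N <= n)%N by near: n; exists N.
have hn : C / (e / 2) / (lam / 2) <= \sum_(N <= l < n) harmonic l by near: n.
have := main (n - N)%N; rewrite subnKC// -/(z n) => h.
suff : C / (1 + s n) <= e / 2 by rewrite -/(z n); lra.
rewrite ler_pdivrMr; last by rewrite ltr_pwDl.
rewrite mulrC -ler_pdivrMr//.
have : C / (e / 2) <= s n.
  rewrite -(@ler_pM2r _ ((lam / 2)^-1)) ?invr_gt0 ?divr_gt0//.
  apply: le_trans hn _; rewrite ler_pdivlMr ?divr_gt0// mulrC mulr_sumr.
  by rewrite /s big_nat [leRHS]big_nat ler_sum// => l /andP[Nl _]; exact: uh.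
lra.
Unshelve. all: by end_near. Qed.

End sequences_asymptotics.

(** * Decay, weights and clock of the model *)

Section rates.
Context {R : realType}.
Variables (alpha gamma c : R) (r : nat -> R).
Hypothesis alpha01 : 0 < alpha <= 1.
Hypothesis gamma01 : 0 < gamma <= 1.
Hypothesis c_gt0 : 0 < c.
Hypothesis r01 : forall n, 0 <= r n < 1.

(* [speed n] steps of the model make up one unit of rescaled time. *)
Definition speed (n : nat) : R := n%:R `^ gamma.
Local Notation G := speed.
Hypothesis Gr : (fun n => G n * r n) @ \oo --> c.

(* The limit of [speed n * (speed n.+1 / speed n - 1)]. *)
Definition crit : R := if gamma == 1 then 1 else 0.
Hypothesis rate_gt0 : 0 < 2 * c * alpha - crit.

Let alpha_gt0 : 0 < alpha. Proof. by case/andP: alpha01. Qed.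

Lemma G_gt0 n : (0 < n)%N -> 0 < G n.
Proof. by move=> n0; rewrite powR_gt0// ltr0n. Qed.

Lemma G_ge0 n : 0 <= G n. Proof. exact: powR_ge0. Qed.

Lemma G_le n : (0 < n)%N -> G n <= n%:R.
Proof. by move=> n0; rewrite ler1_powR ?ler1n//; case/andP: gamma01. Qed.

Lemma G_mono n m : (n <= m)%N -> G n <= G m.
Proof.
move=> nm; apply: ge0_ler_powR; rewrite ?nnegrE// ?ler_nat//.
by case/andP: gamma01 => /ltW.
Qed.

Let powV_cvg0 (a : R) : 0 < a -> (fun n => n.+1%:R^-1 `^ a) @ \oo --> (0 : R).
Proof.
move=> a0; apply: (@cvg_comp _ _ _ harmonic (fun x : R => x `^ a)) (powR_cvg0 a0).
move=> A [e /= e0 eA].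
have /cvgr0_norm_lt/(_ _ e0) := @cvg_harmonic R.
apply: filterS => n hn; apply: eA; last exact: harmonic_gt0.
by rewrite /ball_/= sub0r normrN.
Qed.

Lemma GV_cvg0 : (fun n => (G n)^-1) @ \oo --> (0 : R).
Proof.
rewrite -cvg_shiftS /=.
have /andP[g0 _] := gamma01.
rewrite (_ : (fun n => _) = (fun n => n.+1%:R^-1 `^ gamma)); first exact: powV_cvg0.
by apply/funext => n; rewrite -[in RHS]powR_inv1// -powRrM mulN1r powRN.
Qed.

Lemma Gn_cvg0 : gamma != 1 -> (fun n => G n / n%:R) @ \oo --> (0 : R).
Proof.
move=> g1; rewrite -cvg_shiftS /=.
rewrite (_ : (fun n => _) = (fun n => n.+1%:R^-1 `^ (1 - gamma))).
  by apply: powV_cvg0; rewrite subr_gt0 lt_neqAle g1; case/andP: gamma01.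
apply/funext => n /=; rewrite -[in RHS]powR_inv1// -powRrM mulN1r opprB powRB; last first.
  by apply/implyP => _; rewrite pnatr_eq0.
by rewrite powRr1.
Qed.

Lemma r_cvg0 : r @ \oo --> (0 : R).
Proof.
apply: (@cvg_near_eq _ _ (fun n => (G n * r n) * (G n)^-1)).
  apply: filterS near_oo_gt0 => n n0.
  by rewrite mulrC mulKf// gt_eqF// G_gt0.
by rewrite -(mulr0 c); apply: cvgM => //; exact: GV_cvg0.
Qed.

Let gg n := G n.+1 / G n.

Let ggE n : (0 < n)%N -> gg n = (1 + n%:R^-1) `^ gamma.
Proof.
move=> n0; have n0' : (n%:R : R) != 0 by rewrite pnatr_eq0 -lt0n.
have -> : 1 + n%:R^-1 = n.+1%:R * n%:R^-1 :> R by rewrite -natr1 mulrDl divff// mul1r.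
by rewrite powRM// /gg /G -[in RHS]powR_inv1// -powRrM mulN1r powRN.
Qed.

(** For gamma = 1 the quantity is exactly 1 when n > 0; otherwise [gg n - 1] is at most 1 / n and
    [G n / n] vanishes. *)
Let gg_crit : (fun n => G n * (gg n - 1)) @ \oo --> crit.
Proof.
rewrite /crit; have [g1|g1] := eqVneq gamma 1.
  apply: (@cvg_near_eq _ _ (fun=> 1)); last exact: cvg_cst.
  apply: filterS near_oo_gt0 => n n0.
  rewrite ggE// /G g1 powRr1// powRr1; last by rewrite addr_ge0.
  by rewrite addrC addKr divff// pnatr_eq0 -lt0n.
apply: cvg0_le (Gn_cvg0 g1).
apply: filterS near_oo_gt0 => n n0.
have n1 : 1 <= 1 + n%:R^-1 :> R by rewrite lerDl invr_ge0.
have h1 : 1 <= gg n.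
  by rewrite /gg ler_pdivlMr ?G_gt0// mul1r G_mono.
have h2 : gg n <= 1 + n%:R^-1 by rewrite ggE// ler1_powR//; case/andP: gamma01.
rewrite ger0_norm ?mulr_ge0 ?G_ge0 ?subr_ge0// ler_wpM2l ?G_ge0//; lra.
Qed.

Let gg_cvg1 : gg @ \oo --> (1 : R).
Proof.
apply/subr_cvg0; apply: (@cvg_near_eq _ _ (fun n => (G n * (gg n - 1)) * (G n)^-1)).
  apply: filterS near_oo_gt0 => n n0.
  by rewrite mulrC mulKf// gt_eqF// G_gt0.
by rewrite -(mulr0 crit); apply: cvgM => //; exact: GV_cvg0.
Qed.

(** Relative decrease of [beta2] in one step. To first order the decay contributes 2 alpha r_n and
    the growth of the speed takes off crit / G n, so positivity of the rate is what drives [beta2]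
    to 0. *)
Let u n := 1 - gg n * (1 - alpha * r n) ^+ 2.

Let Gu : (fun n => G n * u n) @ \oo --> 2 * c * alpha - crit.
Proof.
have -> : (fun n => G n * u n) = (fun n => gg n * (2 * alpha * (G n * r n) -
   alpha ^+ 2 * ((G n * r n) * r n)) - G n * (gg n - 1)).
  by apply/funext => n; rewrite /u; ring.
have -> : 2 * c * alpha = 1 * (2 * alpha * c - alpha ^+ 2 * (c * 0)) by ring.
apply: cvgB => //; apply: cvgM => //; apply: cvgB.
  by apply: cvgMr.
by apply: cvgMr; apply: cvgM => //; exact: r_cvg0.
Qed.

Definition decay n := \prod_(l < n) (1 - alpha * r l).
Local Notation Pi := decay.

Let fac_gt0 n : 0 < 1 - alpha * r n.
Proof.
have /andP[r0 r1] := r01 n; have /andP[a0 a1] := alpha01.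
rewrite subr_gt0 (le_lt_trans _ r1)// -[leRHS]mul1r ler_wpM2r//.
Qed.

Let fac_le1 n : 1 - alpha * r n <= 1.
Proof. by have /andP[r0 _] := r01 n; rewrite gerBl mulr_ge0// ltW. Qed.

Lemma PiS n : Pi n.+1 = Pi n * (1 - alpha * r n).
Proof. by rewrite /Pi big_ord_recr. Qed.

Lemma Pi_gt0 n : 0 < Pi n. Proof. by apply: prodr_gt0 => l _. Qed.

Lemma Pi_neq0 n : Pi n != 0. Proof. by rewrite gt_eqF// Pi_gt0. Qed.

Lemma Pi_mono n m : (n <= m)%N -> Pi m <= Pi n.
Proof.
move=> nm; rewrite -(subnKC nm); elim: (m - n)%N => [|k ih]; first by rewrite addn0.
rewrite addnS PiS (le_trans _ ih)// -[leRHS]mulr1.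
by apply: ler_wpM2l => //; rewrite ltW// Pi_gt0.
Qed.

(* Solving the recursion of a deviation [D] from the mean gives
   [D n = decay n * (D 0 + \sum_(l < n) weight l * xi l)] with noise [xi]. *)
Definition weight l := r l / Pi l.+1.
Local Notation wt := weight.
Definition weight_sq n := \sum_(l < n) wt l ^+ 2.
Local Notation A := weight_sq.
(** Square of sqrt (G n) * Pi n, the factor by which the weighted noise sum is rescaled. *)
Definition beta2 n := G n * Pi n ^+ 2.
Definition kappa := c ^+ 2 / (2 * c * alpha - crit).

Lemma A_ge0 n : 0 <= A n. Proof. by apply: sumr_ge0 => l _; exact: sqr_ge0. Qed.

Lemma beta2_ge0 n : 0 <= beta2 n.
Proof. by rewrite mulr_ge0 ?G_ge0// sqr_ge0. Qed.

Let beta2S n : (0 < n)%N -> beta2 n.+1 = (1 - u n) * beta2 n.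
Proof.
move=> n0; rewrite /beta2 PiS /u /gg.
have := G_gt0 n0 => /gt_eqF/negbT g0; by field.
Qed.

(** The product relaxes at rate [u] under the forcing G_{n+1} r_n^2, which is equivalent to c^2 / G
    n; the equilibrium is c^2 divided by the rate. *)
Lemma beta2A_cvg : (fun n => beta2 n * A n) @ \oo --> kappa.
Proof.
apply: (relaxation (lam := 2 * c * alpha - crit) G_gt0 G_le
  (u := u) (b := fun n => G n.+1 * r n ^+ 2)) => //.
- apply: filterS near_oo_gt0 => n n0.
  have -> : A n.+1 = A n + wt n ^+ 2 by rewrite /A big_ord_recr.
  rewrite mulrDr {1}beta2S//; congr (_ + _); first by ring.
  rewrite /beta2 /wt; have := Pi_neq0 n.+1 => h; by field.
- exact: GV_cvg0.
- rewrite /kappa mulrC divfK ?gt_eqF//.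
  apply: (@cvg_near_eq _ _ (fun n => gg n * ((G n * r n) * (G n * r n)))).
    apply: filterS near_oo_gt0 => n n0; rewrite /gg.
    have := G_gt0 n0 => /gt_eqF/negbT g0; by field.
  by rewrite -[c ^+ 2]mul1r expr2; apply: cvgM => //; exact: cvgM.
Qed.

Lemma beta2_cvg0 : beta2 @ \oo --> (0 : R).
Proof.
apply: (relaxation (lam := 2 * c * alpha - crit) G_gt0 G_le
  (u := u) (b := fun n => 0)) => //.
- by apply: filterS near_oo_gt0 => n n0; rewrite beta2S// addr0.
- exact: GV_cvg0.
- by rewrite mulr0; under eq_fun do rewrite mulr0; exact: cvg_cst.
Qed.

Lemma beta2_noninc : exists N, forall n m, (N <= n <= m)%N -> beta2 m <= beta2 n.
Proof.
have [N _ HN] : \forall n \near \oo, 0 <= u n /\ (0 < n)%N.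
  near=> n; split; near: n; last exact: near_oo_gt0.
  have /cvgrPdist_le/(_ _ rate_gt0) := Gu.
  move=> h; near=> n.
  have n0 : (0 < n)%N by near: n; exact: near_oo_gt0.
  have : `|2 * c * alpha - crit - G n * u n| <= 2 * c * alpha - crit by near: n.
  rewrite ler_norml => h'; rewrite -(pmulr_rge0 _ (G_gt0 n0)); lra.
exists N => n m /andP[Nn nm]; rewrite -(subnKC nm).
elim: (m - n)%N => [|k ih]; first by rewrite addn0.
have [u0 n0] := HN (n + k)%N (leq_trans Nn (leq_addr _ _)).
rewrite addnS beta2S// (le_trans _ ih)// -[leRHS]mul1r ler_wpM2r ?beta2_ge0//.
by rewrite gerBl.
Unshelve. all: by end_near. Qed.

Lemma beta2wt_cvg0 : (fun l => beta2 l * wt l ^+ 2) @ \oo --> (0 : R).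
Proof.
have -> : (fun l => beta2 l * wt l ^+ 2) =
   (fun l => ((G l * r l) * r l) * ((1 - alpha * r l) ^- 1) ^+ 2).
  apply/funext => l; rewrite /beta2 /wt PiS; field.
  by rewrite Pi_neq0 gt_eqF.
rewrite -[X in _ --> X](_ : c * 0 * (1 - alpha * 0)^-1 ^+ 2 = 0); last by rewrite mulr0 mul0r.
have h : (fun l => (1 - alpha * r l)^-1) @ \oo --> (1 - alpha * 0)^-1.
  apply: cvgV; first by rewrite mulr0 subr0 oner_eq0.
  by apply: cvgB; [exact: cvg_cst|apply: cvgMr; exact: r_cvg0].
apply: cvgM; first by apply: cvgM => //; exact: r_cvg0.
under eq_fun do rewrite expr2.
by rewrite expr2; exact: cvgM.
Qed.

Let x l := - ln (1 - alpha * r l).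

Let Gx : (fun l => G l * x l) @ \oo --> alpha * c.
Proof.
apply: (@squeeze_cvgr _ _ _ _ (fun l => alpha * (G l * r l))
   (fun l => alpha * (G l * r l) * (1 - alpha * r l)^-1)).
- apply: nearW => l.
  have /andP[r0 _] := r01 l; have f0 := fac_gt0 l.
  have h1 : alpha * r l <= x l.
    rewrite /x lerNr; apply: le_ln1Dx; rewrite ltrNl opprK.
    by rewrite -subr_gt0.
  have h2 : x l <= alpha * r l / (1 - alpha * r l).
    rewrite /x -lnV ?posrE//.
    rewrite [X in ln X](_ : _ = 1 + alpha * r l / (1 - alpha * r l)); last first.
      by field; rewrite gt_eqF.
    apply: le_ln1Dx; apply: lt_le_trans (ltrN10 _) _.
    by rewrite divr_ge0 ?(ltW f0)// mulr_ge0// ltW.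
  apply/andP; split.
    by rewrite mulrCA ler_wpM2l ?G_ge0.
  rewrite (_ : alpha * (G l * r l) * _ = G l * (alpha * r l / (1 - alpha * r l))).
    by rewrite ler_wpM2l ?G_ge0.
  by ring.
- by apply: cvgMr.
- rewrite -[alpha * c]mulr1 -[X in _ * X](_ : (1 - alpha * 0)^-1 = 1); last first.
    by rewrite mulr0 subr0 invr1.
  apply: cvgM; first exact: cvgMr.
  apply: cvgV; first by rewrite mulr0 subr0 oner_eq0.
  by apply: cvgB; [exact: cvg_cst|apply: cvgMr; exact: r_cvg0].
Qed.

Lemma Pi_ratio n m : (n <= m)%N -> Pi n / Pi m = expR (\sum_(n <= l < m) x l).
Proof.
move=> nm; rewrite -(subnKC nm); elim: (m - n)%N => [|k ih].
  by rewrite addn0 big_geq// expR0 divff// Pi_neq0.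
rewrite addnS big_nat_recr ?leq_addr//= expRD -ih /x expRN lnK ?posrE// PiS.
by rewrite invfM mulrA.
Qed.

Definition time_index n (t : R) := Num.truncn (n%:R + G n * t).
Local Notation mm := time_index.

Lemma mm_itv n t : 0 <= t -> (mm n t)%:R <= n%:R + G n * t < (mm n t).+1%:R.
Proof. by move=> t0; apply: truncn_itv; rewrite addr_ge0// mulr_ge0// G_ge0. Qed.

Lemma mm_ge n t : 0 <= t -> (n <= mm n t)%N.
Proof.
move=> t0; have {1}<- : Num.truncn (n%:R : R) = n by exact: natrK.
by apply: le_truncn; rewrite lerDl mulr_ge0// G_ge0.
Qed.

Lemma mm_mono n s t : s <= t -> (mm n s <= mm n t)%N.
Proof. by move=> st; apply: le_truncn; rewrite lerD2l ler_wpM2l// G_ge0. Qed.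

(** Limit of the sum of 1 / G over the window from [n] to [time_index n t]. For gamma < 1 the speed
    is nearly constant there; for gamma = 1 the window has length of order [n] and the sum is
    logarithmic. *)
Definition tau (t : R) := if gamma == 1 then ln (1 + t) else t.
Definition phi (t : R) := expR (c * alpha * tau t).

(** Equivalent of 1 / G l, in a form that telescopes exactly when gamma = 1. *)
Let hh (l : nat) : R := if gamma == 1 then ln (l.+1%:R) - ln l%:R else (G l)^-1.

(** Bounds [time_index n B / n], hence also the growth of the speed over the window since gamma <=
    1. *)
Let rho B n := 1 + (G n / n%:R) * B.

Let G_ratio B n l : gamma != 1 -> 0 <= B -> (0 < n)%N -> (l <= mm n B)%N ->
  G l <= G n * rho B n.
Proof.
move=> g1 B0 n0 lm.
have /andP[g0 gle1] := gamma01.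
have n0' : 0 < n%:R :> R by rewrite ltr0n.
have h1 : 1 <= rho B n by rewrite lerDl mulr_ge0// divr_ge0// G_ge0.
have : G l <= (n%:R * rho B n) `^ gamma.
  apply: ge0_ler_powR; rewrite ?nnegrE ?(ltW g0)// ?mulr_ge0//; first exact: le_trans ler01 h1.
  rewrite /rho mulrDr mulr1 mulrA [n%:R * _]mulrC divfK ?gt_eqF//.
  have /andP[h _] := mm_itv n B0; apply: le_trans h; by rewrite ler_nat.
have rho0 : 0 <= rho B n by exact: le_trans ler01 h1.
rewrite powRM// => /le_trans; apply.
by rewrite ler_wpM2l ?G_ge0// ler1_powR.
Qed.

Let Ghh : (fun l => G l * hh l) @ \oo --> (1 : R).
Proof.
rewrite /hh; have [g1|_] := eqVneq gamma 1; last first.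
  apply: (@cvg_near_eq _ _ (fun=> 1)); last exact: cvg_cst.
  by apply: filterS near_oo_gt0 => l l0; rewrite divff// gt_eqF// G_gt0.
apply: (@squeeze_cvgr _ _ _ _ (fun l => 1 - harmonic l) (fun=> 1)); last first.
- exact: cvg_cst.
- rewrite -[X in _ --> X]subr0; apply: cvgB; [exact: cvg_cst|exact: cvg_harmonic].
apply: filterS near_oo_gt0 => l l0.
have l0' : 0 < l%:R :> R by rewrite ltr0n.
have l1' : 0 < l.+1%:R :> R by [].
rewrite /G g1 powRr1//.
have e1 : ln (l.+1%:R) - ln l%:R = ln (1 + l%:R^-1) :> R.
  rewrite -lnV ?posrE// -lnM ?posrE ?invr_gt0//; congr ln.
  by rewrite -natr1 mulrDl divff ?gt_eqF// mul1r.
have e2 : ln (l.+1%:R) - ln l%:R = - ln (1 + (- l.+1%:R^-1)) :> R.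
  rewrite -[LHS]opprB; congr (- _); rewrite -lnV ?posrE// -lnM ?posrE ?invr_gt0//; congr ln.
  by rewrite -natr1; field; rewrite natr1 pnatr_eq0.
apply/andP; split.
  have h : ln (1 + (- l.+1%:R^-1)) <= - l.+1%:R^-1 :> R.
    by apply: le_ln1Dx; rewrite ltrNl opprK invf_lt1// ltr1n.
  rewrite e2 /harmonic/=.
  rewrite [leLHS](_ : _ = l%:R * l.+1%:R^-1); last first.
    by rewrite -natr1; field; rewrite natr1 pnatr_eq0.
  by rewrite ler_wpM2l ?(ltW l0')// lerNr.
rewrite e1 mulrC -ler_pdivlMr// mul1r; apply: le_ln1Dx.
by rewrite (lt_le_trans (ltrN10 _))// invr_ge0 ltW.
Qed.

Let hh_sum B e : 0 <= B -> 0 < e -> \forall n \near \oo, forall t, 0 <= t <= B ->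
  `|\sum_(n <= l < mm n t) hh l - tau t| <= e.
Proof.
move=> B0 e0; rewrite /tau; have [g1|g1] := eqVneq gamma 1.
  have /cvgr0_norm_le/(_ _ e0) := GV_cvg0 => h.
  near=> n; move=> t /andP[t0 tB].
  have n0 : (0 < n)%N by near: n; exact: near_oo_gt0.
  have nE : (G n)^-1 <= e.
    by apply: le_trans (ler_norm _) _; near: n.
  have GE : G n = n%:R by rewrite /G g1 powRr1.
  have n0' : 0 < n%:R :> R by rewrite ltr0n.
  have nm := mm_ge n t0.
  have m0' : 0 < (mm n t)%:R :> R by rewrite ltr0n (leq_trans n0).
  have -> : \sum_(n <= l < mm n t) hh l = ln (mm n t)%:R - ln n%:R.
    by rewrite /hh g1 eqxx telescope_sumr.
  have /andP[m1 m2] := mm_itv n t0; rewrite GE -natr1 in m1 m2.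
  have t1 : 0 < 1 + t by rewrite ltr_pwDl.
  have lnE : ln n%:R + ln (1 + t) = ln (n%:R + n%:R * t).
    by rewrite -lnM ?posrE// mulrDr mulr1.
  have nt0 : 0 < n%:R + n%:R * t by rewrite ltr_pwDl// mulr_ge0// ltW.
  have h1 : ln (mm n t)%:R <= ln (n%:R + n%:R * t) by rewrite ler_ln ?posrE.
  have h2 : ln (n%:R + n%:R * t) - ln (mm n t)%:R <= n%:R^-1.
    rewrite -lnV ?posrE// -lnM ?posrE ?invr_gt0//.
    rewrite (_ : _ / _ = 1 + ((n%:R + n%:R * t) / (mm n t)%:R - 1)); last by ring.
    apply: le_trans (le_ln1Dx _) _.
      by rewrite ltrBrDl subrr divr_gt0.
    rewrite (_ : _ - 1 = (n%:R + n%:R * t - (mm n t)%:R) / (mm n t)%:R); last first.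
      by field; rewrite gt_eqF.
    apply: (@le_trans _ _ (1 / (mm n t)%:R)).
      by rewrite ler_wpM2r ?invr_ge0 ?(ltW m0')//; lra.
    by rewrite mul1r lef_pV2 ?posrE// ler_nat.
  rewrite GE in nE.
  by rewrite ler_norml; apply/andP; split; lra.
(* The first term accounts for the variation of the speed over the window, the second for the
   integer part in the time index. *)
have h1 : (fun n => B * B * (G n / n%:R) + (G n)^-1) @ \oo --> (0 : R).
  rewrite -[X in _ --> X]addr0 -{1}(mulr0 (B * B)); apply: cvgD; last exact: GV_cvg0.
  by apply: cvgMr; exact: Gn_cvg0.
have /cvgr0_norm_le/(_ _ e0) h := h1.
near=> n; move=> t /andP[t0 tB].
have n0 : (0 < n)%N by near: n; exact: near_oo_gt0.
have hn : B * B * (G n / n%:R) + (G n)^-1 <= e.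
  by apply: le_trans (ler_norm _) _; near: n.
have n0' : 0 < n%:R :> R by rewrite ltr0n.
have G0 := G_gt0 n0.
have nm := mm_ge n t0.
have /andP[m1 m2] := mm_itv n t0; rewrite -natr1 in m2.
have mE : (mm n t)%:R - n%:R = (mm n t - n)%:R :> R by rewrite natrB.
have rho1 : 1 <= rho B n by rewrite lerDl mulr_ge0// divr_ge0// G_ge0.
have rho0 : 0 < rho B n by exact: lt_le_trans ltr01 rho1.
have up : \sum_(n <= l < mm n t) hh l <= t.
  apply: (@le_trans _ _ (\sum_(n <= l < mm n t) (G n)^-1)).
    rewrite big_nat [leRHS]big_nat; apply: ler_sum => l /andP[nl _].
    rewrite /hh (negbTE g1) lef_pV2 ?posrE ?G_mono// G_gt0// (leq_trans n0)//.
  rewrite sumr_const_nat -[leLHS]mulr_natl -mE ler_pdivrMr//; lra.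
have lo : ((mm n t)%:R - n%:R) / (G n * rho B n) <= \sum_(n <= l < mm n t) hh l.
  rewrite mE mulr_natl -sumr_const_nat.
  rewrite big_nat [leRHS]big_nat; apply: ler_sum => l /andP[nl lm].
  have l0 : (0 < l)%N by exact: leq_trans nl.
  rewrite /hh (negbTE g1) lef_pV2 ?posrE ?mulr_gt0 ?G_gt0//.
  apply: G_ratio => //; rewrite (leq_trans (ltnW lm))// mm_mono//.
have lo2 : t - (B * B * (G n / n%:R) + (G n)^-1) <= ((mm n t)%:R - n%:R) / (G n * rho B n).
  rewrite ler_pdivlMr ?mulr_gt0//.
  have -> : (t - (B * B * (G n / n%:R) + (G n)^-1)) * (G n * rho B n) =
     (t * G n) * rho B n - B * B * (G n / n%:R) * G n * rho B n - rho B n.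
    by field; rewrite !gt_eqF.
  apply: (@le_trans _ _ (t * G n - 1)); last by lra.
  have tr : t * G n * rho B n <= t * G n + B * B * (G n / n%:R) * G n.
    rewrite /rho mulrDr mulr1 lerD2l.
    have gn0 : 0 <= G n / n%:R by rewrite divr_ge0 ?ltW.
    rewrite (_ : t * G n * (G n / n%:R * B) = t * B * (G n / n%:R * G n)); last by ring.
    rewrite -[leRHS]mulrA ler_wpM2r ?mulr_ge0 ?(ltW G0)//.
    by rewrite ler_wpM2r.
  have : B * B * (G n / n%:R) * G n <= B * B * (G n / n%:R) * G n * rho B n.
    by rewrite ler_peMr// !mulr_ge0 ?invr_ge0 ?(ltW G0) ?(ltW n0').
  by lra.
by rewrite ler_norml; apply/andP; split; lra.
Unshelve. all: by end_near. Qed.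

(** [x l] and [c * alpha * hh l] differ by o(1 / G l), hence by a small multiple of [hh l], whose
    sum over the window is bounded. *)
Let x_sum B e : 0 <= B -> 0 < e -> \forall n \near \oo, forall t, 0 <= t <= B ->
  `|\sum_(n <= l < mm n t) x l - c * alpha * tau t| <= e.
Proof.
move=> B0 e0.
have tauB t : 0 <= t <= B -> `|tau t| <= B.
  move=> /andP[t0 tB]; rewrite /tau; case: ifP => _; last by rewrite ger0_norm.
  rewrite ger0_norm ?ln_ge0 ?lerDl//; apply: le_trans tB; apply: le_ln1Dx.
  by rewrite (lt_le_trans (ltrN10 _)).
pose e1 := e / 2 / (B + 1).
have B1 : 0 < B + 1 by rewrite ltr_wpDl.
have e1_gt0 : 0 < e1 by rewrite !divr_gt0.
pose e2 := e / 2 / (c * alpha + e1) .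
have ca0 : 0 < c * alpha by rewrite mulr_gt0.
have cae : 0 < c * alpha + 1 by rewrite ltr_wpDl// ltW.
pose e3 := Num.min 1 (e / 2 / (c * alpha + 1)).
have e3_gt0 : 0 < e3 by rewrite /e3 lt_min ltr01/= divr_gt0// divr_gt0.
have Gd : (fun l => G l * (x l - c * alpha * hh l)) @ \oo --> (0 : R).
  rewrite (_ : (fun l => _) = (fun l => G l * x l - c * alpha * (G l * hh l))); last first.
    by apply/funext => l; ring.
  rewrite -[X in _ --> X](_ : alpha * c - c * alpha * 1 = 0); last by ring.
  by apply: cvgB => //; exact: cvgMr.
have n1 : \forall l \near \oo, 2^-1 <= G l * hh l.
  have /cvgrPdist_le/(_ 2^-1) := Ghh.
  rewrite invr_gt0 ltr0n => /(_ isT); apply: filterS => l; rewrite ler_norml; lra.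
have e12 : 0 < e1 * 2^-1 by rewrite divr_gt0.
have /cvgr0_norm_le/(_ _ e12) n2 := Gd.
have [N _ HN] : \forall l \near \oo, [/\ (0 < l)%N, 2^-1 <= G l * hh l &
    `|G l * (x l - c * alpha * hh l)| <= e1 * 2^-1].
  by near=> l; split; near: l; [exact: near_oo_gt0|exact: n1|exact: n2].
have hs := hh_sum B0 e3_gt0.
near=> n; move=> t tB.
have Nn : (N <= n)%N by near: n; exists N.
have hst' : forall t, 0 <= t <= B -> `|\sum_(n <= l < mm n t) hh l - tau t| <= e3.
  by near: n.
have hst := hst' t tB.
have d1 : `|\sum_(n <= l < mm n t) x l - c * alpha * \sum_(n <= l < mm n t) hh l| <=
    e1 * \sum_(n <= l < mm n t) hh l.
  rewrite mulr_sumr -sumrB mulr_sumr big_nat [leRHS]big_nat.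
  apply: le_trans (ler_norm_sum _ _ _) _; apply: ler_sum => l /andP[nl _].
  have [l0 h1 h2] := HN l (leq_trans Nn nl).
  rewrite -(ler_pM2l (G_gt0 l0)) -{1}(ger0_norm (ltW (G_gt0 l0))) -normrM.
  by apply: le_trans h2 _; rewrite [leRHS]mulrCA ler_wpM2l// ltW.
have e31 : e3 <= 1 by rewrite /e3 ge_min lexx.
have e32 : e3 <= e / 2 / (c * alpha + 1) by rewrite /e3 ge_min lexx orbT.
have tB' := tauB t tB.
have sB : \sum_(n <= l < mm n t) hh l <= B + 1.
  by move: hst tB'; rewrite !ler_norml; lra.
have p1 : e1 * \sum_(n <= l < mm n t) hh l <= e / 2.
  apply: (@le_trans _ _ (e1 * (B + 1))); first by rewrite ler_wpM2l// ltW.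
  by rewrite /e1 divfK ?gt_eqF.
have p2 : `|c * alpha * (\sum_(n <= l < mm n t) hh l - tau t)| <= e / 2.
  rewrite normrM (ger0_norm (ltW ca0)).
  apply: (@le_trans _ _ ((c * alpha + 1) * (e / 2 / (c * alpha + 1)))).
    apply: ler_pM => //; [exact: ltW|by rewrite lerDl|exact: le_trans e32].
  by rewrite mulrC divfK ?gt_eqF.
rewrite (_ : \sum_(n <= l < mm n t) x l - c * alpha * tau t =
   (\sum_(n <= l < mm n t) x l - c * alpha * \sum_(n <= l < mm n t) hh l) +
   c * alpha * (\sum_(n <= l < mm n t) hh l - tau t)); last by ring.
by apply: le_trans (ler_normD _ _) _; lra.
Unshelve. all: by end_near. Qed.

Lemma phi_unif B e : 0 <= B -> 0 < e -> \forall n \near \oo, forall t, 0 <= t <= B ->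
  `|phi t * Pi (mm n t) / Pi n - 1| <= e.
Proof.
move=> B0 e0.
have /cvgrPdist_le/(_ _ e0)[d /= d0 hd] := @continuous_expR R 0.
have d2 : 0 < d / 2 by rewrite divr_gt0.
apply: filterS (x_sum B0 d2) => n hn t tB.
have t0 : 0 <= t by case/andP: tB.
have -> : phi t * Pi (mm n t) / Pi n =
   expR (c * alpha * tau t - \sum_(n <= l < mm n t) x l).
  rewrite expRB -/(phi t) -Pi_ratio ?mm_ge// invf_div.
  by rewrite mulrA.
rewrite distrC -{1}expR0; apply: hd.
rewrite /ball_/= sub0r normrN distrC (le_lt_trans (hn t tB))//; lra.
Qed.

Lemma phi_cvg t : 0 <= t -> (fun n => Pi n / Pi (mm n t)) @ \oo --> phi t.
Proof.
move=> t0.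
have h : (fun n => phi t * Pi (mm n t) / Pi n) @ \oo --> (1 : R).
  apply/cvgrPdist_le => e e0; apply: filterS (phi_unif t0 e0) => n hn.
  by rewrite distrC hn// t0 lexx.
have -> : (fun n => Pi n / Pi (mm n t)) = (fun n => phi t * (phi t * Pi (mm n t) / Pi n)^-1).
  apply/funext => n; have := Pi_neq0 n; have := Pi_neq0 (mm n t).
  have : phi t != 0 by rewrite gt_eqF// expR_gt0.
  by move=> *; field; apply/and3P.
rewrite -[X in _ --> X]mulr1 -invr1; apply: cvgMr.
by apply: cvgV => //; exact: oner_neq0.
Qed.

(** Limit of [beta2 n / beta2 (time_index n t)]: the square comes from the decays, the other factor
    from the ratio of speeds. *)
Definition clock t := phi t ^+ 2 * (if gamma == 1 then (1 + t)^-1 else 1).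
Local Notation qq := clock.

Lemma mm_cvg t : 0 <= t -> mm^~ t @ \oo --> \oo.
Proof.
move=> t0 S [N _ hN]; exists N => // n /= Nn; apply: hN => /=.
exact: leq_trans (mm_ge n t0).
Qed.

Lemma beta2A_mm_cvg t : 0 <= t ->
  (fun n => beta2 n * A (mm n t)) @ \oo --> kappa * qq t.
Proof.
move=> t0.
have h1 := cvg_comp _ _ (mm_cvg t0) beta2A_cvg.
have h2 : (fun n => G n / G (mm n t)) @ \oo --> (if gamma == 1 then (1 + t)^-1 else 1).
  have t1 : 0 < 1 + t by rewrite ltr_pwDl.
  have [g1|g1] := eqVneq gamma 1.
    have h : (fun n => G (mm n t) / G n) @ \oo --> 1 + t.
      apply/subr_cvg0; apply: cvg0_le GV_cvg0.
      apply: filterS near_oo_gt0 => n n0.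
      have n0' : 0 < n%:R :> R by rewrite ltr0n.
      have GE k : G k = k%:R by rewrite /G g1 powRr1.
      have /andP[m1 m2] := mm_itv n t0; rewrite GE -natr1 in m1 m2.
      rewrite !GE -(ler_pM2r n0') mulVf ?gt_eqF//.
      rewrite -[X in _ * X](ger0_norm (ltW n0')) -normrM mulrBl divfK ?gt_eqF//.
      by rewrite ler_norml; apply/andP; split; lra.
    rewrite (_ : (fun n => _) = (fun n => (G (mm n t) / G n)^-1)); last first.
      by apply/funext => n; rewrite invf_div.
    by apply: cvgV => //; rewrite gt_eqF.
  apply: (@squeeze_cvgr _ _ _ _ (fun n => (rho t n)^-1) (fun=> 1)); last exact: cvg_cst.
    apply: filterS near_oo_gt0 => n n0.
    have m0 : (0 < mm n t)%N by rewrite (leq_trans n0)// mm_ge.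
    have rho1 : 1 <= rho t n by rewrite lerDl mulr_ge0// divr_ge0// G_ge0.
    have rho0 : 0 < rho t n by exact: lt_le_trans ltr01 rho1.
    apply/andP; split; last by rewrite ler_pdivrMr ?G_gt0// mul1r G_mono// mm_ge.
    rewrite ler_pdivlMr ?G_gt0// mulrC ler_pdivrMr//.
    exact: G_ratio.
  rewrite -[X in _ --> X]invr1; apply: cvgV; first exact: oner_neq0.
  rewrite -[X in _ --> X]addr0; apply: cvgD; first exact: cvg_cst.
  by rewrite -(mul0r t); apply: cvgMl; exact: Gn_cvg0.
apply: (@cvg_near_eq _ _ (fun n => (beta2 (mm n t) * A (mm n t)) *
   ((Pi n / Pi (mm n t)) * (Pi n / Pi (mm n t)) * (G n / G (mm n t))))).
  apply: filterS near_oo_gt0 => n n0.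
  have m0 : (0 < mm n t)%N by rewrite (leq_trans n0)// mm_ge.
  have := G_gt0 m0 => /gt_eqF/negbT g0.
  have := Pi_neq0 (mm n t) => p0.
  by rewrite /beta2; field; rewrite g0.
apply: cvgM => //; rewrite /qq expr2; apply: cvgM => //.
by apply: cvgM; exact: phi_cvg.
Qed.

(** Negligibility of single weights. Up to [n], monotonicity of [beta2] reduces the claim to
    [beta2wt_cvg0]; past [n], the ratio of [beta2 n] to [beta2 l] is bounded by the squared ratio of
    decays across the window. *)
Lemma beta2wt_small B e : 0 <= B -> 0 < e -> exists p, \forall n \near \oo,
  forall l, (p <= l < mm n B)%N -> beta2 n * wt l ^+ 2 <= e.
Proof.
move=> B0 e0.
pose C := phi B ^+ 2 + 2.
have C0 : 0 < C by rewrite ltr_wpDl// sqr_ge0.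
have [N0 HN0] := beta2_noninc.
have eC : 0 < e / C by rewrite divr_gt0.
have /cvgr0_norm_le/(_ _ eC) hw := beta2wt_cvg0.
have [N1 _ HN1] := hw.
have hphi : (fun n => (Pi n / Pi (mm n B)) ^+ 2) @ \oo --> phi B ^+ 2.
  by rewrite expr2; under eq_fun do rewrite expr2; apply: cvgM; exact: phi_cvg.
have /cvgrPdist_le/(_ _ ltr01) hp := hphi.
exists (maxn N0 N1); near=> n; move=> l /andP[].
rewrite geq_max => /andP[N0l N1l] lm.
have wl : beta2 l * wt l ^+ 2 <= e / C by apply: le_trans (ler_norm _) _; exact: HN1.
have w0 : 0 <= wt l ^+ 2 by exact: sqr_ge0.
have bC : beta2 n <= C * beta2 l.
  have [ln|/ltnW nl] := leqP l n.
    apply: (@le_trans _ _ (beta2 l)); first by apply: HN0; rewrite N0l.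
    rewrite ler_peMl ?beta2_ge0// /C; have := sqr_ge0 (phi B); lra.
  have pC : (Pi n / Pi (mm n B)) ^+ 2 <= C.
    have : `|phi B ^+ 2 - (Pi n / Pi (mm n B)) ^+ 2| <= 1 by near: n.
    rewrite ler_norml /C; lra.
  apply: (@le_trans _ _ ((Pi n / Pi (mm n B)) ^+ 2 * beta2 l)); last first.
    by rewrite ler_wpM2r// beta2_ge0.
  rewrite /beta2 [leRHS]mulrCA -exprMn; apply: ler_pM; rewrite ?G_ge0 ?sqr_ge0 ?G_mono//.
  have ge0 k : 0 <= Pi k by rewrite ltW// Pi_gt0.
  rewrite lerXn2r ?nnegrE ?mulr_ge0 ?invr_ge0//.
  rewrite mulrAC ler_pdivlMr ?Pi_gt0// ler_wpM2l//.
  by apply: Pi_mono; exact: ltnW.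
apply: (@le_trans _ _ (C * (beta2 l * wt l ^+ 2))).
  by rewrite mulrA ler_wpM2r.
by rewrite mulrC -ler_pdivlMr.
Unshelve. all: by end_near. Qed.

End rates.

(** * Skorohod-continuous functionals *)

Section skorohod_functional.
Context {R : realType}.
Variables (F : (R -> R) -> R) (M : R).
Hypothesis FM : forall x, `|F x| <= M.
Hypothesis F_cont : skorohod_continuous F.

Lemma cadlag_cst (a : R) : cadlag (fun=> a).
Proof. by move=> t t0; split; [exact: cvg_cst|move=> _; exact: is_cvg_cst]. Qed.

Lemma time_change_id : time_change (id : R -> R).
Proof.
split=> //; split; last by split=> // u u0; exists u.
by apply: continuous_subspaceT => x; exact: cvg_id.
Qed.

Definition lset (j : nat) (x : R -> R) : set R :=
  [set a | exists y e, [/\ cadlag y, 0 <= e,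
     e < 1 -> forall t, 0 <= t <= j%:R -> `|x t - y t| <= e & a = F y + j%:R * e]].

(* Lipschitz regularisation of [F] for the truncated uniform distance on [0, j];
   the condition [e < 1 -> ...] keeps the infimum over a nonempty set. *)
Definition lreg (j : nat) (x : R -> R) : R := inf (lset j x).

Let lset_lb j x : lbound (lset j x) (- M).
Proof.
move=> a [y [e [_ e0 _ ->]]].
have : 0 <= j%:R * e by rewrite mulr_ge0.
have := FM y; rewrite ler_norml; lra.
Qed.

Let lset_nonempty j x : lset j x !=set0.
Proof.
exists (F (fun=> 0) + j%:R * 1), (fun=> 0), 1; split=> //; first exact: cadlag_cst.
by rewrite ltxx.
Qed.

Lemma lreg_le j x : cadlag x -> lreg j x <= F x.
Proof.
move=> cx; apply: ge_inf; first by exists (- M); exact: lset_lb.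
by exists x, 0; split=> // [_ t _|]; rewrite ?subrr ?normr0// mulr0 addr0.
Qed.

Lemma lreg_ge j x : - M <= lreg j x.
Proof. by apply: lb_le_inf; [exact: lset_nonempty|exact: lset_lb]. Qed.

Lemma lreg_bound j x : `|lreg j x| <= M + j%:R.
Proof.
have := lreg_ge j x; have j0 : 0 <= j%:R :> R by [].
have : lreg j x <= F (fun=> 0) + j%:R * 1.
  apply: ge_inf; first by exists (- M); exact: lset_lb.
  exists (fun=> 0), 1; split=> //; first exact: cadlag_cst.
  by rewrite ltxx.
have := FM (fun=> 0); rewrite !ler_norml; lra.
Qed.

Lemma lreg_lip j x y (e : R) : 0 <= e ->
  (forall t, 0 <= t <= j%:R -> `|x t - y t| <= e) ->
  lreg j x <= lreg j y + j%:R * e.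
Proof.
move=> e0 xy; rewrite -lerBlDr; apply: lb_le_inf; first exact: lset_nonempty.
move=> a [z [e' [cz e'0 yz ->]]]; rewrite lerBlDr.
apply: ge_inf; first by exists (- M); exact: lset_lb.
exists z, (e' + e); split=> //; first by rewrite addr_ge0.
  move=> h t tj; have e'1 : e' < 1 by lra.
  have := yz e'1 t tj; have := xy t tj => h1 h2.
  rewrite (_ : x t - z t = (x t - y t) + (y t - z t)); last by ring.
  by rewrite (le_trans (ler_normD _ _))// addrC lerD.
by rewrite mulrDr addrA.
Qed.

Lemma lreg_dist j x y (e : R) : 0 <= e ->
  (forall t, 0 <= t <= j%:R -> `|x t - y t| <= e) ->
  `|lreg j x - lreg j y| <= j%:R * e.
Proof.
move=> e0 xy.
have h1 := lreg_lip e0 xy.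
have h2 : lreg j y <= lreg j x + j%:R * e.
  by apply: lreg_lip => // t tj; rewrite distrC xy.
by rewrite ler_norml; apply/andP; split; lra.
Qed.

(** Otherwise near-minimisers y have F y <= F x - e. Boundedness of [F] forces their distance to [x]
    on [0, n] below 2 M / n, so they converge to [x] with identity time changes, against the
    continuity of [F]. *)
Lemma lreg_cvg x : cadlag x -> lreg j x @[j --> \oo] --> F x.
Proof.
move=> cx; apply/cvgrPdist_le => /= e e0; apply: contrapT => ne.
have M0 : 0 <= M by apply: le_trans (FM (fun=> 0)).
have h n : exists y, [/\ cadlag y, F y <= F x - e &
   forall t, 0 <= t <= n%:R -> 2 * M < n%:R -> `|x t - y t| <= 2 * M / n%:R].
  have [j nj hj] : exists2 j, (n <= j)%N & ~ (`|F x - lreg j x| <= e).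
    apply: contrapT => nh; apply: ne; exists n => // j /= nj.
    by apply: contrapT => hj; apply: nh; exists j.
  have lt : lreg j x < F x - e.
    move/negP: hj; rewrite -ltNge ger0_norm; last by rewrite subr_ge0 lreg_le.
    lra.
  have [a [y [e' [cy e'0 xy ->]]] lta] := inf_lt (lset_nonempty j x) lt.
  have je0 : 0 <= j%:R * e' by rewrite mulr_ge0.
  exists y; split=> //; first by lra.
  move=> t /andP[t0 tn] Mn.
  have n0 : 0 < n%:R :> R by apply: le_lt_trans Mn; rewrite mulr_ge0.
  have nj' : n%:R <= j%:R :> R by rewrite ler_nat.
  have e'n : e' <= 2 * M / n%:R.
    rewrite ler_pdivlMr// mulrC.
    have : n%:R * e' <= j%:R * e' by rewrite ler_wpM2r.
    have := FM x; have := FM y; rewrite !ler_norml; lra.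
  have e'1 : e' < 1 by rewrite (le_lt_trans e'n)// ltr_pdivrMr// mul1r.
  by rewrite (le_trans (xy e'1 t _))// t0 (le_trans tn).
pose xs n := projT1 (cid (h n)).
have xsP n := projT2 (cid (h n)); rewrite -/(xs _) in xsP.
have cxs n : cadlag (xs n) by case: (xsP n).
have sc : skorohod_cvg xs x.
  exists (fun=> id); split; first by move=> n; exact: time_change_id.
  split; first by move=> e' e'0; apply: nearW => n t _; rewrite subrr normr0 ltW.
  move=> m e' e'0; near=> n; move=> t /andP[t0 tm].
  have [_ _ hn] := xsP n.
  have mn : m <= n%:R by near: n; exact: nbhs_infty_ger.
  have Mn : 2 * M < n%:R by near: n; exact: nbhs_infty_gtr.
  have n0 : 0 < n%:R :> R by rewrite (le_lt_trans _ Mn)// mulr_ge0.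
  have en : 2 * M / e' <= n%:R by near: n; exact: nbhs_infty_ger.
  rewrite distrC (le_trans (hn t _ Mn))//; first by rewrite t0 (le_trans tm).
  by rewrite ler_pdivrMr// [leRHS]mulrC -ler_pdivrMr.
have := F_cont cxs cx sc.
have e2 : 0 < e / 2 by rewrite divr_gt0.
move/cvgrPdist_le => /(_ _ e2)[n _ /(_ n (leqnn n))] /=.
have [_ + _] := xsP n; rewrite ler_norml; lra.
Unshelve. all: by end_near. Qed.

Definition grid (k : nat) (i : nat) : R := i%:R / k.+1%:R.
Definition gidx (k : nat) (t : R) : nat := Num.truncn (t * k.+1%:R).
(** Step path through the grid values on [0, j]. Past [j], [inord] may fall back on a default index,
    which [lreg j] does not see. *)
Definition stepf (j k : nat) (x : 'I_(j * k.+1).+1 -> R) (t : R) : R :=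
  x (inord (gidx k t)).

Lemma gidx_le j k t : 0 <= t <= j%:R -> (gidx k t <= j * k.+1)%N.
Proof.
move=> /andP[t0 tj]; rewrite /gidx.
have -> : (j * k.+1)%N = Num.truncn ((j * k.+1)%:R : R) by rewrite natrK.
by apply: le_truncn; rewrite natrM ler_pM2r.
Qed.

Lemma stepf_grid j k (x : R -> R) t : 0 <= t <= j%:R ->
  stepf (fun i : 'I_(j * k.+1).+1 => x (grid k i)) t = x (grid k (gidx k t)).
Proof. by move=> tj; rewrite /stepf inordK// ltnS gidx_le. Qed.

Lemma gidx_itv k t : 0 <= t -> grid k (gidx k t) <= t < grid k (gidx k t).+1.
Proof.
move=> t0; have k0 : 0 < k.+1%:R :> R by [].
have /andP[h1 h2] := @truncn_itv _ (t * k.+1%:R) (mulr_ge0 t0 (ltW k0)).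
by rewrite /grid ler_pdivrMr// h1/= ltr_pdivlMr.
Qed.

(** * From finite-dimensional laws and oscillation bounds to functionals *)

Section convergence.
Context d (T : measurableType d) (P : probability T R)
        d' (T' : measurableType d') (P' : probability T' R).
Variables (X U : nat -> T -> R -> R) (Y : T' -> R -> R).
Hypothesis X_cadlag : \forall n \near \oo, forall w, cadlag (X n w).
Hypothesis Y_cadlag : forall w, cadlag (Y w).
Hypothesis FX_meas : forall n, measurable_fun setT (fun w => F (X n w)).
Hypothesis Y_meas : forall t, 0 <= t -> measurable_fun setT (Y^~ t).
Hypothesis U_meas : forall n t, 0 <= t -> measurable_fun setT ((U n)^~ t).
Hypothesis Y_cont : forall w (j : nat) (e : R), 0 < e -> \forall k \near \oo,
  forall t, 0 <= t <= j%:R -> `|Y w t - Y w (grid k (gidx k t))| <= e.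
Hypothesis fdd : forall (j k : nat) (g : ('I_(j * k.+1).+1 -> R) -> R) (L C : R),
  0 <= L -> (forall x, `|g x| <= C) ->
  (forall x y, `|g x - g y| <= L * \sum_i `|x i - y i|) ->
  Ex P (fun w => g (fun i => U n w (grid k i))) @[n --> \oo] -->
  Ex P' (fun w => g (fun i => Y w (grid k i))).
Hypothesis tight : forall (j : nat) (e : R), 0 < e -> \forall k \near \oo,
  \forall n \near \oo, exists2 Bad : set T, measurable Bad &
   Ex P (\1_Bad) <= e /\ forall w, ~ Bad w -> forall t, 0 <= t <= j%:R ->
     `|X n w t - U n w (grid k (gidx k t))| <= e.

Let grid_ge0 k i : 0 <= grid k i. Proof. by rewrite divr_ge0. Qed.

Let gfun j k (x : 'I_(j * k.+1).+1 -> R) := lreg j (stepf x).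

Let gfun_bound j k x : `|@gfun j k x| <= M + j%:R.
Proof. exact: lreg_bound. Qed.

Let gfun_lip j k x y : `|@gfun j k x - gfun y| <= j%:R * \sum_i `|x i - y i|.
Proof.
apply: lreg_dist; first by apply: sumr_ge0 => i _.
move=> t tj; rewrite /stepf; set i := inord _.
by rewrite (bigD1 i)//= lerDl sumr_ge0.
Qed.

Let gY_cvg j w : @gfun j k (fun i => Y w (grid k i)) @[k --> \oo] --> lreg j (Y w).
Proof.
apply/cvgrPdist_le => e e0.
have e' : 0 < e / (j%:R + 1) by rewrite divr_gt0// ltr_wpDl.
apply: filterS (Y_cont w j e') => k hk.
have h : `|lreg j (Y w) - gfun (fun i : 'I_(j * k.+1).+1 => Y w (grid k i))| <= j%:R * (e / (j%:R + 1)).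
  apply: lreg_dist; first exact: ltW.
  by move=> t tj; rewrite stepf_grid// hk.
apply: le_trans h _; rewrite mulrC mulrAC ler_pdivrMr ?ltr_wpDl//.
by rewrite ler_wpM2l ?(ltW e0)// lerDl.
Qed.

Let gY_bmf j k : bmf (fun w => @gfun j k (fun i => Y w (grid k i))).
Proof.
apply: (lipschitz_bmf (@gfun_bound j k) (@gfun_lip j k)) => // i.
exact: Y_meas.
Qed.

Let lY_bmf j : bmf (fun w => lreg j (Y w)).
Proof.
apply: (@bmf_le _ _ _ (M + j%:R)); last by move=> w; exact: lreg_bound.
apply: (measurable_fun_cvg (h := fun k w => @gfun j k (fun i => Y w (grid k i)))).
  by move=> k; case: (gY_bmf j k).
by move=> w _; exact: gY_cvg.
Qed.

(** Nothing says that [F] is measurable; along [Y] it is a double pointwise limit of Lipschitz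
    functions of finitely many values. *)
Lemma skorohod_bmf : bmf (fun w => F (Y w)).
Proof.
apply: (@bmf_le _ _ _ M) => //.
apply: (measurable_fun_cvg (h := fun j w => lreg j (Y w))).
  by move=> j; case: (lY_bmf j).
by move=> w _; exact: lreg_cvg.
Qed.

(* As [lreg j] converges to [F] from below, it is enough to compare functionals
   that are Lipschitz in finitely many values of the path; [- F] provides the
   matching upper bound. *)
Lemma skorohod_liminf (e : R) : 0 < e ->
  \forall n \near \oo, Ex P' (fun w => F (Y w)) - e <= Ex P (fun w => F (X n w)).
Proof.
move=> e0.
have M0 : 0 <= M by apply: le_trans (FM (fun=> 0)).
have e4 : 0 < e / 4 by rewrite divr_gt0.
have bFY := skorohod_bmf.
have c1 : Ex P' (fun w => lreg j (Y w)) @[j --> \oo] --> Ex P' (fun w => F (Y w)).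
  apply: (@Ex_dct _ _ _ _ _ _ M) => //.
  - by move=> j; case: (lY_bmf j).
  - move=> j w; rewrite ler_norml lreg_ge/= (le_trans (lreg_le _ _))//.
    by rewrite (le_trans (ler_norm _)).
  - by apply: aeW => w; exact: lreg_cvg.
have /cvgrPdist_le/(_ _ e4)[j _ /(_ j (leqnn j)) hj] := c1.
have c2 : Ex P' (fun w => @gfun j k (fun i => Y w (grid k i))) @[k --> \oo] -->
    Ex P' (fun w => lreg j (Y w)).
  apply: (@Ex_dct _ _ _ _ _ _ (M + j%:R)) => //.
  - by move=> k; case: (gY_bmf j k).
  - by apply: aeW => w; exact: gY_cvg.
(* The denominator collects the Lipschitz constant [j], which multiplies the oscillation, and the
   loss [2 * M + j] on the bad event. *)
pose e' := e / 4 / (j%:R + (2 * M + j%:R) + 1).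
have D0 : 0 < j%:R + (2 * M + j%:R) + 1 :> R by rewrite ltr_wpDl// !addr_ge0// mulr_ge0.
have e'0 : 0 < e' by rewrite divr_gt0.
have /cvgrPdist_le/(_ _ e4) hk := c2.
have [k _ /(_ k (leqnn k)) [hk1 hk2]] : \forall k \near \oo, _ /\ _ := filterI hk (tight j e'0).
have := fdd (ler0n _ j) (@gfun_bound j k) (@gfun_lip j k).
move=> /cvgrPdist_le/(_ _ e4) hn.
near=> n.
have [Bad mB [PB hB]] : exists2 Bad : set T, measurable Bad &
   Ex P (\1_Bad) <= e' /\ forall w, ~ Bad w -> forall t, 0 <= t <= j%:R ->
     `|X n w t - U n w (grid k (gidx k t))| <= e' by near: n.
have hnn : `|Ex P' (fun w => gfun (fun i : 'I_(j * k.+1).+1 => Y w (grid k i))) -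
   Ex P (fun w => gfun (fun i : 'I_(j * k.+1).+1 => U n w (grid k i)))| <= e / 4 by near: n.
have cXn : forall w, cadlag (X n w) by near: n.
have bU : bmf (fun w => gfun (fun i : 'I_(j * k.+1).+1 => U n w (grid k i))).
  apply: (lipschitz_bmf (@gfun_bound j k) (@gfun_lip j k)) => // i.
  exact: U_meas.
have bFX : bmf (fun w => F (X n w)) by exact: (@bmf_le _ _ _ M).
have bB : bmf (\1_Bad : T -> R) by exact: bmf_indic.
have bcB : bmf (fun w => (2 * M + j%:R) * \1_Bad w : R).
  by apply: bmfM => //; exact: bmf_cst.
(* Off [Bad], [F] dominates [lreg j], which is Lipschitz; on [Bad] the bounds M of [F] and M + j of
   [gfun] are simply added. *)
have low : Ex P (fun w => gfun (fun i : 'I_(j * k.+1).+1 => U n w (grid k i)) - j%:R * e'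
     - (2 * M + j%:R) * \1_Bad w) <= Ex P (fun w => F (X n w)).
  apply: Ex_le => //; first by apply: bmfB => //; apply: bmfB => //; exact: bmf_cst.
  move=> w; have [Bw|nBw] := pselect (Bad w).
    rewrite indicE mem_set// mulr1.
    have je : 0 <= j%:R * e' by rewrite mulr_ge0// ltW.
    have := FM (X n w); have := @gfun_bound j k (fun i => U n w (grid k i)).
    rewrite !ler_norml; lra.
  rewrite indicE memNset// mulr0 subr0 lerBlDr.
  apply: le_trans (lerD (lreg_le j (cXn w)) (lexx _)).
  apply: lreg_lip; first exact: ltW.
  by move=> t tj; rewrite stepf_grid// distrC hB.
have bcst : @bmf R _ T (fun=> j%:R * e') by exact: bmf_cst.
rewrite (ExB P (bmfB bU bcst) bcB) (ExB P bU bcst) Ex_cst (ExZ P _ bB) in low.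
have MJ : 0 <= 2 * M + j%:R by rewrite addr_ge0// mulr_ge0.
have q1 : (2 * M + j%:R) * Ex P (\1_Bad) <= (2 * M + j%:R) * e' by rewrite ler_wpM2l.
have q2 : j%:R * e' + (2 * M + j%:R) * e' <= e / 4.
  rewrite -mulrDl mulrC /e' mulrAC ler_pdivrMr// ler_wpM2l ?(ltW e4)//; lra.
move: hj hk1 hnn; rewrite !ler_norml; lra.
Unshelve. all: by end_near. Qed.

End convergence.
End skorohod_functional.

(** * Deviations in the interacting model *)

Lemma same_law_Ex (R : realType) d (T : measurableType d) (P : probability T R) (Z : T -> R)
  d' (T' : measurableType d') (P' : probability T' R) (Z' : T' -> R) (h : R -> R) :
  same_law P Z P' Z' -> measurable_fun setT Z -> measurable_fun setT Z' -> bmf h ->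
  Ex P (fun w => h (Z w)) = Ex P' (fun w => h (Z' w)).
Proof.
move=> ZZ mZ mZ' bh.
apply/eqP; rewrite -subr_eq0 -normr_eq0 eq_le normr_ge0 andbT.
apply/ler_addgt0Pr => e e0; rewrite add0r.
have e2 : 0 < e / 2 by rewrite divr_gt0.
have [n [a [A [mA hA]]]] := bmf_approx bh e2.
have mhA k : measurable (h @^-1` A k) by rewrite -[X in measurable X]setTI; exact: bh.1.
pose g x := \sum_(k < n) a k * \1_(h @^-1` (A k)) x : R.
have bi k : bmf (\1_(h @^-1` (A k)) : R -> R) by exact: bmf_indic.
have bg : bmf g by apply: bmf_sum => k; apply: bmfM; [exact: bmf_cst|exact: bi].
have cmp d0 (S : measurableType d0) (X : S -> R) (f : R -> R) :
    measurable_fun setT X -> bmf f -> bmf (fun w => f (X w)).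
  by move=> mX [mf [M fM]]; split; [exact: measurableT_comp|exists M].
have gE d0 (S : measurableType d0) (Q : probability S R) (X : S -> R) :
   measurable_fun setT X ->
   Ex Q (fun w => g (X w)) = \sum_(k < n) a k * fine (Q (X @^-1` (h @^-1` A k))).
  move=> mX; rewrite /g Ex_sum.
    apply: eq_bigr => k _; rewrite ExZ; last by apply: (cmp _ _ X) => //; exact: bi.
    congr (_ * _); rewrite -Ex_indic//.
    by rewrite -[X in measurable X]setTI; exact: mX.
  move=> k; apply: bmfM; first exact: bmf_cst.
  by apply: (cmp _ _ X) => //; exact: bi.
have gg : Ex P (fun w => g (Z w)) = Ex P' (fun w => g (Z' w)).
  by rewrite !gE//; apply: eq_bigr => k _; rewrite ZZ.
have h1 : `|Ex P (fun w => h (Z w)) - Ex P (fun w => g (Z w))| <= e / 2.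
  by apply: Ex_dist_le => //; exact: cmp.
have h2 : `|Ex P' (fun w => h (Z' w)) - Ex P' (fun w => g (Z' w))| <= e / 2.
  by apply: Ex_dist_le => //; exact: cmp.
move: h1 h2; rewrite gg !ler_norml; lra.
Qed.

(** Passes from events of the sub-sigma-algebra to its bounded functions, which turns the
    conditional law given by the model into identities with adapted weights. *)
Lemma sub_sigma_Ex (R : realType) d (T : measurableType d) (P : probability T R)
  (G : set (set T)) (g f1 f2 : T -> R) :
  (forall A, G A -> measurable A) ->
  @bmf R _ (g_sigma_algebraType G) g -> bmf f1 -> bmf f2 ->
  (forall A, <<s G >> A -> Ex P (fun w => \1_A w * f1 w) = Ex P (fun w => \1_A w * f2 w)) ->
  Ex P (fun w => g w * f1 w) = Ex P (fun w => g w * f2 w).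
Proof.
move=> GT bg b1 b2 f12.
have GT' A : <<s G >> A -> measurable A.
  by apply: smallest_sub => //; exact: sigma_algebra_measurable.
have bgT : bmf g by exact: (@adp_bmf _ _ _ (fun=> G) (fun _ => GT) 0%N).
have [M1 hM1] := b1.2; have [M2 hM2] := b2.2.
have M10 : 0 <= M1 by apply: le_trans (hM1 point).
have M20 : 0 <= M2 by apply: le_trans (hM2 point).
apply/eqP; rewrite -subr_eq0 -normr_eq0 eq_le normr_ge0 andbT.
apply/ler_addgt0Pr => e e0; rewrite add0r.
pose e' := e / (M1 + M2 + 1).
have D0 : 0 < M1 + M2 + 1 by rewrite ltr_wpDl// addr_ge0.
have e'0 : 0 < e' by rewrite divr_gt0.
have [n [a [A [mA gA]]]] := bmf_approx bg e'0.
have sA k : <<s G >> (g @^-1` A k).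
  have := bg.1 measurableT (A k) (mA k); rewrite setTI; exact.
pose h w := \sum_(k < n) a k * \1_(g @^-1` (A k)) w : R.
have bi k : bmf (\1_(g @^-1` (A k)) : T -> R) by apply: bmf_indic; exact: GT'.
have bh : bmf h by apply: bmf_sum => k; apply: bmfM; [exact: bmf_cst|exact: bi].
have hE f : bmf f -> Ex P (fun w => h w * f w) =
   \sum_(k < n) a k * Ex P (fun w => \1_(g @^-1` (A k)) w * f w).
  move=> bf.
  have -> : (fun w => h w * f w) = (fun w => \sum_(k < n) a k * (\1_(g @^-1` (A k)) w * f w)).
    by apply/funext => w; rewrite /h mulr_suml; apply: eq_bigr => k _; rewrite mulrA.
  rewrite Ex_sum; last by move=> k; apply: bmfM; [exact: bmf_cst|exact: bmfM].
  by apply: eq_bigr => k _; rewrite ExZ//; exact: bmfM.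
have hh : Ex P (fun w => h w * f1 w) = Ex P (fun w => h w * f2 w).
  by rewrite !hE//; apply: eq_bigr => k _; rewrite f12.
have h1 : `|Ex P (fun w => g w * f1 w) - Ex P (fun w => h w * f1 w)| <= e' * M1.
  apply: Ex_dist_le; [exact: bmfM|exact: bmfM|].
  by move=> w; rewrite -mulrBl normrM ler_pM// gA.
have h2 : `|Ex P (fun w => g w * f2 w) - Ex P (fun w => h w * f2 w)| <= e' * M2.
  apply: Ex_dist_le; [exact: bmfM|exact: bmfM|].
  by move=> w; rewrite -mulrBl normrM ler_pM// gA.
have q : e' * M1 + e' * M2 <= e.
  rewrite -mulrDr /e' mulrAC ler_pdivrMr// ler_wpM2l ?(ltW e0)//; lra.
move: h1 h2; rewrite hh !ler_norml; lra.
Qed.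

Section model.
Context {R : realType} d (T : measurableType d) (P : probability T R).
Variables (N : nat) (alpha : R) (r : nat -> R).
Variables (Zi : nat -> 'I_N -> T -> R) (I : nat -> 'I_N -> T -> R).
Hypothesis N_gt0 : (0 < N)%N.
Hypothesis alpha01 : 0 < alpha <= 1.
Hypothesis r01 : forall n, 0 <= r n < 1.
Hypothesis model : interacting_model P alpha r Zi I.

Let mZi n j : measurable_fun setT (Zi n j). Proof. by case: model. Qed.
Let mI n j : measurable_fun setT (I n j). Proof. by case: model => _ []. Qed.
Let Zi01 n j w : 0 <= Zi n j w <= 1. Proof. by case: model => _ [_ []]. Qed.
Let I01 n j w : I n.+1 j w = 0 \/ I n.+1 j w = 1.
Proof. by case: model => _ [_ [_ []]]. Qed.
Let ZiS n j w : Zi n.+1 j w = (1 - r n) * Zi n j w + r n * I n.+1 j w.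
Proof. by case: model => _ [_ [_ [_ []]]]. Qed.

(** The generators of [nat_filt], named apart because [adp] takes a generating family. *)
Definition gen (n : nat) : set (set T) :=
  [set A | exists k (j : 'I_N) (B : set R),
               (k <= n)%N /\ measurable B /\ A = Zi k j @^-1` B].

Lemma gen_meas n A : gen n A -> measurable A.
Proof.
by move=> [k [j [B [_ [mB ->]]]]]; rewrite -[X in measurable X]setTI; exact: mZi.
Qed.

Lemma gen_mono n : gen n `<=` gen n.+1.
Proof.
by move=> A [k [j [B [kn h]]]]; exists k, j, B; split => //; exact: leqW.
Qed.

Local Notation adp := (adp gen).

Lemma Zi_adp k n j : (k <= n)%N -> adp n (Zi k j).
Proof.
move=> kn; apply: (@bmf_le _ _ _ 1); last first.
  by move=> w; have /andP[? ?] := Zi01 k j w; rewrite ger0_norm.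
move=> _ B mB; rewrite setTI; apply: sub_sigma_algebra.
by exists k, j, B.
Qed.

Lemma avg_adp k n : (k <= n)%N -> adp n (avg Zi k).
Proof.
move=> kn; apply: bmfM; first exact: bmf_cst.
by apply: bmf_sum => j; exact: Zi_adp.
Qed.

Let N_neq0 : N%:R != 0 :> R. Proof. by rewrite pnatr_eq0 -lt0n. Qed.

Lemma avg01 n w : 0 <= avg Zi n w <= 1.
Proof.
have N0 : 0 < N%:R :> R by rewrite ltr0n.
rewrite /avg mulr_ge0 ?invr_ge0 ?sumr_ge0//=; last by move=> j _; case/andP: (Zi01 n j w).
rewrite -[leRHS](mulVf N_neq0) ler_wpM2l ?invr_ge0// -[N in leRHS]card_ord -sumr_const.
by apply: ler_sum => j _; case/andP: (Zi01 n j w).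
Qed.

Let p n w (j : 'I_N) := (1 - alpha) * Zi n j w + alpha * avg Zi n w.

Let p01 n w j : 0 <= p n w j <= 1.
Proof.
have /andP[a0 a1] := alpha01; have /andP[z0 z1] := Zi01 n j w.
have /andP[v0 v1] := avg01 n w; rewrite /p.
have a1' : 0 <= 1 - alpha by rewrite subr_ge0.
have := mulr_ge0 a1' z0; have := mulr_ge0 (ltW a0) v0.
have : (1 - alpha) * Zi n j w <= (1 - alpha) * 1 by rewrite ler_wpM2l.
have : alpha * avg Zi n w <= alpha * 1 by rewrite ler_wpM2l// ltW.
by move=> *; apply/andP; split; lra.
Qed.

Let p_adp n j : adp n (fun w => p n w j).
Proof.
apply: bmfD; apply: bmfM; try exact: bmf_cst; first exact: Zi_adp.
exact: avg_adp.
Qed.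

Let Ev n (b : {ffun 'I_N -> bool}) : set T := [set w | forall j, I n.+1 j w = (b j)%:R].

Let mEv n b : measurable (Ev n b).
Proof.
have -> : Ev n b = \big[setI/setT]_(j < N) (I n.+1 j @^-1` [set (b j)%:R]).
  rewrite -bigcap_seq_cond; apply/seteqP; split => w.
    by move=> h j _; exact: h.
  by move=> h j; apply: h => /=; rewrite mem_index_enum.
apply: bigsetI_measurable => j _; rewrite -[X in measurable X]setTI; exact: mI.
Qed.

Let Ib n w : {ffun 'I_N -> bool} := [ffun j => I n.+1 j w == 1].

Let IbE n w j : I n.+1 j w = (Ib n w j)%:R.
Proof.
by rewrite ffunE; case: (I01 n j w) => ->; rewrite ?eqxx// eq_sym oner_eq0.
Qed.

Let EvP n b w : Ev n b w <-> Ib n w = b.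
Proof.
split=> [h|<- j]; last exact: IbE.
apply/ffunP => j; rewrite ffunE h; case: (b j); rewrite ?eqxx// eq_sym.
exact/negbTE/oner_neq0.
Qed.

Let bern_adp n b : adp n (fun w => bern (p n w) b).
Proof.
apply: bmf_prod => j; case: (b j); first exact: p_adp.
by apply: bmfB; [exact: bmf_cst|exact: p_adp].
Qed.

Let cond_pmf n (g : T -> R) (b : {ffun 'I_N -> bool}) : adp n g ->
  Ex P (fun w => g w * \1_(Ev n b) w) = Ex P (fun w => g w * bern (p n w) b).
Proof.
move=> ag; have bb := adp_bmf gen_meas (bern_adp n b).
apply: (@sub_sigma_Ex _ _ _ _ (gen n)) => //.
- exact: gen_meas.
- exact: bmf_indic.
move=> A sA.
have mA : measurable A.
  by apply: smallest_sub sA; [exact: sigma_algebra_measurable|exact: gen_meas].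
have [_ [_ [_ [_ [_ /(_ n A b sA)]]]]] := model => h.
have -> : (fun w => \1_A w * \1_(Ev n b) w) = \1_(A `&` Ev n b) :> (T -> R).
  apply/funext => w; rewrite !indicE in_setI.
  by do 2 case: (_ \in _); rewrite ?mul1r ?mul0r.
rewrite Ex_indic; last by apply: measurableI => //; exact: mEv.
rewrite h /Ex /Rintegral [X in fine X = _]integral_mkcond; congr fine; apply: eq_integral => w _.
rewrite patchE indicE; case: (w \in A); last by rewrite mul0r.
by rewrite mul1r.
Qed.

(** Given the past, only the outcome is random: a function of both is averaged over the outcome with
    the product Bernoulli weights. *)
Let cond_exp n (psi : {ffun 'I_N -> bool} -> T -> R) : (forall b, adp n (psi b)) ->
  Ex P (fun w => psi (Ib n w) w) =
  Ex P (fun w => \sum_(b : {ffun 'I_N -> bool}) bern (p n w) b * psi b w).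
Proof.
move=> apsi.
have bpsi b := adp_bmf gen_meas (apsi b).
have -> : (fun w => psi (Ib n w) w) =
   (fun w => \sum_(b : {ffun 'I_N -> bool}) psi b w * \1_(Ev n b) w).
  apply/funext => w; rewrite (bigD1 (Ib n w))//= big1 ?addr0.
    by rewrite indicE mem_set ?mulr1//; apply/EvP.
  move=> b bI; rewrite indicE memNset ?mulr0// => /EvP h.
  by rewrite h eqxx in bI.
rewrite !Ex_sum.
- by apply: eq_bigr => b _; rewrite cond_pmf//; congr Ex; apply/funext => w; rewrite mulrC.
- by move=> b; apply: bmfM => //; exact: (adp_bmf gen_meas (bern_adp n b)).
- by move=> b; apply: bmfM => //; apply: bmf_indic; exact: mEv.
Qed.

Variable i : 'I_N.

Definition dev (j : 'I_N) n w := Zi n j w - avg Zi n w.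

Lemma dev_le j n w : `|dev j n w| <= 1.
Proof.
have /andP[? ?] := Zi01 n j w; have /andP[? ?] := avg01 n w.
by rewrite ler_norml /dev; apply/andP; split; lra.
Qed.

Lemma dev_adp j k n : (k <= n)%N -> adp n (dev j k).
Proof. by move=> kn; apply: bmfB; [exact: Zi_adp|exact: avg_adp]. Qed.

(* The division makes [xi n] vanish when [r n = 0], where [I n.+1] need not be
   measurable for the filtration. *)
Definition xi n w := (dev i n.+1 w - (1 - alpha * r n) * dev i n w) / r n.

(** Coefficients of the linear form taking a vector to the deviation of its entry [i] from the
    mean. *)
Let coef (j : 'I_N) : R := (j == i)%:R - N%:R^-1.

Let sum_coef (F : 'I_N -> R) : \sum_j coef j * F j = F i - N%:R^-1 * \sum_j F j.
Proof.
under eq_bigr do rewrite mulrBl; rewrite sumrB -mulr_sumr; congr (_ - _).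
by rewrite (bigD1 i)//= eqxx mul1r big1 ?addr0// => j ji; rewrite (negbTE ji) mul0r.
Qed.

(** The probabilities [p n w j] have mean [avg Zi n w] and deviations (1 - alpha) times those of
    Z_n, which explains the contraction factor 1 - alpha r_n: what remains is the deviation of the
    centered outcomes. *)
Let xiE n w : r n != 0 -> xi n w = \sum_j coef j * ((Ib n w j)%:R - p n w j).
Proof.
move=> rn; rewrite sum_coef sumrB.
have -> : \sum_j p n w j = N%:R * avg Zi n w.
  rewrite /p big_split/= -mulr_sumr sumr_const card_ord -[_ *+ N]mulr_natl.
  have -> : \sum_j Zi n j w = N%:R * avg Zi n w by rewrite /avg mulrA divff// mul1r.
  by ring.
have -> : \sum_j (Ib n w j)%:R = \sum_j I n.+1 j w.
  by apply: eq_bigr => j _; rewrite IbE.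
have avgS : avg Zi n.+1 w = (1 - r n) * avg Zi n w + r n * (N%:R^-1 * \sum_j I n.+1 j w).
  rewrite /avg; under eq_bigr do rewrite ZiS.
  by rewrite big_split/= -!mulr_sumr; ring.
rewrite /xi /dev avgS ZiS -IbE /p.
move: (\sum_j I n.+1 j w) (avg Zi n w) => SI av.
by field; rewrite rn N_neq0.
Qed.

(** Conditional variance of [xi n], with the same convention when [r n] is 0. *)
Definition sg n w := if r n == 0 then 0 else \sum_j coef j ^+ 2 * (p n w j * (1 - p n w j)).

Lemma xi_adp n : adp n.+1 (xi n).
Proof.
apply: bmfM; last exact: bmf_cst.
apply: bmfB; first exact: dev_adp.
by apply: bmfM; [exact: bmf_cst|exact: dev_adp].
Qed.

Lemma sg_adp n : adp n (sg n).
Proof.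
rewrite /sg; case: (r n == 0); first exact: bmf_cst.
apply: bmf_sum => j; apply: bmfM; first exact: bmf_cst.
apply: bmfM; first exact: p_adp.
by apply: bmfB; [exact: bmf_cst|exact: p_adp].
Qed.

Lemma devS n w : dev i n.+1 w = (1 - alpha * r n) * dev i n w + r n * xi n w.
Proof.
have [r0|r0] := eqVneq (r n) 0.
  have E j : Zi n.+1 j w = Zi n j w by rewrite ZiS r0 subr0 mul1r mul0r addr0.
  rewrite r0 mul0r addr0 mulr0 subr0 mul1r /dev /avg E.
  by under eq_bigr do rewrite E.
by rewrite /xi [X in _ + X]mulrC divfK// addrC subrK.
Qed.

(** Difference between the deviations of two vectors with entries in [0, 1], each at most 1 in
    absolute value. *)
Lemma xi_le n w : `|xi n w| <= 2.
Proof.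
have [r0|r0] := eqVneq (r n) 0; first by rewrite /xi r0 invr0 mulr0 normr0.
rewrite xiE//.
have -> : \sum_j coef j * ((Ib n w j)%:R - p n w j) =
  \sum_j coef j * (Ib n w j)%:R - \sum_j coef j * p n w j.
  by rewrite -sumrB; apply: eq_bigr => j _; rewrite mulrBr.
have bnd (F : 'I_N -> R) : (forall j, 0 <= F j <= 1) -> `|\sum_j coef j * F j| <= 1.
  move=> F01; rewrite sum_coef.
  have s0 : 0 <= N%:R^-1 * \sum_j F j.
    by rewrite mulr_ge0 ?invr_ge0// sumr_ge0// => j _; case/andP: (F01 j).
  have s1 : N%:R^-1 * \sum_j F j <= 1.
    rewrite -[leRHS](mulVf N_neq0) ler_wpM2l ?invr_ge0// -[N in leRHS]card_ord -sumr_const.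
    by apply: ler_sum => j _; case/andP: (F01 j).
  have /andP[? ?] := F01 i.
  by rewrite ler_norml; apply/andP; split; lra.
have -> : 2 = 1 + 1 :> R by ring.
rewrite (le_trans (ler_normB _ _))// lerD// bnd// => j.
by case: (Ib n w j); rewrite ?lexx ?ler01.
Qed.

Lemma xi_centered n g : adp n g -> Ex P (fun w => g w * xi n w) = 0.
Proof.
move=> ag; have [r0|r0] := eqVneq (r n) 0.
  by rewrite /xi r0 invr0; under eq_fun do rewrite mulr0 mulr0; exact: Ex_cst.
under eq_fun do rewrite xiE//.
pose psi (b : {ffun 'I_N -> bool}) w := g w * \sum_j coef j * ((b j)%:R - p n w j).
rewrite (cond_exp (psi := psi)) => [|b]; last first.
  apply: bmfM => //; apply: bmf_sum => j; apply: bmfM; first exact: bmf_cst.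
  by apply: bmfB; [exact: bmf_cst|exact: p_adp].
rewrite -[RHS](Ex_cst P 0); congr Ex; apply/funext => w.
rewrite /psi.
under eq_bigr do rewrite mulrCA.
rewrite -mulr_sumr; under eq_bigr do rewrite mulr_sumr.
rewrite exchange_big/= big1 ?mulr0// => j _.
under eq_bigr do rewrite mulrCA.
by rewrite -mulr_sumr bern_mean mulr0.
Qed.

Lemma xi_sqr n g : adp n g ->
  Ex P (fun w => g w * xi n w ^+ 2) = Ex P (fun w => g w * sg n w).
Proof.
move=> ag; rewrite /sg; have [r0|r0] := eqVneq (r n) 0.
  by congr Ex; apply/funext => w; rewrite /xi r0 invr0 mulr0 expr0n.
under eq_fun do rewrite xiE//.
pose psi (b : {ffun 'I_N -> bool}) w := g w * (\sum_j coef j * ((b j)%:R - p n w j)) ^+ 2.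
rewrite (cond_exp (psi := psi)) => [|b]; last first.
  apply: bmfM => //; apply: bmfX; apply: bmf_sum => j; apply: bmfM; first exact: bmf_cst.
  by apply: bmfB; [exact: bmf_cst|exact: p_adp].
congr Ex; apply/funext => w; rewrite /psi.
under eq_bigr do rewrite mulrCA.
rewrite -mulr_sumr; congr (_ * _).
transitivity (\sum_(b : {ffun 'I_N -> bool}) \sum_(j < N) \sum_(l < N) coef j * coef l *
  (bern (p n w) b * (((b j)%:R - p n w j) * ((b l)%:R - p n w l)))).
  apply: eq_bigr => b _; rewrite expr2 mulr_suml mulr_sumr; apply: eq_bigr => j _.
  by rewrite !mulr_sumr; apply: eq_bigr => l _; ring.
rewrite exchange_big/=; apply: eq_bigr => j _; rewrite exchange_big/=.
under eq_bigr do rewrite -mulr_sumr bern_cov.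
rewrite (bigD1 j)//= eqxx big1 ?addr0 ?expr2// => l lj.
by rewrite eq_sym (negbTE lj) mulr0.
Qed.

Let coef_le j : coef j ^+ 2 <= 1.
Proof.
have n0 : 0 < N%:R^-1 :> R by rewrite invr_gt0 ltr0n.
have n1 : N%:R^-1 <= 1 :> R by rewrite invf_le1 ?ltr0n// ler1n.
rewrite -[leRHS](expr1n _ 2) -[leLHS]real_normK ?num_real// lerXn2r ?nnegrE//.
by rewrite ler_norml /coef; case: (j == i) => /=; rewrite ?mulr1n ?mulr0n; apply/andP; split; lra.
Qed.

Let sum_coef2 : \sum_j coef j ^+ 2 = 1 - N%:R^-1.
Proof.
under eq_bigr do rewrite expr2.
rewrite sum_coef.
have -> : \sum_j coef j = 0.
  have := sum_coef (fun=> 1); under eq_bigr do rewrite mulr1.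
  by move=> ->; rewrite sumr_const card_ord mulVf// subrr.
by rewrite mulr0 subr0 /coef eqxx.
Qed.

(** Origin of the factor 1 - 1/N: it is the sum of the squared coefficients. Replacing each
    [p n w j] by the mean costs at most the deviation of [j]. *)
Lemma sg_close n w : r n != 0 ->
  `|sg n w - (1 - N%:R^-1) * (avg Zi n w * (1 - avg Zi n w))| <= \sum_j `|dev j n w|.
Proof.
move=> r0; rewrite /sg (negbTE r0) -sum_coef2 mulr_suml -sumrB.
apply: le_trans (ler_norm_sum _ _ _) _; apply: ler_sum => j _.
rewrite -mulrBr normrM ger0_norm ?sqr_ge0// -[leRHS]mul1r ler_pM ?sqr_ge0//.
have /andP[p0 p1] := p01 n w j; have /andP[v0 v1] := avg01 n w.
have /andP[a0 a1] := alpha01.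
have -> : p n w j * (1 - p n w j) - avg Zi n w * (1 - avg Zi n w) =
   (1 - alpha) * (1 - p n w j - avg Zi n w) * dev j n w.
  by rewrite /p /dev; ring.
rewrite normrM -[leRHS]mul1r ler_wpM2r// normrM -[leRHS]mul1r ler_pM//.
  by rewrite ger0_norm ?subr_ge0// gerBl ltW.
by rewrite ler_norml; apply/andP; split; lra.
Qed.

End model.

(** * Central limit theorem for blocks of noise *)

Lemma big_nat_indic (R : realType) (F : nat -> R) (m1 m2 m : nat) : (m1 <= m2 <= m)%N ->
  \sum_(0 <= l < m) (if (m1 <= l < m2)%N then F l else 0) = \sum_(m1 <= l < m2) F l.
Proof.
move=> /andP[h1 h2].
rewrite (@big_cat_nat _ _ _ m1)//=; last exact: leq_trans h2.
rewrite [X in _ + X](@big_cat_nat _ _ _ m2)//=.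
rewrite [X in X + _]big_nat [X in X + _]big1 ?add0r; last first.
  by move=> l /andP[_ lm]; rewrite [(m1 <= l)%N]leqNgt lm.
rewrite [X in _ + X]big_nat [X in _ + X]big1 ?addr0; last first.
  by move=> l /andP[ml _]; rewrite [(l < m2)%N]ltnNge ml andbF.
by rewrite big_nat [RHS]big_nat; apply: eq_bigr => l ->.
Qed.

Lemma expRN_lip (R : realType) (x y : R) : 0 <= x -> 0 <= y ->
  `|expR (- x) - expR (- y)| <= `|x - y|.
Proof.
wlog xy : x y / x <= y.
  move=> h x0 y0; have [/h->//|/ltW yx] := leP x y.
  by rewrite distrC [leRHS]distrC h.
move=> x0 y0; rewrite ger0_norm; last by rewrite subr_ge0 ler_expR lerN2.
rewrite distrC ger0_norm ?subr_ge0//.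
have -> : expR (- y) = expR (- x) * expR (- (y - x)) by rewrite -expRD; congr expR; ring.
rewrite -{1}[expR (- x)]mulr1 -mulrBr -[leRHS]mul1r ler_pM ?expR_ge0//.
- by rewrite subr_ge0 -[leRHS]expR0 ler_expR oppr_le0 subr_ge0.
- by rewrite -[leRHS]expR0 ler_expR oppr_le0.
- have := expR_ge1Dx (- (y - x)); lra.
Qed.

Lemma cos_lip (R : realType) (x y : R) : `|cos x - cos y| <= `|x - y|.
Proof.
have D (z u v : R) : z \in `]u, v[ -> is_derive z 1 cos (- sin z).
  by move=> _; exact: is_derive_cos.
have C (u v : R) : {within `[u, v], continuous (@cos R)}.
  by apply: continuous_subspaceT; exact: continuous_cos.
have [xy|/ltW xy] := leP x y.
  have [z _ zE] := MVT_segment xy (fun z => @D z x y) (C x y).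
  rewrite distrC zE normrM normrN [leRHS]distrC -[leRHS]mul1r ler_wpM2r//.
  exact: sin_max.
have [z _ zE] := MVT_segment xy (fun z => @D z y x) (C y x).
by rewrite zE normrM normrN -[leRHS]mul1r ler_wpM2r// sin_max.
Qed.

(* The truncation keeps the variance nonnegative off the almost sure event
   [0 <= z <= 1]. *)
Definition vquad {R : realType} (z : R) : R := Num.max 0 (z * (1 - z)).

Lemma vquad_ge0 (R : realType) (z : R) : 0 <= vquad z.
Proof. by rewrite /vquad le_max lexx. Qed.

Lemma vquad_le1 (R : realType) (z : R) : vquad z <= 1.
Proof. by rewrite /vquad ge_max ler01/=; have := sqr_ge0 (z - 1/2); rewrite expr2; lra. Qed.

Lemma measurable_vquad (R : realType) : measurable_fun setT (@vquad R).
Proof.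
apply: measurable_maxr => //; apply: measurable_funM => //.
exact: measurable_funB.
Qed.

Section fclt.
Context {R : realType} d (T : measurableType d) (P : probability T R).
Variables (N : nat) (alpha gamma c : R) (r : nat -> R).
Variables (Zi : nat -> 'I_N -> T -> R) (I : nat -> 'I_N -> T -> R) (Z : T -> R).
Hypothesis N_gt0 : (0 < N)%N.
Hypothesis alpha01 : 0 < alpha <= 1.
Hypothesis gamma01 : 0 < gamma <= 1.
Hypothesis c_gt0 : 0 < c.
Hypothesis r01 : forall n, 0 <= r n < 1.
Hypothesis Gr : (fun n => speed gamma n * r n) @ \oo --> c.
Hypothesis rate_gt0 : 0 < 2 * c * alpha - crit gamma.
Hypothesis model : interacting_model P alpha r Zi I.
Hypothesis mZ : measurable_fun setT Z.
Hypothesis aeZ : {ae P, forall w, avg Zi n w @[n --> \oo] --> Z w}.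

Local Notation Pi := (decay alpha r).
Local Notation wt := (weight alpha r).
Local Notation A := (weight_sq alpha r).
Local Notation G := (speed gamma).
Local Notation beta2 := (beta2 alpha gamma r).
Local Notation kappa := (kappa alpha gamma c).
Local Notation adp := (adp (gen Zi)).
Local Notation dev := (dev Zi).

Let gm := gen_meas model.
Let gmono : forall n, gen Zi n `<=` gen Zi n.+1 := @gen_mono _ _ _ _ Zi.

Let bdev j n : bmf (dev j n).
Proof. exact: (adp_bmf gm (dev_adp model j (leqnn n))). Qed.

Let bavg n : bmf (avg Zi n).
Proof. exact: (adp_bmf gm (avg_adp model (leqnn n))). Qed.

Lemma dev_mtr j m w : dev j m w =
  Pi m * (dev j 0%N w + mtr (xi alpha r Zi j) wt (fun _ _ => 1) m w).
Proof.
elim: m => [|m ih]; first by rewrite /mtr big_ord0 addr0 /Pi big_ord0 mul1r.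
rewrite (devS model) ih mtrS PiS /wt PiS.
have := Pi_neq0 alpha01 r01 m => p0.
have := Pi_neq0 alpha01 r01 m.+1; rewrite PiS mulf_eq0 negb_or => /andP[_ f0].
by field; rewrite p0 f0.
Qed.

Let dev2_le j m : Ex P (fun w => dev j m w ^+ 2) <= 2 * Pi m ^+ 2 * (1 + 4 * A m).
Proof.
pose S := mtr (xi alpha r Zi j) wt (fun _ _ => 1) m.
have oadp l : adp l (fun=> 1 : R) by exact: bmf_cst.
have bS : bmf S by exact: (adp_bmf gm (mtr_adp gmono (xi_adp model j) wt m oadp)).
apply: (@le_trans _ _ (Ex P (fun w => 2 * Pi m ^+ 2 * (1 + S w ^+ 2)))).
  apply: Ex_le; first exact: bmfX.
    apply: bmfM; first exact: bmf_cst.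
    by apply: bmfD; [exact: bmf_cst|exact: bmfX].
  move=> w; rewrite dev_mtr -/(S w) exprMn.
  rewrite (_ : 2 * Pi m ^+ 2 * _ = Pi m ^+ 2 * (2 * (1 + S w ^+ 2))); last by ring.
  rewrite ler_wpM2l ?sqr_ge0//.
  have d1 : dev j 0%N w ^+ 2 <= 1.
    rewrite -[leRHS](expr1n _ 2) -[leLHS]real_normK ?num_real// lerXn2r ?nnegrE//.
    exact: (dev_le N_gt0 model).
  have := sqr_ge0 (dev j 0%N w - S w); rewrite !expr2 in d1 *; lra.
rewrite ExZ; last by apply: bmfD; [exact: bmf_cst|exact: bmfX].
apply: ler_wpM2l; first by apply: mulr_ge0 => //; exact: sqr_ge0.
rewrite (@ExD _ _ _ P (fun=> 1) (fun w => S w ^+ 2)); [|exact: bmf_cst|exact: bmfX].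
rewrite Ex_cst lerD2l.
have := @mtr_moment2 _ _ _ P _ gm gmono 2 (xi alpha r Zi j)
  (xi_adp model j) (xi_le N_gt0 alpha01 model j)
  (@xi_centered _ _ _ _ _ _ _ _ _ N_gt0 model j) wt (fun _ _ => 1) oadp _ m.
move=> h; apply: le_trans (h _) _; first by move=> l w; rewrite normr1.
by rewrite /A mulr_sumr; apply: ler_sum => l _; rewrite exprMn -natrX.
Qed.

(** Synchronisation in mean square: the bound of [dev2_le] is of order 1 / G n, since [beta2] and
    [beta2 * A] both converge. *)
Let dev2_cvg0 j : Ex P (fun w => dev j n w ^+ 2) @[n --> \oo] --> (0 : R).
Proof.
apply: (@cvg0_le _ _ (fun n => 2 * (beta2 n + 4 * (beta2 n * A n)) * (G n)^-1)).
  apply: filterS near_oo_gt0 => n n0.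
  rewrite ger0_norm; last by apply: Ex_ge0 => w; exact: sqr_ge0.
  apply: le_trans (dev2_le j n) _; rewrite /beta2.
  have := G_gt0 gamma n0 => /gt_eqF/negbT g0.
  by rewrite le_eqVlt; apply/orP; left; apply/eqP; field.
rewrite -[X in _ --> X](mulr0 (2 * (0 + 4 * kappa))); apply: cvgM; last exact: GV_cvg0.
apply: cvgMr; apply: cvgD; first exact: (beta2_cvg0 gamma01 Gr rate_gt0).
by apply: cvgMr; exact: (beta2A_cvg alpha01 gamma01 r01 Gr rate_gt0).
Qed.

Lemma dev_cvg0 j : Ex P (fun w => `|dev j n w|) @[n --> \oo] --> (0 : R).
Proof.
apply/cvgr0Pnorm_le => e e0.
have e2 : 0 < e / 2 by rewrite divr_gt0.
have e22 : 0 < (e / 2) ^+ 2 by rewrite exprn_gt0.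
have /cvgr0_norm_le/(_ _ e22) := dev2_cvg0 j.
apply: filterS => n hn.
rewrite ger0_norm; last by apply: Ex_ge0 => w.
(* Uses |x| <= a + x^2 / a with a = e / 2. *)
apply: (@le_trans _ _ (Ex P (fun w => e / 2 + (e / 2)^-1 * dev j n w ^+ 2))).
  apply: Ex_le; first exact: bmf_norm.
    by apply: bmfD; [exact: bmf_cst|apply: bmfM; [exact: bmf_cst|exact: bmfX]].
  move=> w; rewrite -(ler_pM2l e2) [leRHS]mulrDr mulVKf ?gt_eqF//.
  have := sqr_ge0 (`|dev j n w| - e / 2); rewrite sqrrB real_normK ?num_real//.
  have := sqr_ge0 (dev j n w); have := sqr_ge0 (e / 2).
  have := mulr_ge0 (normr_ge0 (dev j n w)) (ltW e2); rewrite !expr2; lra.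
rewrite (@ExD _ _ _ P (fun=> e / 2) (fun w => (e / 2)^-1 * dev j n w ^+ 2)); last 2 first.
- exact: bmf_cst.
- by apply: bmfM; [exact: bmf_cst|exact: bmfX].
rewrite Ex_cst ExZ; last exact: bmfX.
have : (e / 2)^-1 * Ex P (fun w => dev j n w ^+ 2) <= e / 2.
  rewrite mulrC ler_pdivrMr// -expr2; exact: le_trans (ler_norm _) hn.
lra.
Qed.

(** [Z] clipped to [0, 1]: almost surely unchanged, and bounded everywhere. *)
Let Zc w := Num.max 0 (Num.min 1 (Z w)).

Let Zc01 w : 0 <= Zc w <= 1.
Proof. by rewrite /Zc le_max lexx/= ge_max ler01 ge_min lexx. Qed.

Let mZc : measurable_fun setT Zc.
Proof. by apply: measurable_maxr => //; exact: measurable_minr. Qed.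

Let bZc : bmf Zc.
Proof. by apply: (@bmf_le _ _ _ 1) => // w; have /andP[? ?] := Zc01 w; rewrite ger0_norm. Qed.

Let vquadZ w : vquad (Z w) = Zc w * (1 - Zc w).
Proof.
rewrite /vquad /Zc; have [z1|z1] := leP 1 (Z w).
  rewrite [Num.max 0 1]max_r// subrr mulr0 max_l//.
  by rewrite -oppr_ge0 -mulrN opprB mulr_ge0 ?subr_ge0// (le_trans ler01).
have [z0|z0] := leP 0 (Z w).
  by rewrite max_r// mulr_ge0// subr_ge0 ltW.
by rewrite mul0r max_l// mulr_le0_ge0// ?subr_ge0 ltW.
Qed.

Lemma avg_cvg : Ex P (fun w => `|avg Zi n w - Zc w|) @[n --> \oo] --> (0 : R).
Proof.
rewrite -[X in _ --> X](Ex_cst P).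
apply: (@Ex_dct _ _ _ _ _ _ 1).
- by move=> n; apply: bmf_meas; apply: bmf_norm; exact: bmfB.
- exact: bmf_cst.
- move=> n w; rewrite normr_id; have /andP[? ?] := Zc01 w.
  have /andP[? ?] := avg01 N_gt0 model n w.
  by rewrite ler_norml; apply/andP; split; lra.
apply: filterS aeZ => w cw.
have Zw : Zc w = Z w.
  have z0 : 0 <= Z w.
    rewrite -(cvg_lim _ cw)//; apply: limr_ge; first exact: cvgP cw.
    by apply: nearW => n; case/andP: (avg01 N_gt0 model n w).
  have z1 : Z w <= 1.
    rewrite -(cvg_lim _ cw)//; apply: limr_le; first exact: cvgP cw.
    by apply: nearW => n; case/andP: (avg01 N_gt0 model n w).
  by rewrite /Zc (min_r z1) (max_r z0).
rewrite -[X in _ --> X](normr0 R); apply: cvg_norm.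
by rewrite Zw; apply/subr_cvg0.
Qed.

Let N1 : 0 <= (1 - N%:R^-1 : R) <= 1.
Proof.
have n0 : 0 < N%:R^-1 :> R by rewrite invr_gt0 ltr0n.
have n1 : N%:R^-1 <= 1 :> R by rewrite invf_le1 ?ltr0n// ler1n.
by apply/andP; split; lra.
Qed.

(** The variance frozen at time [p]: known at that time, it is admissible in the Lindeberg
    exchange. *)
Let sp p w := (1 - N%:R^-1) * (avg Zi p w * (1 - avg Zi p w)).
Definition sinf w := (1 - N%:R^-1) * vquad (Z w).

Let sp_adp p : adp p (sp p).
Proof.
apply: bmfM; first exact: bmf_cst.
have h := avg_adp model (leqnn p).
by apply: bmfM => //; apply: bmfB => //; exact: bmf_cst.
Qed.

Let sp01 p w : 0 <= sp p w <= 1.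
Proof.
have /andP[v0 v1] := avg01 N_gt0 model p w; have /andP[n0 n1] := N1.
have h : 0 <= 1 - avg Zi p w by rewrite subr_ge0.
have h2 : avg Zi p w * (1 - avg Zi p w) <= 1.
  by rewrite -[leRHS]mul1r; apply: ler_pM => //; lra.
have h3 : 0 <= avg Zi p w * (1 - avg Zi p w) by exact: mulr_ge0.
apply/andP; split; first exact: mulr_ge0.
by rewrite /sp -[leRHS](mul1r 1); apply: ler_pM.
Qed.

Let bsp p : bmf (sp p). Proof. exact: (adp_bmf gm (sp_adp p)). Qed.

Let bsinf : bmf sinf.
Proof.
apply: bmfM; first exact: bmf_cst.
apply: (@bmf_le _ _ _ 1); first by apply: measurableT_comp => //; exact: measurable_vquad.
by move=> w; rewrite ger0_norm ?vquad_ge0 ?vquad_le1.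
Qed.

Let quad_lip (a b : R) : 0 <= a <= 1 -> 0 <= b <= 1 ->
  `|(1 - N%:R^-1) * (a * (1 - a)) - (1 - N%:R^-1) * (b * (1 - b))| <= `|a - b|.
Proof.
move=> /andP[? ?] /andP[? ?]; have /andP[n0 n1] := N1.
rewrite -mulrBr normrM (ger0_norm n0) -[leRHS]mul1r ler_pM//.
rewrite (_ : _ - _ = (1 - a - b) * (a - b)); last by ring.
rewrite normrM -[leRHS]mul1r ler_wpM2r// ler_norml; apply/andP; split; lra.
Qed.

Let sp_sinf p w : `|sp p w - sinf w| <= `|avg Zi p w - Zc w|.
Proof. by rewrite /sinf vquadZ; apply: quad_lip => //; exact: (avg01 N_gt0 model). Qed.

Let sg_cvg j (e : R) : 0 < e -> \forall p \near \oo,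
  (forall l, (p <= l)%N -> r l != 0 ->
     Ex P (fun w => `|sg alpha r Zi j l w - sp p w|) <= e) /\
  Ex P (fun w => `|sp p w - sinf w|) <= e.
Proof.
move=> e0; have e3 : 0 < e / 3 by rewrite divr_gt0.
have hd : (fun n => \sum_(k < N) Ex P (fun w => `|dev k n w|)) @ \oo --> (0 : R).
  have := @cvg_bigsum R 'I_N (index_enum _) (fun k n => Ex P (fun w => `|dev k n w|))
    (fun=> 0) dev_cvg0.
  by rewrite big1_eq.
have /cvgr0_norm_le/(_ _ e3)[p1 _ hp1] := hd.
have /cvgr0_norm_le/(_ _ e3)[p2 _ hp2] := avg_cvg.
exists (maxn p1 p2) => // p /=; rewrite geq_max => /andP[p1p p2p].
have bd n : bmf (fun w => `|avg Zi n w - Zc w|) by apply: bmf_norm; exact: bmfB.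
have avp n : (p2 <= n)%N -> Ex P (fun w => `|avg Zi n w - Zc w|) <= e / 3.
  by move=> /hp2; apply: le_trans; exact: ler_norm.
have bsg l : bmf (sg alpha r Zi j l) by exact: (adp_bmf gm (sg_adp model j l)).
split.
  move=> l pl rl.
  have p2l := leq_trans p2p pl; have p1l := leq_trans p1p pl.
  have bD : bmf (fun w => \sum_k `|dev k l w|) by apply: bmf_sum => k; exact: bmf_norm.
  apply: (@le_trans _ _ (Ex P (fun w => \sum_k `|dev k l w| +
     (`|avg Zi l w - Zc w| + `|avg Zi p w - Zc w|)))).
    apply: Ex_le; first by apply: bmf_norm; exact: bmfB.
      by apply: bmfD => //; exact: bmfD.
    move=> w; have h1 := sg_close N_gt0 alpha01 model j w rl.
    have h2 : `|sp l w - sp p w| <= `|avg Zi l w - avg Zi p w|.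
      by apply: quad_lip; exact: (avg01 N_gt0 model).
    have h3 : `|avg Zi l w - avg Zi p w| <= `|avg Zi l w - Zc w| + `|avg Zi p w - Zc w|.
      by rewrite [`|avg Zi p w - Zc w|]distrC; exact: ler_distD.
    rewrite (_ : sg alpha r Zi j l w - sp p w =
       (sg alpha r Zi j l w - sp l w) + (sp l w - sp p w)); last by ring.
    rewrite (le_trans (ler_normD _ _))// lerD//.
    exact: le_trans h2 h3.
  rewrite ExD//; last exact: bmfD.
  rewrite ExD// Ex_sum; last by move=> k; exact: bmf_norm.
  have := avp l p2l; have := avp p p2p.
  have : \sum_k Ex P (fun w => `|dev k l w|) <= e / 3.
    exact: le_trans (ler_norm _) (hp1 l p1l).
  lra.
apply: (@le_trans _ _ (Ex P (fun w => `|avg Zi p w - Zc w|))).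
  by apply: Ex_le => //; apply: bmf_norm; exact: bmfB.
by apply: le_trans (avp p p2p) _; lra.
Qed.

(** * Joint limit of sums over consecutive blocks *)

Section blocks.
Variables (i : 'I_N) (K : nat) (Mb : nat -> nat -> nat) (Q : nat -> R).
Hypothesis Mb0 : forall n, Mb n 0%N = 0%N.
Hypothesis Mb_mono : forall n j k, (j <= k)%N -> (Mb n j <= Mb n k)%N.
Hypothesis Mb_ge : forall n, (n <= Mb n K)%N.
Hypothesis HQ : forall j, (j <= K)%N ->
  (fun n => beta2 n * A (Mb n j)) @ \oo --> kappa * Q j.
Hypothesis small : forall e : R, 0 < e -> exists p, \forall n \near \oo,
  forall l, (p <= l < Mb n K)%N -> beta2 n * wt l ^+ 2 <= e.

Local Notation xi := (xi alpha r Zi i).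
Let bt n : R := Num.sqrt (beta2 n).

Definition inc n j w := bt n * \sum_(Mb n j <= l < Mb n j.+1) wt l * xi l w.

Let bxi l : bmf (xi l). Proof. exact: (adp_bmf gm (xi_adp model i l)). Qed.

Lemma bmf_inc n j : bmf (inc n j).
Proof.
apply: bmfM; first exact: bmf_cst.
by apply: bmf_sum => l; apply: bmfM; [exact: bmf_cst|exact: bxi].
Qed.

Let bt2 n : bt n ^+ 2 = beta2 n.
Proof. by rewrite /bt sqr_sqrtr// beta2_ge0. Qed.

Let AB (m1 m2 : nat) : (m1 <= m2)%N -> \sum_(m1 <= l < m2) wt l ^+ 2 = A m2 - A m1.
Proof.
move=> m12; rewrite /A -!(big_mkord predT (fun l => wt l ^+ 2)).
by rewrite [X in _ = X - _](@big_cat_nat _ _ _ m1)//= [X in _ = X - _]addrC addrK.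
Qed.

Lemma inc_moment2 n j : Ex P (fun w => inc n j w ^+ 2) <=
  4 * (beta2 n * (A (Mb n j.+1) - A (Mb n j))).
Proof.
have oadp l : adp l (fun=> 1 : R) by exact: bmf_cst.
pose a l := if (Mb n j <= l < Mb n j.+1)%N then wt l else 0.
have incE w : inc n j w = bt n * mtr xi a (fun _ _ => 1) (Mb n j.+1) w.
  rewrite /inc /mtr -(big_mkord predT (fun l => a l * 1 * xi l w)).
  rewrite -(@big_nat_indic _ _ _ _ (Mb n j.+1)); last by rewrite leqnn Mb_mono.
  congr (_ * _); apply: eq_bigr => l _; rewrite /a mulr1; case: ifP => //.
  by rewrite mul0r.
under eq_fun do rewrite incE exprMn bt2.
have bS : bmf (mtr xi a (fun _ _ => 1) (Mb n j.+1)).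
  exact: (adp_bmf gm (mtr_adp gmono (xi_adp model i) _ _ oadp)).
rewrite ExZ; last exact: bmfX.
rewrite mulrCA ler_wpM2l ?beta2_ge0//.
have h := @mtr_moment2 _ _ _ P _ gm gmono 2 xi
  (xi_adp model i) (xi_le N_gt0 alpha01 model i)
  (@xi_centered _ _ _ _ _ _ _ _ _ N_gt0 model i) a (fun _ _ => 1) oadp _ (Mb n j.+1).
apply: le_trans (h _) _; first by move=> l w; rewrite normr1.
rewrite -AB ?Mb_mono// mulr_sumr -(big_mkord predT (fun l => (2 * a l) ^+ 2)).
rewrite -[leRHS](@big_nat_indic _ _ _ _ (Mb n j.+1)); last by rewrite leqnn Mb_mono.
apply: ler_sum => l _; rewrite /a; case: ifP => _; last by rewrite mulr0 expr0n.
by rewrite exprMn -natrX.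
Qed.

Section characteristic.
Variables (lam : nat -> R) (th : R).

Let on n j l := (Mb n j <= l < Mb n j.+1)%N.
(** The coefficient of the block containing [l]. A linear combination of block sums thus becomes a
    single noise sum with weights [b], within the scope of [lindeberg]. *)
Let Lam n l := \sum_(0 <= j < K) (if on n j l then lam j else 0).
Let SL := \sum_(0 <= j < K) `|lam j|.
Let b n l := bt n * wt l * Lam n l.

Let SL_ge0 : 0 <= SL. Proof. by apply: sumr_ge0. Qed.

Let Lam_le n l : `|Lam n l| <= SL.
Proof.
apply: le_trans (ler_norm_sum _ _ _) _; apply: ler_sum => j _.
by case: ifP => //; rewrite normr0.
Qed.

Let Lam2 n l : Lam n l ^+ 2 = \sum_(0 <= j < K) (if on n j l then lam j ^+ 2 else 0).
Proof.
rewrite expr2 /Lam !big_mkord mulr_suml; apply: eq_bigr => j _.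
rewrite mulr_sumr (bigD1 j)//= big1 ?addr0.
  by case: ifP => _; rewrite ?mulr0// expr2.
move=> k kj; case: ifP => [jl|_]; last by rewrite mul0r.
case: ifP => [kl|_]; last by rewrite mulr0.
exfalso; move/eqP: kj; apply; apply: val_inj => /=.
have /andP[j1 j2] := jl; have /andP[k1 k2] := kl.
have [jk|kj|//] := ltngtP k j.
- have := Mb_mono n jk => h; by rewrite leqNgt (leq_trans k2 h) in j1.
- have := Mb_mono n kj => h; by rewrite leqNgt (leq_trans j2 h) in k1.
Qed.

Let sum_inc n w : \sum_(0 <= j < K) lam j * inc n j w =
  \sum_(0 <= l < Mb n K) b n l * xi l w.
Proof.
transitivity (\sum_(0 <= l < Mb n K) \sum_(0 <= j < K)
    (if on n j l then lam j * bt n * (wt l * xi l w) else 0)); last first.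
  apply: eq_bigr => l _; rewrite /b /Lam mulr_sumr mulr_suml.
  by apply: eq_bigr => j _; case: ifP => _; ring.
rewrite exchange_big/= !big_mkord; apply: eq_bigr => j _.
rewrite big_nat_indic; last by rewrite !Mb_mono.
by rewrite /inc -mulr_sumr mulrA.
Qed.

Let sum_b2 n : \sum_(0 <= l < Mb n K) b n l ^+ 2 =
  \sum_(0 <= j < K) lam j ^+ 2 * (beta2 n * A (Mb n j.+1) - beta2 n * A (Mb n j)).
Proof.
transitivity (\sum_(0 <= l < Mb n K) \sum_(0 <= j < K)
    (if on n j l then lam j ^+ 2 * beta2 n * wt l ^+ 2 else 0)).
  apply: eq_bigr => l _; rewrite /b !exprMn bt2 Lam2 mulr_sumr.
  by apply: eq_bigr => j _; case: ifP => _; ring.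
rewrite exchange_big/= !big_mkord; apply: eq_bigr => j _.
rewrite big_nat_indic; last by rewrite !Mb_mono.
by rewrite -mulr_sumr AB ?Mb_mono//; ring.
Qed.

Let Vinf := \sum_(0 <= j < K) lam j ^+ 2 * (kappa * Q j.+1 - kappa * Q j).

Let V_cvg : (fun n => \sum_(0 <= l < Mb n K) b n l ^+ 2) @ \oo --> Vinf.
Proof.
rewrite /Vinf big_mkord; under eq_fun do rewrite sum_b2 big_mkord.
apply: cvg_bigsum => j; apply: cvgMr; apply: cvgB; apply: HQ => //.
exact: ltnW.
Qed.

Let Vinf_ge0 : 0 <= Vinf.
Proof.
rewrite -(cvg_lim _ V_cvg)//; apply: limr_ge; first exact: cvgP V_cvg.
by apply: nearW => n; apply: sumr_ge0 => l _; exact: sqr_ge0.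
Qed.

Let bt_cvg0 : bt @ \oo --> (0 : R).
Proof.
rewrite -[X in _ --> X](sqrtr0 R); apply: continuous_cvg; first exact: sqrt_continuous.
exact: (beta2_cvg0 gamma01 Gr rate_gt0).
Qed.

(** The noise before the freezing time [p] is a fixed number of bounded terms multiplied by [bt n],
    which tends to 0. *)
Let head_cvg0 p : (fun n => \sum_(0 <= l < p) `|b n l|) @ \oo --> (0 : R).
Proof.
apply: (@cvg0_le _ _ (fun n => (SL * \sum_(0 <= l < p) `|wt l|) * bt n)); last first.
  rewrite -[X in _ --> X](mulr0 (SL * \sum_(0 <= l < p) `|wt l|)).
  by apply: cvgMr; exact: bt_cvg0.
apply: nearW => n; rewrite ger0_norm; last by apply: sumr_ge0.
rewrite [leRHS]mulrAC mulr_sumr; apply: ler_sum => l _.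
have bt0 : 0 <= bt n by exact: sqrtr_ge0.
rewrite /b normrM [`|bt n * wt l|]normrM (ger0_norm bt0) [leLHS]mulrC mulrA ler_wpM2r//.
by rewrite ler_wpM2r.
Qed.

(* The conditional variances are frozen at a time [p], sent to infinity after [n]. *)
Lemma block_cos :
  Ex P (fun w => cos (\sum_(0 <= j < K) lam j * inc n j w + th)) @[n --> \oo] -->
  Ex P (fun w => cos th * expR (- (sinf w * Vinf) / 2)).
Proof.
apply/cvgrPdist_le => /= e e0.
have V1 : 0 < Vinf + 1 by rewrite ltr_wpDl.
pose d1 := e / 5 / (Vinf + 1).
have d1_gt0 : 0 < d1 by rewrite !divr_gt0.
(* 25 = 2^3 + 2^4 + 1 is the constant of the Lindeberg bound for noise bounded by 2. *)
pose d2 := Num.min 1 (e / 5 / (25 * (Vinf + 1))).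
have d2_gt0 : 0 < d2.
  by rewrite /d2 lt_min ltr01/= !divr_gt0// mulr_gt0.
have d21 : d2 <= 1 by rewrite /d2 ge_min lexx.
have d2e : d2 <= e / 5 / (25 * (Vinf + 1)) by rewrite /d2 ge_min lexx orbT.
(* As [Lam] is bounded by [SL], this makes the weights [b n l] at most [d2] past the freezing
   time. *)
pose eta := d2 ^+ 2 / (SL ^+ 2 + 1).
have SL2 : 0 < SL ^+ 2 + 1 by rewrite ltr_wpDl// sqr_ge0.
have eta_gt0 : 0 < eta by rewrite divr_gt0// exprn_gt0.
have [p0 hp0] := small eta_gt0.
have [p1 _ hp1] := sg_cvg i d1_gt0.
pose p := maxn p0 p1.
have [hsg hsp] := hp1 p (leq_maxr _ _).
have e5 : 0 < e / 5 by rewrite divr_gt0.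
have e10 : 0 < e / 10 by rewrite divr_gt0.
have h1_gt0 : 0 < Num.min 1 (e / 10) by rewrite lt_min ltr01.
have /cvgr0_norm_le/(_ _ h1_gt0) hh := head_cvg0 p.
have /cvgrPdist_le/(_ _ h1_gt0) hv := V_cvg.
near=> n.
have pM : (p <= Mb n K)%N by rewrite (leq_trans _ (Mb_ge n))//; near: n; exists p.
have hsm : forall l, (p0 <= l < Mb n K)%N -> beta2 n * wt l ^+ 2 <= eta by near: n.
have hhn : \sum_(0 <= l < p) `|b n l| <= Num.min 1 (e / 10).
  by apply: le_trans (ler_norm _) _; near: n.
have hvn : `|Vinf - \sum_(0 <= l < Mb n K) b n l ^+ 2| <= Num.min 1 (e / 10) by near: n.
have hh1 : \sum_(0 <= l < p) `|b n l| <= 1 by apply: le_trans hhn _; rewrite ge_min lexx.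
have hh2 : \sum_(0 <= l < p) `|b n l| <= e / 10.
  by apply: le_trans hhn _; rewrite ge_min lexx orbT.
have hv1 : `|Vinf - \sum_(0 <= l < Mb n K) b n l ^+ 2| <= 1.
  by apply: le_trans hvn _; rewrite ge_min lexx.
have hv2 : `|Vinf - \sum_(0 <= l < Mb n K) b n l ^+ 2| <= e / 10.
  by apply: le_trans hvn _; rewrite ge_min lexx orbT.
pose Vp := \sum_(p <= l < Mb n K) b n l ^+ 2.
pose Vh := \sum_(0 <= l < p) b n l ^+ 2.
have VE : \sum_(0 <= l < Mb n K) b n l ^+ 2 = Vh + Vp by rewrite (@big_cat_nat _ _ _ p).
have Vp0 : 0 <= Vp by apply: sumr_ge0 => l _; exact: sqr_ge0.
have Vh0 : 0 <= Vh by apply: sumr_ge0 => l _; exact: sqr_ge0.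
have Vhe : Vh <= e / 10.
  apply: le_trans hh2; rewrite /Vh !big_mkord; apply: ler_sum => l _.
  rewrite -[leLHS]real_normK ?num_real// expr2 -[leRHS]mulr1 ler_wpM2l//.
  apply: le_trans hh1; rewrite big_mkord (bigD1 l)//= lerDl.
  by apply: sumr_ge0.
have bd l : (p <= l < Mb n K)%N -> `|b n l| <= d2.
  move=> /andP[pl lM].
  have h := hsm l; rewrite lM andbT in h.
  have {}h := h (leq_trans (leq_maxl _ _) pl).
  rewrite -(@ler_pXn2r _ 2)// ?nnegrE ?(ltW d2_gt0)// real_normK ?num_real//.
  rewrite /b exprMn [(bt n * wt l) ^+ 2]exprMn bt2.
  have L2 : Lam n l ^+ 2 <= SL ^+ 2.
    by rewrite -[leLHS]real_normK ?num_real// lerXn2r ?nnegrE// Lam_le.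
  apply: (@le_trans _ _ (eta * SL ^+ 2)).
    apply: ler_pM => //; last exact: sqr_ge0.
    by apply: mulr_ge0; [exact: beta2_ge0|exact: sqr_ge0].
  rewrite /eta mulrAC ler_pdivrMr// ler_wpM2l ?sqr_ge0//.
  by rewrite lerDl.
(* [lindeberg] asks for weights bounded by 1 at every index, which [b n] satisfies only in this
   range. *)
pose b' l := if (p <= l < Mb n K)%N then b n l else 0.
have b'E l : (p <= l < Mb n K)%N -> b' l = b n l by rewrite /b' => ->.
have b'1 l : `|b' l| <= 1.
  rewrite /b'; case: ifP => [h|_]; last by rewrite normr0.
  exact: le_trans (bd l h) d21.
have lin := lindeberg gm gmono (ler0n R 2) (xi_adp model i) (xi_le N_gt0 alpha01 model i)
  (@xi_centered _ _ _ _ _ _ _ _ _ N_gt0 model i) (sg_adp model i)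
  (@xi_sqr _ _ _ _ _ _ _ _ _ N_gt0 model i) th b'1 (sp_adp p) (sp01 p) pM.
have S'E w : \sum_(p <= l < Mb n K) b' l * xi l w = \sum_(p <= l < Mb n K) b n l * xi l w.
  by apply: eq_big_nat => l h; rewrite b'E.
have V'E : \sum_(p <= l < Mb n K) b' l ^+ 2 = Vp.
  by apply: eq_big_nat => l h; rewrite b'E.
have E1 : Ex P (fun w => cos (\sum_(p <= l < Mb n K) b' l * xi l w + th)) =
    Ex P (fun w => cos (\sum_(p <= l < Mb n K) b n l * xi l w + th)).
  by congr Ex; apply/funext => w; rewrite S'E.
rewrite E1 V'E in lin.
have errs : \sum_(p <= l < Mb n K) (b' l ^+ 2 / 2 *
     Ex P (fun w => `|sg alpha r Zi i l w - sp p w|) + (2 ^+ 3 + 2 ^+ 4 + 1) * `|b' l| ^+ 3)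
   <= (Vinf + 1) * (d1 / 2 + 25 * d2).
  apply: (@le_trans _ _ (Vp * (d1 / 2 + 25 * d2))).
    rewrite /Vp mulr_suml big_nat [leRHS]big_nat; apply: ler_sum => l h.
    (* When [r l] is 0, [sg] is 0 by convention and need not be near [sp p], but the weight vanishes
       too. *)
    rewrite b'E//; have [r0|r0] := eqVneq (r l) 0.
      have -> : b n l = 0 by rewrite /b /wt r0 mul0r mulr0 mul0r.
      by rewrite normr0 !expr0n/= !mul0r mulr0 addr0.
    rewrite mulrDr; apply: lerD.
      rewrite -mulrA [2^-1 * _]mulrC ler_wpM2l ?sqr_ge0// ler_wpM2r ?invr_ge0//.
      by apply: hsg => //; case/andP: h.
    rewrite [`|b n l| ^+ 3]exprSr real_normK ?num_real// [leLHS]mulrCA ler_wpM2l ?sqr_ge0//.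
    rewrite (_ : 2 ^+ 3 + 2 ^+ 4 + 1 = 25 :> R); last by ring.
    by rewrite ler_wpM2l// bd.
  have dd : 0 <= d1 / 2 + 25 * d2 by move: d1_gt0 d2_gt0; lra.
  rewrite ler_wpM2r//.
  by move: hv1; rewrite VE ler_norml; lra.
have q1 : (Vinf + 1) * (d1 / 2 + 25 * d2) <= e / 10 + e / 5.
  rewrite mulrDr; apply: lerD.
    by rewrite /d1 [_ / 2]mulrAC mulrC divfK ?gt_eqF//; lra.
  rewrite mulrCA mulrA mulrC -ler_pdivlMr//; last by rewrite mulr_gt0.
have k1 : `|Ex P (fun w => cos (\sum_(0 <= j < K) lam j * inc n j w + th)) -
   Ex P (fun w => cos (\sum_(p <= l < Mb n K) b n l * xi l w + th))| <= e / 5.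
  have ms m1 m2 : measurable_fun setT (fun w => \sum_(m1 <= l < m2) b n l * xi l w).
    apply: bmf_meas; apply: bmf_sum => l; apply: bmfM; first exact: bmf_cst.
    exact: bxi.
  under [X in Ex _ X - _]eq_fun do rewrite sum_inc.
  apply: Ex_dist_le; [by apply: bmf_cos; exact: measurable_funD|by apply: bmf_cos; exact: measurable_funD|].
  move=> w; apply: le_trans (cos_lip _ _) _.
  rewrite [X in X + th - _](@big_cat_nat _ _ _ p)//=.
  rewrite (_ : _ - _ = \sum_(0 <= l < p) b n l * xi l w); last by ring.
  apply: (@le_trans _ _ (\sum_(0 <= l < p) `|b n l| * 2)).
    apply: le_trans (ler_norm_sum _ _ _) _; apply: ler_sum => l _.
    by rewrite normrM ler_wpM2l// (xi_le N_gt0 alpha01 model).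
  by rewrite -mulr_suml; lra.
have bex (s : T -> R) (v : R) : bmf s -> (forall w, 0 <= s w) -> 0 <= v ->
    bmf (fun w => cos th * expR (- (s w * v / 2))).
  move=> bs s0 v0; apply: bmfM; first exact: bmf_cst.
  apply: bmf_expRN; last by move=> w; rewrite oppr_le0 divr_ge0// mulr_ge0.
  apply: bmf_meas; apply: bmfN; apply: bmfM; last exact: bmf_cst.
  by apply: bmfM => //; exact: bmf_cst.
have sinf0 w : 0 <= sinf w.
  by rewrite /sinf mulr_ge0 ?vquad_ge0//; case/andP: N1.
have sinf1 w : sinf w <= 1.
  rewrite /sinf -[leRHS](mul1r 1) ler_pM ?vquad_ge0 ?vquad_le1//; by case/andP: N1.
have sp0 w : 0 <= sp p w by case/andP: (sp01 p w).
have k3 : `|Ex P (fun w => cos th * expR (- (sp p w * Vp / 2))) -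
    Ex P (fun w => cos th * expR (- (sinf w * Vinf / 2)))| <= e / 5 + e / 10.
  have b1 := bex _ _ (bsp p) sp0 Vp0.
  have b2 := bex _ _ bsinf sinf0 Vinf_ge0.
  rewrite -ExB// (le_trans (Ex_norm _ (bmfB b1 b2)))//.
  have bd' : bmf (fun w => `|sp p w - sinf w|) by apply: bmf_norm; exact: bmfB.
  apply: (@le_trans _ _ (Ex P (fun w => Vinf / 2 * `|sp p w - sinf w| + e / 10))).
    apply: Ex_le; first by apply: bmf_norm; exact: bmfB.
      apply: bmfD; last exact: bmf_cst.
      by apply: bmfM => //; exact: bmf_cst.
    move=> w; rewrite -mulrBr normrM.
    apply: (@le_trans _ _ (1 * `|sp p w * Vp / 2 - sinf w * Vinf / 2|)).
      apply: ler_pM => //; first exact: cos_max.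
      by apply: expRN_lip; rewrite divr_ge0// mulr_ge0.
    rewrite mul1r (_ : _ - _ = Vinf / 2 * (sp p w - sinf w) + (sp p w * (Vp - Vinf)) / 2); last by ring.
    apply: le_trans (ler_normD _ _) _; apply: lerD.
      by rewrite normrM ger0_norm// divr_ge0.
    have VpV : `|Vp - Vinf| <= e / 5.
      by move: hv2; rewrite VE !ler_norml; lra.
    rewrite normrM [`|2^-1|]ger0_norm// normrM (ger0_norm (sp0 w)).
    have : sp p w * `|Vp - Vinf| <= 1 * (e / 5).
      by apply: ler_pM => //; case/andP: (sp01 p w).
    lra.
  rewrite (@ExD _ _ _ P (fun w => Vinf / 2 * `|sp p w - sinf w|) (fun=> e / 10)); last 2 first.
  - by apply: bmfM => //; exact: bmf_cst.
  - exact: bmf_cst.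
  rewrite Ex_cst ExZ// lerD2r.
  apply: (@le_trans _ _ ((Vinf + 1) * d1)); last by rewrite /d1 mulrC divfK ?gt_eqF.
  apply: ler_pM => //; first by rewrite divr_ge0.
  - by apply: Ex_ge0.
  - by have := Vinf_ge0; lra.
have -> : Ex P (fun w => cos th * expR (- (sinf w * Vinf) / 2)) =
   Ex P (fun w => cos th * expR (- (sinf w * Vinf / 2))).
  by congr Ex; apply/funext => w; rewrite mulNr.
move: lin errs q1 k1 k3; rewrite !ler_norml.
set t1 := Ex P _; set t2 := Ex P _; set t3 := Ex P _; set t4 := Ex P _.
lra.
Unshelve. all: by end_near. Qed.

End characteristic.
End blocks.

End fclt.

(** * Paths and the limit clock *)

Section paths.
Context {R : realType}.
Implicit Types x y : R -> R.

Lemma cadlag_ext x y : cadlag x -> (forall t, 0 <= t -> y t = x t) -> cadlag y.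
Proof.
move=> cx xy t t0; have [cr cl] := cx t t0; split.
  rewrite xy//; apply: cvg_trans cr; apply: near_eq_cvg.
  near=> s; rewrite xy//; apply: (le_trans t0); apply/ltW; near: s; exact: nbhs_right_gt.
move=> t_gt0; have /cvg_ex[l hl] := cl t_gt0; apply/cvg_ex; exists l.
apply: cvg_trans hl; apply: near_eq_cvg.
near=> s; rewrite xy//; apply/ltW; near: s; exact: nbhs_left_gt.
Unshelve. all: by end_near. Qed.

Lemma cadlag_continuous x : (forall t, 0 <= t -> {for t, continuous x}) -> cadlag x.
Proof.
move=> cx t t0; split; first by apply: cvg_at_right_filter; exact: cx.
by move=> _; apply/cvg_ex; exists (x t); apply: cvg_at_left_filter; exact: cx.
Qed.

Lemma cadlag_step (f : R -> R) (h : nat -> R) (a b : R) : 0 <= a -> 0 < b ->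
  (forall t, 0 <= t -> {for t, continuous f}) ->
  cadlag (fun t => f t * h (Num.truncn (a + b * t))).
Proof.
move=> a0 b0 cf t t0.
have abt0 : 0 <= a + b * t by rewrite addr_ge0// mulr_ge0// ltW.
set k := Num.truncn (a + b * t).
have /andP[k1 k2] := truncn_itv abt0; rewrite -/k in k1 k2.
have lim_h j : f s * h j @[s --> t] --> f t * h j.
  by apply: cvgM; [exact: cf|exact: cvg_cst].
split.
  apply: cvg_trans (cvg_at_right_filter (lim_h k)); apply: near_eq_cvg.
  have d0 : t < t + (k.+1%:R - (a + b * t)) / b by rewrite ltrDl divr_gt0// subr_gt0.
  near=> s; congr (_ * h _); apply/esym; apply: truncn_def.
  have ts : t < s by near: s; exact: nbhs_right_gt.
  have sd : s < t + (k.+1%:R - (a + b * t)) / b by near: s; exact: nbhs_right_lt.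
  have bts : b * t < b * s by rewrite ltr_pM2l.
  have : b * s < b * (t + (k.+1%:R - (a + b * t)) / b) by rewrite ltr_pM2l.
  rewrite mulrDr [b * (_ / b)]mulrC divfK ?gt_eqF// => h1.
  by apply/andP; split; lra.
move=> t_gt0; have [kt|kt] := ltP k%:R (a + b * t).
  apply/cvg_ex; exists (f t * h k).
  apply: cvg_trans (cvg_at_left_filter (lim_h k)); apply: near_eq_cvg.
  have d0 : t - (a + b * t - k%:R) / b < t by rewrite ltrBlDr ltrDl divr_gt0// subr_gt0.
  near=> s; congr (_ * h _); apply/esym; apply: truncn_def.
  have ts : s < t by near: s; exact: nbhs_left_lt.
  have sd : t - (a + b * t - k%:R) / b < s by near: s; exact: nbhs_left_gt.
  have bts : b * s < b * t by rewrite ltr_pM2l.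
  have : b * (t - (a + b * t - k%:R) / b) < b * s by rewrite ltr_pM2l.
  rewrite mulrBr [b * (_ / b)]mulrC divfK ?gt_eqF// => h1.
  by apply/andP; split; lra.
(* At a jump the left limit reads the index k - 1, and k > 0 because t > 0. *)
have kE : a + b * t = k%:R by apply/eqP; rewrite eq_le kt k1.
have k0 : (0 < k)%N.
  by rewrite -(ltr0n R) -kE ltr_wpDl// mulr_gt0.
apply/cvg_ex; exists (f t * h k.-1).
apply: cvg_trans (cvg_at_left_filter (lim_h k.-1)); apply: near_eq_cvg.
have d0 : t - b^-1 < t by rewrite ltrBlDr ltrDl invr_gt0.
near=> s; congr (_ * h _); apply/esym; apply: truncn_def.
have ts : s < t by near: s; exact: nbhs_left_lt.
have sd : t - b^-1 < s by near: s; exact: nbhs_left_gt.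
have bts : b * s < b * t by rewrite ltr_pM2l.
have : b * (t - b^-1) < b * s by rewrite ltr_pM2l.
rewrite mulrBr divff ?gt_eqF// prednK// => h1.
have : k%:R = k.-1%:R + 1 :> R by rewrite natr1 prednK.
by move=> h2; apply/andP; split; lra.
Unshelve. all: by end_near. Qed.

(** Uniform continuity by extraction: offending times accumulate at some t >= 0, and so do their
    grid points, since the mesh vanishes. *)
Lemma unif_grid x (j : nat) (e : R) : (forall t, 0 <= t -> {for t, continuous x}) ->
  0 < e -> \forall k \near \oo, forall t, 0 <= t <= j%:R ->
  `|x t - x (grid k (gidx k t))| <= e.
Proof.
move=> cx e0; apply: contrapT => nh.
have h n : exists kt : nat * R, [/\ (n <= kt.1)%N, 0 <= kt.2 <= j%:R &
    ~ (`|x kt.2 - x (grid kt.1 (gidx kt.1 kt.2))| <= e)].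
  apply: contrapT => nn; apply: nh; exists n => // k /= nk t tj.
  by apply: contrapT => ne; apply: nn; exists (k, t).
pose kt n := projT1 (cid (h n)).
have ktP n := projT2 (cid (h n)); rewrite -/(kt _) in ktP.
pose u n := (kt n).2.
have bu : bounded_fun u.
  exists j%:R; split; first exact: num_real.
  move=> y jy n _ /=; have [_ /andP[t0 tj] _] := ktP n.
  by rewrite ger0_norm// (le_trans tj)// ltW.
have [f fi cu] := bolzano_weierstrass bu.
have /cvg_ex[t cut] := cu.
have t0 : 0 <= t.
  rewrite -(cvg_lim _ cut)//; apply: limr_ge; first exact: cvgP cut.
  by apply: nearW => n /=; have [_ /andP[]] := ktP (f n).
pose v n : R := grid (kt (f n)).1 (gidx (kt (f n)).1 (u (f n))).
have fn n : (n <= f n)%N.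
  elim: n => // n ih; apply: (leq_ltn_trans ih).
  by have := fi n.+1 n; rewrite leEnat ltnn => /negbT; rewrite -ltnNge.
have vt : v @ \oo --> t.
  have -> : v = fun n => (u \o f) n - ((u \o f) n - v n).
    by apply/funext => n; rewrite opprB addrC subrK.
  rewrite -[t]subr0; apply: cvgB => //.
  apply: (@cvg0_le _ _ harmonic); last exact: cvg_harmonic.
  apply: nearW => n.
  have [nk /andP[u0 _] _] := ktP (f n).
  have /andP[g1 g2] := gidx_itv (kt (f n)).1 u0.
  rewrite ger0_norm ?subr_ge0//= /v /harmonic/=.
  apply: (@le_trans _ _ ((kt (f n)).1.+1%:R^-1)).
    have : grid (kt (f n)).1 (gidx (kt (f n)).1 (u (f n))).+1 =
       grid (kt (f n)).1 (gidx (kt (f n)).1 (u (f n))) + (kt (f n)).1.+1%:R^-1 :> R.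
      by rewrite /grid -natr1 mulrDl mul1r.
    by move=> E; rewrite -/(u (f n)) E in g2; rewrite lerBlDr addrC ltW.
  by rewrite lef_pV2 ?posrE// ler_nat ltnS (leq_trans (fn n)).
have l1 : x ((u \o f) n) @[n --> \oo] --> x t by apply: cvg_comp cut _; exact: cx.
have l2 : x (v n) @[n --> \oo] --> x t by apply: cvg_comp vt _; exact: cx.
have : x ((u \o f) n) - x (v n) @[n --> \oo] --> (0 : R).
  by rewrite -(subrr (x t)); exact: cvgB.
move=> /cvgr0_norm_le/(_ _ e0)[n _ /(_ n (leqnn n)) hn].
by have [_ _] := ktP (f n); apply.
Unshelve. all: by end_near. Qed.

(** Paths are functions on the whole line, but negative times do not matter: the constant sequence
    [y] converges to [x]. *)
Lemma skorohod_ext (F : (R -> R) -> R) x y : skorohod_continuous F ->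
  cadlag x -> cadlag y -> (forall t, 0 <= t -> y t = x t) -> F y = F x.
Proof.
move=> Fc cx cy xy.
have sc : skorohod_cvg (fun=> y) x.
  exists (fun=> id); split; first by move=> n; exact: time_change_id.
  split; first by move=> e' e'0; apply: nearW => n t _; rewrite subrr normr0 ltW.
  move=> m e e0; apply: nearW => n t /andP[t0 _].
  by rewrite xy// subrr normr0 ltW.
have := Fc (fun=> y) x (fun=> cy) cx sc => h.
have h' : (fun n : nat => F y) @ \oo --> F y by exact: cvg_cst.
exact: (cvg_unique _ h' h).
Qed.

End paths.

(** * Regularity of the limit clock *)

Section limit_clock.
Context {R : realType}.
Variables (alpha gamma c : R).
Hypothesis alpha01 : 0 < alpha <= 1.
Hypothesis c_gt0 : 0 < c.
Hypothesis rate_gt0 : 0 < 2 * c * alpha - crit gamma.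

Local Notation tau := (tau gamma).
Local Notation phi := (phi alpha gamma c).
Local Notation qq := (clock alpha gamma c).
Let rate := 2 * c * alpha - crit gamma.

Lemma tau_continuous t : 0 <= t -> {for t, continuous tau}.
Proof.
move=> t0; rewrite /tau; case: (gamma == 1); last exact: cvg_id.
have t1 : 0 < 1 + t by rewrite ltr_pwDl.
apply: (@continuous_comp _ _ _ (fun t : R => 1 + t) (@ln R)); last exact: continuous_ln.
by apply: cvgD; [exact: cvg_cst|exact: cvg_id].
Qed.

Lemma phi_continuous t : 0 <= t -> {for t, continuous phi}.
Proof.
move=> t0.
apply: (@continuous_comp _ _ _ (fun t : R => c * alpha * tau t) (@expR R)).
  by apply: cvgM; [exact: cvg_cst|exact: tau_continuous].
exact: continuous_expR.
Qed.

(** For gamma = 1 the factor 1 / (1 + t) is exp(- tau t). Both regimes then share one exponential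
    form, from which monotonicity and the Lipschitz bound follow. *)
Lemma qqE t : 0 <= t -> qq t = expR (rate * tau t).
Proof.
move=> t0; rewrite /qq /phi expr2 -expRD /rate /crit /tau.
case: eqVneq => _.
  have t1 : 0 < 1 + t by rewrite ltr_pwDl.
  have -> : (1 + t)^-1 = expR (- ln (1 + t)) by rewrite expRN lnK ?posrE.
  by rewrite -expRD; congr expR; ring.
by rewrite mulr1; congr expR; ring.
Qed.

Lemma qq_ge0 t : 0 <= t -> 0 <= qq t.
Proof. by move=> t0; rewrite qqE// expR_ge0. Qed.

Lemma qq_gt0 t : 0 <= t -> 0 < qq t.
Proof. by move=> t0; rewrite qqE// expR_gt0. Qed.

Let tau_lt s t : 0 <= s -> s < t -> tau s < tau t /\ tau t - tau s <= t - s.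
Proof.
move=> s0 st; have t0 : 0 <= t by exact: le_trans (ltW st).
rewrite /tau; case: (gamma == 1); last by split.
have s1 : 0 < 1 + s by rewrite ltr_pwDl.
have t1 : 0 < 1 + t by rewrite ltr_pwDl.
split; first by rewrite ltr_ln ?posrE// ltrD2l.
rewrite -lnV ?posrE// -lnM ?posrE ?invr_gt0//.
rewrite (_ : (1 + t) / (1 + s) = 1 + (t - s) / (1 + s)); last by field; rewrite gt_eqF.
have ts : 0 <= t - s by rewrite subr_ge0 ltW.
apply: le_trans (le_ln1Dx _) _.
  by rewrite (lt_le_trans (ltrN10 _))// divr_ge0// ltW.
by rewrite ler_pdivrMr// ler_peMr// lerDl.
Qed.

Lemma qq_lt s t : 0 <= s -> s < t -> qq s < qq t.
Proof.
move=> s0 st; have t0 : 0 <= t by exact: le_trans (ltW st).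
by rewrite !qqE// ltr_expR ltr_pM2l//; case: (tau_lt s0 st).
Qed.

Lemma qq_le s t : 0 <= s -> s <= t -> qq s <= qq t.
Proof.
by move=> s0; rewrite le_eqVlt => /predU1P[->//|st]; rewrite ltW// qq_lt.
Qed.

Lemma qq_lip s t : 0 <= s -> s <= t -> qq t - qq s <= qq t * rate * (t - s).
Proof.
move=> s0; rewrite le_eqVlt => /predU1P[->|st]; first by rewrite !subrr mulr0.
have t0 : 0 <= t by exact: le_trans (ltW st).
have [_ h] := tau_lt s0 st.
have q0 := qq_ge0 t0.
apply: (@le_trans _ _ (qq t * (rate * (tau t - tau s)))); last first.
  by rewrite -mulrA ler_wpM2l// ler_wpM2l// ltW.
rewrite (_ : qq s = qq t * expR (- (rate * (tau t - tau s)))); last first.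
  by rewrite !qqE// -expRD; congr expR; ring.
rewrite -{1}[qq t]mulr1 -mulrBr ler_wpM2l//.
have := expR_ge1Dx (- (rate * (tau t - tau s))); lra.
Qed.

Lemma qq_continuous t : 0 <= t -> {for t, continuous qq}.
Proof.
move=> t0; rewrite /qq.
have cp := phi_continuous t0.
apply: cvgM.
  by rewrite expr2; under eq_fun do rewrite expr2; exact: cvgM.
case: (gamma == 1); last exact: cvg_cst.
apply: cvgV; first by rewrite gt_eqF// ltr_pwDl.
by apply: cvgD; [exact: cvg_cst|exact: cvg_id].
Qed.

End limit_clock.

(** * Convergence in law *)

Section functional_limit.
Context {R : realType} d (T : measurableType d) (P : probability T R).
Variables (N : nat) (alpha gamma c : R) (r : nat -> R).
Variables (Zi : nat -> 'I_N -> T -> R) (I : nat -> 'I_N -> T -> R) (Z : T -> R).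
Hypothesis N_gt0 : (0 < N)%N.
Hypothesis alpha01 : 0 < alpha <= 1.
Hypothesis gamma01 : 0 < gamma <= 1.
Hypothesis c_gt0 : 0 < c.
Hypothesis r01 : forall n, 0 <= r n < 1.
Hypothesis Gr : (fun n => speed gamma n * r n) @ \oo --> c.
Hypothesis rate_gt0 : 0 < 2 * c * alpha - crit gamma.
Hypothesis model : interacting_model P alpha r Zi I.
Hypothesis mZ : measurable_fun setT Z.
Hypothesis aeZ : {ae P, forall w, avg Zi n w @[n --> \oo] --> Z w}.
Variable i : 'I_N.
Context d' (T' : measurableType d') (P' : probability T' R).
Variables (W : R -> T' -> R) (Z' : T' -> R).
Hypothesis ZZ' : same_law P Z P' Z'.
Hypothesis BM : BM_indep_of P' W Z'.

Local Notation Pi := (decay alpha r).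
Local Notation wt := (weight alpha r).
Local Notation A := (weight_sq alpha r).
Local Notation G := (speed gamma).
Local Notation beta2 := (beta2 alpha gamma r).
Local Notation kappa := (kappa alpha gamma c).
Local Notation mm := (time_index gamma).
Local Notation phi := (phi alpha gamma c).
Local Notation qq := (clock alpha gamma c).
Local Notation adp := (adp (gen Zi)).
Local Notation dev := (dev Zi).
Local Notation xi := (xi alpha r Zi i).

Let gm := gen_meas model.
Let gmono : forall n, gen Zi n `<=` gen Zi n.+1 := @gen_mono _ _ _ _ Zi.
Let bt n : R := Num.sqrt (beta2 n).

Let kappa_ge0 : 0 <= kappa.
Proof. by rewrite /kappa divr_ge0 ?sqr_ge0// ltW. Qed.

Let N1 : 0 <= (1 - N%:R^-1 : R) <= 1.
Proof.
have n0 : 0 < N%:R^-1 :> R by rewrite invr_gt0 ltr0n.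
have n1 : N%:R^-1 <= 1 :> R by rewrite invf_le1 ?ltr0n// ler1n.
by apply/andP; split; lra.
Qed.

Let v (z : R) := (1 - N%:R^-1) * kappa * vquad z.

Let v_ge0 z : 0 <= v z.
Proof.
case/andP: N1 => n0 _; apply: mulr_ge0; last exact: vquad_ge0.
exact: mulr_ge0.
Qed.

Let v_le z : v z <= kappa.
Proof.
case/andP: N1 => n0 n1; rewrite /v mulrAC -[leRHS]mul1r ler_wpM2r//.
by rewrite -[leRHS](mulr1 1) ler_pM ?vquad_ge0 ?vquad_le1.
Qed.

Let mv : measurable_fun setT v.
Proof. by apply: measurable_funM => //; exact: measurable_vquad. Qed.

Let mZ' : measurable_fun setT Z'. Proof. by case: BM => _ []. Qed.
Let W0 w : W 0 w = 0. Proof. by case: BM => _ [_ []]. Qed.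

(** With [vquad] for z (1 - z), the time is nonnegative and the path continuous for every [w], not
    only almost surely. *)
Definition limit_path w t := W ((1 - N%:R^-1) * kappa * vquad (Z' w) * qq t) w.
Local Notation Y := limit_path.

Lemma limit_path_continuous w t : 0 <= t -> {for t, continuous (Y w)}.
Proof.
move=> t0; have [_ [_ [_ [cW _]]]] := BM.
have /subspace_continuousP cWw := cW w.
pose h s := v (Z' w) * qq s.
have hc : h @ t --> h t.
  by apply: cvgM; [exact: cvg_cst|exact: qq_continuous].
have h0 : \forall s \near t, 0 <= h s.
  near=> s; rewrite /h mulr_ge0//; rewrite /qq mulr_ge0 ?sqr_ge0//; case: ifP => // _.
  rewrite invr_ge0 -lerBlDl sub0r ltW//; near: s; apply: lt_nbhsr.
  by rewrite (lt_le_trans _ t0)// ltrN10.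
have ht : [set t | 0 <= t] (h t) by rewrite /= /h mulr_ge0// qq_ge0.
apply: (@cvg_comp _ _ _ h (fun s => W s w) _ (within [set t | 0 <= t] (nbhs (h t)))).
  move=> B; rewrite /within/= => hB; have := hc _ hB.
  by apply: filterS2 h0 => s /= hs; exact.
exact: cWw.
Unshelve. all: by end_near. Qed.

Lemma measurable_limit_path t : 0 <= t -> measurable_fun setT (Y^~ t).
Proof.
(* A partition with the single step from 0 to [qq t]. *)
move=> t0; pose q p : R := if p is _.+1 then qq t else 0.
have q_lt p : (p < 1)%N -> q p < q p.+1 by case: p => // _; exact: qq_gt0.
have := measurable_time_change BM (erefl : q 0%N = 0) q_lt mv v_ge0 v_le (ltnSn 0).
by congr measurable_fun; apply/funext => w; rewrite /= mulr0 W0 subr0.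
Qed.

Let grid_ge0 k p : 0 <= grid k p :> R. Proof. by rewrite divr_ge0. Qed.
Let grid_lt k p q : (p < q)%N -> grid k p < grid k q :> R.
Proof. by move=> pq; rewrite /grid ltr_pM2r ?invr_gt0// ltr_nat. Qed.
Let grid_le k p q : (p <= q)%N -> grid k p <= grid k q :> R.
Proof. by move=> pq; rewrite /grid ler_pM2r ?invr_gt0// ler_nat. Qed.
Let grid_max k j : grid k (j * k.+1) = j%:R :> R.
Proof. by rewrite /grid natrM mulfK. Qed.

(** The rescaled deviation without its initial value, and with [phi t * Pi (mm n t) / Pi n] replaced
    by its limit 1. *)
Definition scaled_sum n w t := bt n * \sum_(0 <= l < mm n t) wt l * xi l w.
Local Notation U := scaled_sum.

Lemma A_mono m1 m2 : (m1 <= m2)%N -> A m1 <= A m2.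
Proof.
move=> h; rewrite /A -!(big_mkord predT (fun l => wt l ^+ 2)).
rewrite [leRHS](@big_cat_nat _ _ _ m1)//= lerDl.
by apply: sumr_ge0 => l _; exact: sqr_ge0.
Qed.

Section fdd.
Variables (j k : nat).

Let K := (j * k.+1).+1.
(** The first block is the whole past of [n], since the noise sum starts at 0. Accordingly the first
    increment of the limit runs from 0 to [qq 0], which equals 1. *)
Let Mb n p := if p is p'.+1 then mm n (grid k p') else 0%N.
Let Q p : R := if p is p'.+1 then qq (grid k p') else 0.

Let Mb_mono n p q : (p <= q)%N -> (Mb n p <= Mb n q)%N.
Proof. by case: p q => [|p] [|q] //= pq; apply: mm_mono; exact: grid_le. Qed.

Let Q_lt p : (p < K)%N -> Q p < Q p.+1.
Proof.
by case: p => [|p] _ /=; [apply: qq_gt0|apply: qq_lt => //; exact: grid_lt].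
Qed.

Local Notation incs := (inc alpha gamma r Zi i Mb).

Let sum_inc n w p : \sum_(0 <= q < p.+1) incs n q w = U n w (grid k p).
Proof.
elim: p => [|p ih]; first by rewrite big_nat1.
rewrite big_nat_recr//= ih /scaled_sum /inc -mulrDr -big_cat_nat//=.
by apply: mm_mono; exact: grid_le.
Qed.

Let sum_Y w p : \sum_(0 <= q < p.+1) (W (v (Z' w) * Q q.+1) w - W (v (Z' w) * Q q) w) =
  Y w (grid k p).
Proof. by rewrite telescope_sumr//= mulr0 W0 subr0. Qed.

(** Both sides are mixtures over the limit variance of the same Gaussian formula; [Z] and [Z'] enter
    only through the function [h], so equality of their laws suffices. *)
Let cos_cvg (lam : nat -> R) (th : R) :
  Ex P (fun w => cos (\sum_(0 <= q < K) lam q * incs n q w + th)) @[n --> \oo] -->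
  Ex P' (fun w => cos (\sum_(0 <= q < K) lam q *
    (W (v (Z' w) * Q q.+1) w - W (v (Z' w) * Q q) w) + th)).
Proof.
have HQ p : (p <= K)%N -> (fun n => beta2 n * A (Mb n p)) @ \oo --> kappa * Q p.
  move=> _; case: p => [|p] /=.
    by rewrite mulr0 /A big_ord0; under eq_fun do rewrite mulr0; exact: cvg_cst.
  exact: (beta2A_mm_cvg alpha01 gamma01 c_gt0 r01 Gr rate_gt0).
have small (e : R) : 0 < e -> exists p, \forall n \near \oo,
    forall l, (p <= l < Mb n K)%N -> beta2 n * wt l ^+ 2 <= e.
  by move=> e0; exact: (beta2wt_small alpha01 gamma01 c_gt0 r01 Gr rate_gt0).
have Mb_ge n : (n <= Mb n K)%N by exact: mm_ge.
have := @block_cos _ _ _ _ _ _ _ _ _ _ _ _ N_gt0 alpha01 gamma01 r01 Gr rate_gt0 model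
  mZ aeZ i _ _ _ Mb_mono Mb_ge HQ small lam th.
set Vi := \sum_(0 <= _ < K) _ => bc.
rewrite (BM_cos_random BM lam th (erefl : Q 0%N = 0) Q_lt mv v_ge0 v_le).
have Vi0 : 0 <= Vi.
  rewrite /Vi big_nat; apply: sumr_ge0 => q /andP[_ qK].
  by rewrite mulr_ge0 ?sqr_ge0// -mulrBr mulr_ge0// subr_ge0 ltW// Q_lt.
pose h z := cos th * expR (- ((1 - N%:R^-1) * vquad z * Vi) / 2).
have bh : bmf h.
  apply: bmfM; first exact: bmf_cst.
  apply: bmf_expRN.
    apply: measurable_funM => //; apply: measurableT_comp => //.
    by do 2 apply: measurable_funM => //; exact: measurable_vquad.
  move=> z; rewrite mulNr oppr_le0 divr_ge0// !mulr_ge0 ?vquad_ge0//.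
  by case/andP: N1.
have := same_law_Ex ZZ' mZ mZ' bh => E.
rewrite (_ : Ex P' _ = Ex P (fun w => h (Z w)))// E; congr Ex; apply/funext => w.
rewrite /h; congr (_ * expR (- _ / 2)); rewrite /v /Vi.
under [in RHS]eq_bigr do rewrite -mulrBr mulrCA.
by rewrite -mulr_sumr; ring.
Qed.

(** The cosine limits concern increments, so [g] is composed with partial sums, at the cost of a
    factor K in the Lipschitz constant. *)
Lemma fdd_cvg (g : ('I_(j * k.+1).+1 -> R) -> R) (L C : R) :
  0 <= L -> (forall x, `|g x| <= C) ->
  (forall x y, `|g x - g y| <= L * \sum_i `|x i - y i|) ->
  Ex P (fun w => g (fun i => U n w (grid k i))) @[n --> \oo] -->
  Ex P' (fun w => g (fun i => Y w (grid k i))).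
Proof.
move=> L0 gC gL.
pose cum (x : 'I_K -> R) (p : 'I_K) := \sum_(q < K | (q < p.+1)%N) x q.
pose g' x := g (cum x).
have cumE (F : nat -> R) p : cum (fun q => F q) p = \sum_(0 <= q < p.+1) F q.
  by rewrite /cum big_mkord (big_ord_widen _ _ (ltn_ord p)).
have g'L x y : `|g' x - g' y| <= L * K%:R * \sum_p `|x p - y p|.
  apply: le_trans (gL _ _) _; rewrite -mulrA ler_wpM2l//.
  rewrite -[X in X%:R * _](card_ord K) mulr_natl -sumr_const; apply: ler_sum => p _.
  rewrite /cum -sumrB; apply: le_trans (ler_norm_sum _ _ _) _.
  by rewrite [leRHS](bigID (fun q : 'I_K => (q < p.+1)%N))/= lerDl; apply: sumr_ge0.
have LK : 0 <= L * K%:R by rewrite mulr_ge0.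
pose X n w (p : 'I_K) := incs n p w.
pose Dl w (p : 'I_K) := W (v (Z' w) * Q p.+1) w - W (v (Z' w) * Q p) w.
have XE n w : g' (X n w) = g (fun p => U n w (grid k p)).
  by congr g; apply/funext => p; rewrite (cumE (fun q => incs n q w)) sum_inc.
have YE w : g' (Dl w) = g (fun p => Y w (grid k p)).
  congr g; apply/funext => p.
  by rewrite (cumE (fun q => W (v (Z' w) * Q q.+1) w - W (v (Z' w) * Q q) w)) sum_Y.
under eq_fun do under eq_fun do rewrite -XE.
have -> : (fun w => g (fun p => Y w (grid k p))) = fun w => g' (Dl w).
  by apply/funext => w; rewrite YE.
apply: (levy (fun x => gC (cum x)) g'L LK (C := 4 * (kappa * qq j%:R + 1))).
- by move=> n p; exact: (bmf_inc _ model).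
- move=> p.
  exact: (measurable_time_change BM (erefl : Q 0%N = 0) Q_lt mv v_ge0 v_le (ltn_ord p)).
- have /cvgrPdist_le/(_ _ ltr01) h :=
    beta2A_mm_cvg alpha01 gamma01 c_gt0 r01 Gr rate_gt0 (ler0n R j).
  apply: filterS h => n hn p.
  apply: le_trans (inc_moment2 _ N_gt0 alpha01 model i Mb_mono n p) _.
  rewrite ler_wpM2l//; apply: (@le_trans _ _ (beta2 n * A (mm n j%:R))).
    rewrite ler_wpM2l ?beta2_ge0// lerBlDr.
    rewrite (@le_trans _ _ (A (mm n j%:R)))//; last by rewrite lerDl A_ge0.
    by apply: A_mono => /=; apply: mm_mono; rewrite -(grid_max k j) grid_le// -ltnS.
  by move: hn; rewrite distrC ler_norml; lra.
move=> lam th.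
have h : _ --> _ := @cos_cvg (fun p => lam (inord p)) th; move: h.
have sE (F : nat -> R) : \sum_(0 <= q < K) lam (inord q) * F q = \sum_(q < K) lam q * F q.
  by rewrite big_mkord; apply: eq_bigr => q _; rewrite inord_val.
under eq_fun do under eq_fun do rewrite sE.
by congr (_ --> Ex P' _); apply/funext => w; rewrite sE.
Qed.

End fdd.

End functional_limit.

(** * Oscillations between grid points *)

Section tightness.
Context {R : realType} d (T : measurableType d) (P : probability T R).
Variables (N : nat) (alpha gamma c : R) (r : nat -> R).
Variables (Zi : nat -> 'I_N -> T -> R) (I : nat -> 'I_N -> T -> R).
Hypothesis N_gt0 : (0 < N)%N.
Hypothesis alpha01 : 0 < alpha <= 1.
Hypothesis gamma01 : 0 < gamma <= 1.
Hypothesis c_gt0 : 0 < c.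
Hypothesis r01 : forall n, 0 <= r n < 1.
Hypothesis Gr : (fun n => speed gamma n * r n) @ \oo --> c.
Hypothesis rate_gt0 : 0 < 2 * c * alpha - crit gamma.
Hypothesis model : interacting_model P alpha r Zi I.
Variable i : 'I_N.

Local Notation Pi := (decay alpha r).
Local Notation wt := (weight alpha r).
Local Notation A := (weight_sq alpha r).
Local Notation G := (speed gamma).
Local Notation beta2 := (beta2 alpha gamma r).
Local Notation kappa := (kappa alpha gamma c).
Local Notation mm := (time_index gamma).
Local Notation phi := (phi alpha gamma c).
Local Notation qq := (clock alpha gamma c).
Local Notation dev := (dev Zi).
Local Notation xi := (xi alpha r Zi i).
Local Notation U := (scaled_sum alpha gamma r Zi i).
Local Notation rate := (2 * c * alpha - crit gamma).

Let gm := gen_meas model.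
Let gmono : forall n, gen Zi n `<=` gen Zi n.+1 := @gen_mono _ _ _ _ Zi.
Let bt n : R := Num.sqrt (beta2 n).

Let bt2 n : bt n ^+ 2 = beta2 n.
Proof. by rewrite /bt sqr_sqrtr// beta2_ge0. Qed.

Let btE n : bt n = Num.sqrt (G n) * Pi n.
Proof.
by rewrite /bt /beta2 sqrtrM ?G_ge0// sqrtr_sqr ger0_norm// ltW// Pi_gt0.
Qed.

Let wb n m1 m2 l := if (m1 <= l < m2)%N then bt n * wt l else 0.

Let mtr_wb n m1 m2 m w : (m1 <= m <= m2)%N ->
  mtr xi (wb n m1 m2) (fun _ _ => 1) m w = bt n * \sum_(m1 <= l < m) wt l * xi l w.
Proof.
move=> /andP[h1 h2].
rewrite /mtr -(big_mkord predT (fun l => wb n m1 m2 l * 1 * xi l w)) mulr_sumr.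
rewrite -[RHS](@big_nat_indic _ _ _ _ m) ?h1 ?leqnn//=.
rewrite [LHS]big_nat [RHS]big_nat; apply: eq_bigr => l /andP[_ lm].
rewrite /wb lm (leq_trans lm h2) !andbT mulr1.
by case: ifP => _; rewrite ?mul0r// mulrA.
Qed.

(** 64 = 4 * 4^2: the 4 of the maximal inequality, and the square of 2^2 coming from noise bounded
    by 2. *)
Let exceed_wb n m1 m2 (e : R) : 0 < e -> (m1 <= m2)%N ->
  Ex P (\1_(exceed xi (wb n m1 m2) e m2)) <= 64 * (beta2 n * (A m2 - A m1)) ^+ 2 / e ^+ 4.
Proof.
move=> e0 m12.
apply: le_trans (exceed_le gm gmono (xi_adp model i) (xi_le N_gt0 alpha01 model i)
  (@xi_centered _ _ _ _ _ _ _ _ _ N_gt0 model i) (wb n m1 m2) e0 m2) _.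
rewrite ler_wpM2r ?invr_ge0 ?exprn_ge0 ?(ltW e0)//.
rewrite -(big_mkord predT (fun l => (2 * wb n m1 m2 l) ^+ 2)).
rewrite (_ : \sum_(0 <= l < m2) _ = 4 * (beta2 n * (A m2 - A m1))); last first.
  rewrite /A -!(big_mkord predT (fun l => wt l ^+ 2)).
  rewrite [X in _ = 4 * (_ * (X - _))](@big_cat_nat _ _ _ m1)//=.
  rewrite [X in _ = 4 * (_ * X)]addrAC subrr add0r !mulr_sumr.
  rewrite -[RHS](@big_nat_indic _ _ _ _ m2) ?m12/=; last by rewrite leqnn.
  apply: eq_bigr => l _; rewrite /wb; case: ifP => _; last by rewrite mulr0 expr0n.
  by rewrite -bt2; ring.
by rewrite exprMn mulrA -natrX -natrM.
Qed.

(* By the fourth moments, each of the [O(k)] blocks of length [1 / k.+1] has an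
   oscillation above a given level with probability [O(k^-2)]. *)
Lemma tightness (X : nat -> T -> R -> R) :
  (\forall n \near \oo, forall w t, 0 <= t ->
     X n w t = Num.sqrt (G n) * phi t * dev i (mm n t) w) ->
  forall (j : nat) (e : R), 0 < e -> \forall k \near \oo,
  \forall n \near \oo, exists2 Bad : set T, measurable Bad &
   Ex P (\1_Bad) <= e /\ forall w, ~ Bad w -> forall t, 0 <= t <= j%:R ->
     `|X n w t - U n w (grid k (gidx k t))| <= e.
Proof.
move=> XE j e e0.
(* Lipschitz constant of [kappa * qq] on [0, j + 1]; the last block may end past [j]. *)
pose D := kappa * (qq j.+1%:R * rate).
have k0 : 0 <= kappa by rewrite /kappa divr_ge0 ?sqr_ge0// ltW.
have D0 : 0 <= D by rewrite /D mulr_ge0// mulr_ge0 ?qq_ge0// ltW.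
(* At most (j + 1)(k + 1) blocks, each exceeding e / 2 with probability of order 1 / (k + 1)^2,
   leave a total of C / (k + 1). *)
pose C := 64 * (D + 1) ^+ 2 / (e / 2) ^+ 4 * j.+1%:R.
have e2 : 0 < e / 2 by rewrite divr_gt0.
have e4 : 0 < e / 4 by rewrite divr_gt0.
pose B := kappa * qq j%:R + 1.
(* A level that the whole sum exceeds with probability at most e / 2; the added 1 gives
   [Am <= Am ^+ 4]. *)
pose Am := 1 + 64 * B ^+ 2 / (e / 2).
have B20 : 0 <= 64 * B ^+ 2 / (e / 2).
  by rewrite divr_ge0 ?(ltW e2)// mulr_ge0// sqr_ge0.
have Am1 : 1 <= Am by rewrite lerDl.
have Am0 : 0 < Am by exact: lt_le_trans Am1.
(* The error on the factor [cn] is multiplied by a sum of size at most 1 + Am. *)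
have de : 0 < e / 4 / (1 + Am) by rewrite divr_gt0// addr_gt0.
near=> k.
have kC : C / (e / 2) <= k.+1%:R.
  by rewrite (@le_trans _ _ k%:R) ?ler_nat//; near: k; exact: nbhs_infty_ger.
pose K := (j * k.+1).+1.
have hblk : \forall n \near \oo, forall p : 'I_K,
    beta2 n * (A (mm n (grid k p.+1)) - A (mm n (grid k p))) <= (D + 1) / k.+1%:R.
  apply: filter_forall => p.
  have g0 q : 0 <= grid k q :> R by rewrite divr_ge0.
  have g1 : grid k p.+1 - grid k p = k.+1%:R^-1 :> R.
    by rewrite /grid -mulrBl -natr1 addrAC subrr add0r mul1r.
  have gp : grid k p <= grid k p.+1 :> R by rewrite -subr_ge0 g1.
  have gj : grid k p.+1 <= j.+1%:R :> R.
    rewrite /grid ler_pdivrMr// -natrM ler_nat mulSn.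
    by rewrite (leq_trans (ltn_ord p))// /K -addn1 addnC leq_add2r.
  have c1 : (fun n => beta2 n * (A (mm n (grid k p.+1)) - A (mm n (grid k p)))) @ \oo -->
      kappa * qq (grid k p.+1) - kappa * qq (grid k p).
    under eq_fun do rewrite mulrBr.
    by apply: cvgB; apply: (beta2A_mm_cvg alpha01 gamma01 c_gt0 r01 Gr rate_gt0).
  have kV : 0 < k.+1%:R^-1 :> R by rewrite invr_gt0.
  have l1 : kappa * qq (grid k p.+1) - kappa * qq (grid k p) <= D / k.+1%:R.
    rewrite -mulrBr /D -[leRHS]mulrA ler_wpM2l// -g1.
    apply: le_trans (qq_lip rate_gt0 (g0 p) gp) _.
    rewrite ler_wpM2r ?subr_ge0// ler_wpM2r ?(ltW rate_gt0)//.
    exact: (qq_le rate_gt0).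
  move/cvgrPdist_le : c1 => /(_ _ kV); apply: filterS => n.
  move=> /ler_normlP[h _]; rewrite mulrDl mul1r -lerBlDl (le_trans _ h)//.
  by rewrite opprB lerD2l lerN2.
have hglob : \forall n \near \oo, beta2 n * A (mm n j%:R) <= B.
  have /cvgrPdist_le/(_ _ ltr01) := beta2A_mm_cvg alpha01 gamma01 c_gt0 r01 Gr rate_gt0 (ler0n R j).
  by apply: filterS => n; rewrite ler_norml /B; lra.
have hbt : bt @ \oo --> (0 : R).
  rewrite -[X in _ --> X](sqrtr0 R); apply: continuous_cvg; first exact: sqrt_continuous.
  exact: (beta2_cvg0 gamma01 Gr rate_gt0).
have mine : 0 < Num.min 1 (e / 4) by rewrite lt_min ltr01.
have /cvgr0_norm_le/(_ _ mine) hbtn := hbt.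
have hphi := phi_unif alpha01 gamma01 c_gt0 r01 Gr (ler0n R j) de.
near=> n.
have XEn : forall w t, 0 <= t -> X n w t = Num.sqrt (G n) * phi t * dev i (mm n t) w.
  by near: n.
have hb : forall p : 'I_K,
    beta2 n * (A (mm n (grid k p.+1)) - A (mm n (grid k p))) <= (D + 1) / k.+1%:R by near: n.
have hg : beta2 n * A (mm n j%:R) <= B by near: n.
have hbn : `|bt n| <= Num.min 1 (e / 4) by near: n.
have hp : forall t, 0 <= t <= j%:R -> `|phi t * Pi (mm n t) / Pi n - 1| <= e / 4 / (1 + Am).
  by near: n.
have bt1 : `|bt n| <= 1 by apply: le_trans hbn _; rewrite ge_min lexx.
have bte : `|bt n| <= e / 4 by apply: le_trans hbn _; rewrite ge_min lexx orbT.
pose E0 := exceed xi (wb n 0 (mm n j%:R)) Am (mm n j%:R).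
pose E1 p := exceed xi (wb n (mm n (grid k p)) (mm n (grid k p.+1))) (e / 2) (mm n (grid k p.+1)).
have gle p q : (p <= q)%N -> (mm n (grid k p) <= mm n (grid k q))%N.
  by move=> pq; apply: mm_mono; rewrite /grid ler_pM2r ?invr_gt0// ler_nat.
have mE0 : measurable E0 by exact: (measurable_exceed gm gmono (xi_adp model i)).
have mE1 p : measurable (E1 p) by exact: (measurable_exceed gm gmono (xi_adp model i)).
exists (E0 `|` \big[setU/set0]_(p < K) E1 p).
  by apply: measurableU => //; apply: bigsetU_measurable.
split.
  have p0 : Ex P (\1_E0) <= e / 2.
    apply: le_trans (exceed_wb n Am0 (leq0n _)) _.
    have -> : A 0 = 0 by rewrite /A big_ord0.
    rewrite subr0.
    rewrite ler_pdivrMr ?exprn_gt0//.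
    apply: (@le_trans _ _ (64 * B ^+ 2)).
      rewrite ler_wpM2l// lerXn2r ?nnegrE//; first by rewrite mulr_ge0 ?beta2_ge0 ?A_ge0.
      by apply: le_trans hg; rewrite mulr_ge0 ?beta2_ge0 ?A_ge0.
    rewrite [leRHS]mulrC -ler_pdivrMr// (@le_trans _ _ Am)//; first by rewrite lerDr.
    exact: ler_eXnr.
  have p1 (p : 'I_K) : Ex P (\1_(E1 p)) <= 64 * ((D + 1) / k.+1%:R) ^+ 2 / (e / 2) ^+ 4.
    apply: le_trans (exceed_wb n e2 (gle _ _ (leqnSn p))) _.
    rewrite ler_wpM2r ?invr_ge0 ?exprn_ge0 ?(ltW e2)// ler_wpM2l//.
    rewrite lerXn2r ?nnegrE ?hb//; last by rewrite divr_ge0// addr_ge0.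
    by rewrite mulr_ge0 ?beta2_ge0// subr_ge0; apply: A_mono; exact: gle.
  have bE (S : set T) : measurable S -> bmf (\1_S : T -> R) by exact: bmf_indic.
  apply: (@le_trans _ _ (Ex P (fun w => \1_E0 w + \sum_(p < K) \1_(E1 p) w))).
    apply: Ex_le.
    - by apply: bE; apply: measurableU => //; apply: bigsetU_measurable.
    - by apply: bmfD; [exact: bE|apply: bmf_sum => p; exact: bE].
    move=> w.
    have i0 (S : set T) : 0 <= \1_S w :> R by rewrite indicE.
    have i1 (S : set T) : S w -> \1_S w = 1 :> R by move=> Sw; rewrite indicE mem_set.
    rewrite [leLHS]indicE; case: (boolP (_ \in _)) => [|_]; last first.
      by rewrite addr_ge0// sumr_ge0.
    rewrite inE => -[/i1->|]; first by rewrite lerDl sumr_ge0.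
    rewrite -bigcup_mkord => -[p /= pK /i1 h].
    apply: ler_wpDl => //; rewrite (bigD1 (Ordinal pK))//= h lerDl.
    by rewrite sumr_ge0.
  rewrite ExD; [|exact: bE|by apply: bmf_sum => p; exact: bE].
  rewrite Ex_sum; last by move=> p; exact: bE.
  suff : \sum_(p < K) Ex P (\1_(E1 p)) <= e / 2 by lra.
  apply: le_trans (ler_sum _ (fun p _ => p1 p)) _.
  rewrite sumr_const card_ord -[leLHS]mulr_natr.
  apply: (@le_trans _ _ (C / k.+1%:R)); last first.
    by rewrite ler_pdivrMr// [leRHS]mulrC -ler_pdivrMr.
  rewrite (_ : C / k.+1%:R = 64 * ((D + 1) / k.+1%:R) ^+ 2 / (e / 2) ^+ 4 * (j.+1 * k.+1)%:R).
    rewrite ler_wpM2l//.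
      by rewrite !mulr_ge0 ?invr_ge0 ?exprn_ge0 ?(ltW e2)// ?mulr_ge0 ?invr_ge0// addr_ge0.
    by rewrite ler_nat /K mulSn -addn1 addnC leq_add2r.
  rewrite /C natrM; field.
  by rewrite gt_eqF// gt_eqF.
move=> w nB t tj; have /andP[t0 tj'] := tj.
have n0 : ~ E0 w by move=> h; apply: nB; left.
have gK := gidx_le k tj.
have n1 : ~ E1 (gidx k t) w.
  move=> h; apply: nB; right; rewrite -bigcup_mkord; exists (gidx k t) => //=.
have /andP[gt1 /ltW gt2] := gidx_itv k t0.
set g := gidx k t in gt1 gt2 gK n1 *.
have U1 : `|U n w t| <= Am.
  rewrite leNgt; apply/negP => h; apply: n0; exists (mm n t); first exact: mm_mono.
  by rewrite mtr_wb ?leq0n/= ?mm_mono// ltW.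
have U2 : `|U n w t - U n w (grid k g)| <= e / 2.
  have m12 : (mm n (grid k g) <= mm n t)%N by exact: mm_mono.
  rewrite leNgt; apply/negP => h; apply: n1; exists (mm n t); first exact: mm_mono.
  rewrite mtr_wb ?m12/= ?mm_mono// ltW//; apply: lt_le_trans h _.
  rewrite /scaled_sum -mulrBr (@big_cat_nat _ _ _ (mm n (grid k g)) 0 (mm n t))//=.
  by rewrite addrAC subrr add0r.
pose cn := phi t * Pi (mm n t) / Pi n.
have Xc : X n w t = cn * (bt n * dev i 0 w + U n w t).
  rewrite XEn// (dev_mtr alpha01 r01 model) /scaled_sum -/(bt n) -mulrDr btE /cn.
  rewrite /mtr -(big_mkord predT (fun l => wt l * 1 * xi l w)).
  under eq_bigr do rewrite mulr1.
  have := Pi_neq0 alpha01 r01 n; move: (dev i 0 w + _) => u p0.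
  by field.
have dv := dev_le N_gt0 model i 0 w.
have cn1 := hp t tj; rewrite -/cn in cn1.
have bd : `|bt n * dev i 0 w| <= `|bt n|.
  by rewrite normrM -[leRHS]mulr1 ler_wpM2l.
have s1 : `|bt n * dev i 0 w + U n w t| <= 1 + Am.
  by rewrite (le_trans (ler_normD _ _))// lerD// (le_trans bd).
have s2 : `|(cn - 1) * (bt n * dev i 0 w + U n w t)| <= e / 4.
  rewrite normrM; apply: (@le_trans _ _ (e / 4 / (1 + Am) * (1 + Am))); first exact: ler_pM.
  by rewrite divfK// gt_eqF// addr_gt0.
(* The budget is e / 4 for the factor [cn], e / 4 for the initial deviation and e / 2 for the
   oscillation within the block. *)
rewrite Xc (_ : _ - _ = (cn - 1) * (bt n * dev i 0 w + U n w t) +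
   (bt n * dev i 0 w + (U n w t - U n w (grid k g)))); last by ring.
apply: le_trans (ler_normD _ _) _.
have := ler_normD (bt n * dev i 0 w) (U n w t - U n w (grid k g)).
by move: s2 bd bte U2; lra.
Unshelve. all: by end_near. Qed.

End tightness.

Section convergence_in_law.
Context {R : realType} d (T : measurableType d) (P : probability T R).
Variables (N : nat) (alpha gamma c : R) (r : nat -> R).
Variables (Zi : nat -> 'I_N -> T -> R) (I : nat -> 'I_N -> T -> R) (Z : T -> R).
Hypothesis N_gt0 : (0 < N)%N.
Hypothesis alpha01 : 0 < alpha <= 1.
Hypothesis gamma01 : 0 < gamma <= 1.
Hypothesis c_gt0 : 0 < c.
Hypothesis r01 : forall n, 0 <= r n < 1.
Hypothesis Gr : (fun n => speed gamma n * r n) @ \oo --> c.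
Hypothesis rate_gt0 : 0 < 2 * c * alpha - crit gamma.
Hypothesis model : interacting_model P alpha r Zi I.
Hypothesis mZ : measurable_fun setT Z.
Hypothesis aeZ : {ae P, forall w, avg Zi n w @[n --> \oo] --> Z w}.
Variable i : 'I_N.
Context d' (T' : measurableType d') (P' : probability T' R).
Variables (W : R -> T' -> R) (Z' : T' -> R).
Hypothesis ZZ' : same_law P Z P' Z'.
Hypothesis BM : BM_indep_of P' W Z'.

Local Notation G := (speed gamma).
Local Notation kappa := (kappa alpha gamma c).
Local Notation mm := (time_index gamma).
Local Notation phi := (phi alpha gamma c).
Local Notation qq := (clock alpha gamma c).
Local Notation dev := (dev Zi).
Local Notation Y := (limit_path N alpha gamma c W Z').
Local Notation U := (scaled_sum alpha gamma r Zi i).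

Let mZ' : measurable_fun setT Z'. Proof. by case: BM => _ []. Qed.

Let Y_cont w t : 0 <= t -> {for t, continuous (Y w)}.
Proof. exact: (limit_path_continuous N_gt0 rate_gt0 BM). Qed.

Let Y_cadlag w : cadlag (Y w).
Proof. by apply: cadlag_continuous => t; exact: Y_cont. Qed.

Let mY t : 0 <= t -> measurable_fun setT (Y^~ t).
Proof. exact: (measurable_limit_path N_gt0 rate_gt0 BM). Qed.

Let U_meas n t : 0 <= t -> measurable_fun setT ((U n)^~ t).
Proof.
move=> _; apply: bmf_meas; apply: bmfM; first exact: bmf_cst.
apply: bmf_sum => l; apply: bmfM; first exact: bmf_cst.
exact: (adp_bmf (gen_meas model) (xi_adp model i l)).
Qed.

Section functional.
Variables (X : nat -> T -> R -> R) (F : (R -> R) -> R) (M : R).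
Hypothesis XE : \forall n \near \oo, forall w t, 0 <= t ->
  X n w t = Num.sqrt (G n) * phi t * dev i (mm n t) w.
Hypothesis FM : forall x, `|F x| <= M.
Hypothesis F_cont : skorohod_continuous F.
Hypothesis FX_meas : forall n, measurable_fun setT (fun w => F (X n w)).

Let X_cadlag : \forall n \near \oo, forall w, cadlag (X n w).
Proof.
near=> n; move=> w.
have n0 : (0 < n)%N by near: n; exact: near_oo_gt0.
have XEn : forall w t, 0 <= t -> X n w t = Num.sqrt (G n) * phi t * dev i (mm n t) w.
  by near: n.
have := @cadlag_step _ (fun t => Num.sqrt (G n) * phi t) (fun m => dev i m w) n%:R (G n)
  (ler0n _ _) (G_gt0 gamma n0) _.
move=> h; apply: cadlag_ext (h _) (XEn w) => t t0.
by apply: cvgM; [exact: cvg_cst|exact: phi_continuous].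
Unshelve. all: by end_near. Qed.

Lemma bmf_limit : bmf (fun w => F (Y w)).
Proof.
apply: (skorohod_bmf FM F_cont Y_cadlag mY) => w j e e0.
by apply: unif_grid => // t; exact: Y_cont.
Qed.

Lemma limit_liminf (e : R) : 0 < e ->
  \forall n \near \oo, Ex P' (fun w => F (Y w)) - e <= Ex P (fun w => F (X n w)).
Proof.
move=> e0; apply: (skorohod_liminf FM F_cont X_cadlag Y_cadlag FX_meas mY U_meas) => //.
- by move=> w j e' e'0; apply: unif_grid => // t; exact: Y_cont.
- move=> j k g L C L0 gC gL.
  exact: (fdd_cvg N_gt0 alpha01 gamma01 c_gt0 r01 Gr rate_gt0 model mZ aeZ i ZZ' BM L0 gC gL).
- exact: (tightness N_gt0 alpha01 gamma01 c_gt0 r01 Gr rate_gt0 model XE).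
Qed.

End functional.

Lemma limit_cvg X F M :
  (\forall n \near \oo, forall w t, 0 <= t ->
     X n w t = Num.sqrt (G n) * phi t * dev i (mm n t) w) ->
  (forall x, `|F x| <= M) -> skorohod_continuous F ->
  (forall n, measurable_fun setT (fun w => F (X n w))) ->
  Ex P (fun w => F (X n w)) @[n --> \oo] --> Ex P' (fun w => F (Y w)).
Proof.
move=> XE FM Fc FX.
have NM x : `|- F x| <= M by rewrite normrN.
have Nc : skorohod_continuous (fun x => - F x).
  by move=> xs x h1 h2 h3; apply: cvgN; exact: Fc.
have NX n : measurable_fun setT (fun w => - F (X n w)) by exact: measurableT_comp.
apply/cvgrPdist_le => e e0.
have h1 := limit_liminf XE FM Fc FX e0.
have h2 := limit_liminf XE NM Nc NX e0.
apply: filterS2 h1 h2 => n.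
have bX : bmf (fun w => F (X n w)) by apply: (@bmf_le _ _ _ M).
by rewrite (ExN _ bX) (ExN _ (bmf_limit FM Fc)) ler_norml; lra.
Qed.

Let Z'01 : {ae P', forall w, 0 <= Z' w <= 1}.
Proof.
pose B : set R := [set x | ~~ (0 <= x <= 1)].
have mB : measurable B.
  rewrite (_ : B = ~` `[0, 1]%classic); first exact: measurableC.
  by apply/seteqP; split => x; rewrite /B/= in_itv/= => /negP.
have PB : P (Z @^-1` B) = 0%E.
  apply/negligibleP; first by rewrite -[X in measurable X]setTI; exact: mZ.
  apply: negligibleS aeZ => w /= /negP h cw; apply: h; apply/andP; split.
    rewrite -(cvg_lim _ cw)//; apply: limr_ge; first exact: cvgP cw.
    by apply: nearW => n; case/andP: (avg01 N_gt0 model n w).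
  rewrite -(cvg_lim _ cw)//; apply: limr_le; first exact: cvgP cw.
  by apply: nearW => n; case/andP: (avg01 N_gt0 model n w).
exists (Z' @^-1` B); split.
- by rewrite -[X in measurable X]setTI; exact: mZ'.
- by rewrite ZZ'.
- by move=> w /= /negP.
Qed.

(** [Y0] has z (1 - z) where [limit_path] has [vquad]. As [Z'] has the law of a limit of means in
    [0, 1], the paths almost surely agree at nonnegative times, which suffices by [skorohod_ext]. *)
Lemma deviation_cvg_dist (X : nat -> T -> R -> R) (Y0 : T' -> R -> R) :
  (\forall n \near \oo, forall w t, 0 <= t ->
     X n w t = Num.sqrt (G n) * phi t * dev i (mm n t) w) ->
  (forall w t, 0 <= t ->
     Y0 w t = W ((1 - N%:R^-1) * kappa * (Z' w * (1 - Z' w)) * qq t) w) ->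
  cvg_dist_skorohod P X P' Y0.
Proof.
move=> XE YE F [M FM] Fc FX FY.
have -> : (\int[P']_w (F (Y0 w))%:E = (Ex P' (fun w => F (Y w)))%:E)%E.
  rewrite -(ExE _ (bmf_limit FM Fc)); apply: ae_eq_integral => //.
  - by apply/measurable_EFinP.
  - by apply/measurable_EFinP; case: (bmf_limit FM Fc).
  apply: filterS Z'01 => w /andP[z0 z1] _; congr EFin.
  have Yw t : 0 <= t -> Y0 w t = Y w t.
    move=> t0; rewrite YE// /limit_path /vquad max_r//.
    by rewrite mulr_ge0// subr_ge0.
  by apply: skorohod_ext => //; apply: cadlag_ext Yw.
under eq_fun do rewrite (ExE _ (@bmf_le _ _ _ M _ (FX _) (fun w => FM _))).
by apply: cvg_EFin; [exact: nearW|exact: limit_cvg].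
Qed.

End convergence_in_law.

Theorem theorem2p6 (R : realType) (d : measure_display) (T : measurableType d)
  (P : probability T R) (N : nat) (alpha gamma c : R) (r : nat -> R)
  (Zi : nat -> 'I_N -> T -> R) (I : nat -> 'I_N -> T -> R) (Z : T -> R)
  (i : 'I_N) :
  (0 < N)%N ->
  0 < alpha <= 1 ->
  (forall n, 0 <= r n < 1) ->
  2^-1 < gamma <= 1 -> 0 < c ->
  (fun n => (n%:R `^ gamma) * r n) @ \oo --> c ->
  interacting_model P alpha r Zi I ->
  (* the law of (Z_0(1),...,Z_0(N)) is permutation invariant *)
  (forall (s : {perm 'I_N}) (B : 'I_N -> set R), (forall j, measurable (B j)) ->
     P [set w | forall j, B j (Zi 0%N j w)] =
     P [set w | forall j, B j (Zi 0%N (s j) w)]) ->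
  (forall j, (\int[P]_w (Zi 0%N j w)%:E = (2^-1)%:E)%E) ->
  (0 < \int[P]_w (avg Zi 0 w * (1 - avg Zi 0 w))%:E)%E ->
  measurable_fun setT Z ->
  {ae P, forall w, avg Zi n w @[n --> \oo] --> Z w} ->
  (gamma < 1 ->
   forall (d' : measure_display) (T' : measurableType d') (P' : probability T' R)
          (W : R -> T' -> R) (Z' : T' -> R),
   same_law P Z P' Z' -> BM_indep_of P' W Z' ->
   cvg_dist_skorohod P
     (fun n w t =>
        let m := Num.truncn (n%:R + n%:R `^ gamma * t) in
        n%:R `^ (gamma / 2) * expR (c * alpha * t) * (Zi m i w - avg Zi m w))
     P'
     (fun w t =>
        W ((1 - N%:R^-1) * (c * Z' w * (1 - Z' w)) / (2 * alpha)
             * expR (2 * c * alpha * t)) w)) /\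
  (gamma = 1 -> 1 < 2 * c * alpha ->
   forall (d' : measure_display) (T' : measurableType d') (P' : probability T' R)
          (W : R -> T' -> R) (Z' : T' -> R),
   same_law P Z P' Z' -> BM_indep_of P' W Z' ->
   cvg_dist_skorohod P
     (fun n w t =>
        let m := Num.truncn (n%:R + n%:R * t) in
        Num.sqrt n%:R * (1 + t) `^ (c * alpha) * (Zi m i w - avg Zi m w))
     P'
     (fun w t =>
        W ((1 - N%:R^-1) * (c ^+ 2 * Z' w * (1 - Z' w)) / (2 * c * alpha - 1)
             * (1 + t) `^ (2 * c * alpha - 1)) w)).
Proof.
move=> N_gt0 alpha01 r01 gamma_half c_gt0 Gr model _ _ _ mZ aeZ.
have alpha_gt0 : 0 < alpha by case/andP: alpha01.
have gamma01 : 0 < gamma <= 1.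
  by case/andP: gamma_half => h ->; rewrite andbT (lt_trans _ h)// invr_gt0.
split=> [gamma_lt1|gamma1 rate1] d' T' P' W Z' ZZ' BM.
  have gamma_neq1 : (gamma == 1) = false by rewrite lt_eqF.
  have rate_gt0 : 0 < 2 * c * alpha - crit gamma.
    by rewrite /crit gamma_neq1 subr0 !mulr_gt0.
  apply: (deviation_cvg_dist N_gt0 alpha01 gamma01 c_gt0 r01 Gr rate_gt0 model mZ aeZ
    (i := i) ZZ' BM).
    apply: nearW => n w t t0; rewrite /dev /time_index /speed /phi /tau gamma_neq1.
    by rewrite powRrM -powR12_sqrt ?powR_ge0.
  move=> w t t0; congr (W _ w).
  have E : expR (c * alpha * t) ^+ 2 = expR (2 * c * alpha * t).
    by rewrite expr2 -expRD; congr expR; ring.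
  rewrite /kappa /clock /phi /tau /crit gamma_neq1 subr0 mulr1 E.
  by field; rewrite !gt_eqF// ltr0n.
have rate_gt0 : 0 < 2 * c * alpha - crit gamma.
  by rewrite /crit gamma1 eqxx subr_gt0.
apply: (deviation_cvg_dist N_gt0 alpha01 gamma01 c_gt0 r01 Gr rate_gt0 model mZ aeZ
  (i := i) ZZ' BM).
  apply: nearW => n w t t0; rewrite /dev /time_index /speed /phi /tau gamma1 eqxx powRr1//.
  (* Since 1 + t > 0, the power is exp(c alpha ln (1 + t)), that is [phi t]. *)
  by rewrite /powR gt_eqF// ltr_pwDl.
move=> w t t0; congr (W _ w).
have t1 : 1 + t != 0 by rewrite gt_eqF// ltr_pwDl.
have t1' : 0 < 1 + t by rewrite ltr_pwDl.
rewrite /kappa /clock /phi /tau /crit gamma1 eqxx.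
rewrite (_ : (1 + t) `^ (2 * c * alpha - 1) = expR (c * alpha * ln (1 + t)) ^+ 2 / (1 + t)).
  by field; rewrite t1 !gt_eqF ?ltr0n// subr_gt0.
have -> : (1 + t)^-1 = expR (- ln (1 + t)) by rewrite expRN lnK ?posrE.
by rewrite /powR (negbTE t1) expr2 -!expRD; congr expR; ring.
Qed.
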